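(* Let $d\ge 1$, let $U\subset\mathbb{R}^d$ be an open bounded connected set of diameter $h_U$, and let $l\ge 0$ be an integer. Assume that $U$ is star-shaped with respect to every point in a ball of radius $\varrho h_U$ for some $\varrho>0$. Let $s\in\{1,\ldots,l+1\}$ and $p\in[1,+\infty]$. Then there exists a real number $C>0$ depending only on $d$, $\varrho$, $l$, $s$, and $p$ such that, for all $m\in\{0,\ldots,s\}$ and all $v\in W^{s,p}(U)$, $$|v-\pi_U^{1,l}v|_{W^{m,p}(U)}\le C\,h_U^{s-m}\,|v|_{W^{s,p}(U)},$$ where $\pi_U^{1,l}$ is the elliptic projector on $\mathbb{P}^l(U)$.
   Context: For an integer $s\ge 0$ and $p\in[1,+\infty]$, $W^{s,p}(U)$ is the space of functions with derivatives up to order $s$ in $L^p(U)$, with seminorm $|v|_{W^{s,p}(U)}=\sum_{\alpha\in\mathbb{N}^d,\ \alpha_1+\cdots+\alpha_d=s}\|\partial^\alpha v\|_{L^p(U)}$ (so $|v|_{W^{0,p}(U)}=\|v\|_{L^p(U)}$). $\mathbb{P}^l(U)$ is the space of (restrictions to $U$ of) $d$-variate polynomials of total degree at most $l$. The elliptic projector $\pi_U^{1,l}:W^{1,1}(U)\to\mathbb{P}^l(U)$ maps $v\in W^{1,1}(U)$ to the unique polynomial $\pi_U^{1,l}v\in\mathbb{P}^l(U)$ such that $\int_U\nabla\pi_U^{1,l}v\cdot\nabla w=\int_U\nabla v\cdot\nabla w$ for all $w\in\mathbb{P}^l(U)$ and $\int_U(\pi_U^{1,l}v-v)=0$. *)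

(* Defs.v *)
From HB Require Import structures.
From mathcomp Require Import all_boot all_order all_algebra.
(* The notations of mpoly clash with those of MathComp-Analysis; mpoly also
   rebinds names such as [isMeasure], hence the order of the imports. *)
From mathcomp Require mpoly.
Import -(notations) mpoly.
From mathcomp Require Import all_classical all_reals all_analysis.

Set Implicit Arguments.
Unset Strict Implicit.
Unset Printing Implicit Defensive.
Import Order.TTheory GRing.Theory Num.Theory numFieldNormedType.Exports.
Local Open Scope classical_set_scope.
Local Open Scope ring_scope.

Fact rV_display : measure_display. Proof. exact: default_measure_display. Qed.

(* ['rV[R]_n] carries the sigma-algebra generated by the coordinates, i.e. its
   Borel sigma-algebra. *)
Section measurable_rV.
Variables (R : realType) (n : nat).

Let coord (i : 'I_n) (x : 'rV[R]_n) : R := x ord0 i.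

Let rV_set0 : g_sigma_preimage coord set0.
Proof. exact: sigma_algebra0. Qed.

Let rV_setC A : g_sigma_preimage coord A -> g_sigma_preimage coord (~` A).
Proof. exact: sigma_algebraC. Qed.

Let rV_bigcup (F : _^nat) : (forall i, g_sigma_preimage coord (F i)) ->
  g_sigma_preimage coord (\bigcup_i (F i)).
Proof. exact: sigma_algebra_bigcup. Qed.

HB.instance Definition _ := @isMeasurable.Build rV_display
  'rV[R]_n (g_sigma_preimage coord) rV_set0 rV_setC rV_bigcup.

Lemma measurable_coord (i : 'I_n) :
  measurable_fun [set: 'rV[R]_n] (fun x : 'rV[R]_n => x ord0 i).
Proof.
move=> _ Y mY; rewrite setTI; apply: sub_sigma_algebra => /=.
rewrite -bigcup_seq/=; exists i => /=; first by rewrite mem_index_enum.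
by exists Y => //; rewrite setTI.
Qed.

Lemma measurable_fun_coordP d (T : measurableType d) (f : T -> 'rV[R]_n) :
  (forall i, measurable_fun [set: T] (fun t => f t ord0 i)) ->
  measurable_fun [set: T] f.
Proof.
move=> mf; have sub : g_sigma_preimage (fun i => coord i \o f) `<=` measurable.
  apply: smallest_sub; first exact: sigma_algebra_measurable.
  by rewrite -bigcup_seq; apply: bigcup_sub => i _ A [B mB <-]; exact: mf.
move=> _ A mA; rewrite setTI; apply: sub.
by rewrite g_sigma_preimage_comp; exists A => //; rewrite setTI.
Qed.

Lemma measurable_box (A : 'I_n -> set R) : (forall i, measurable (A i)) ->
  measurable [set x : 'rV[R]_n | forall i, A i (x ord0 i)].
Proof.
move=> mA; rewrite [X in measurable X](_ : _ =
    \big[setI/setT]_(i <- index_enum 'I_n) (coord i @^-1` A i)).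
  apply: bigsetI_measurable => i _; rewrite -[X in measurable X]setTI.
  exact: measurable_coord.
rewrite -bigcap_seq; apply/seteqP; split => x /= Ax i; first by move=> _.
exact/Ax/mem_index_enum.
Qed.

End measurable_rV.

Section lebesgue_rV.
Variable R : realType.

Definition cons_rV n (x : measurableTypeR R * 'rV[R]_n) : 'rV[R]_n.+1 :=
  \row_i oapp (x.2 ord0) x.1 (unlift ord0 i).

Definition uncons_rV n (x : 'rV[R]_n.+1) : measurableTypeR R * 'rV[R]_n :=
  (x ord0 ord0, \row_i x ord0 (lift ord0 i)).

Lemma cons_rVK n : cancel (@cons_rV n) (@uncons_rV n).
Proof.
move=> [x y]; rewrite /uncons_rV /cons_rV mxE unlift_none/=; congr pair.
by apply/rowP => i; rewrite !mxE liftK.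
Qed.

Lemma measurable_cons_rV n : measurable_fun setT (@cons_rV n).
Proof.
apply: measurable_fun_coordP => i.
under eq_fun do rewrite mxE; case: unliftP => [j _|_] /=.
  exact: (measurableT_comp (measurable_coord j) measurable_snd).
exact: measurable_fst.
Qed.

Lemma measurable_uncons_rV n : measurable_fun setT (@uncons_rV n).
Proof.
apply: measurable_fun_pair; first exact: measurable_coord.
apply: measurable_fun_coordP => i; under eq_fun do rewrite mxE.
exact: measurable_coord.
Qed.

HB.instance Definition _ n := isMeasurableFun.Build _ _ _ _ (@cons_rV n)
  (@measurable_cons_rV n).

Section step.
Variables (n : nat) (m : {sigma_finite_measure set 'rV[R]_n -> \bar R}).
Local Open Scope ereal_scope.

Definition lebesgueS : set 'rV[R]_n.+1 -> \bar R :=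
  pushforward (@lebesgue_measure R \x m) (@cons_rV n).

Let lebesgueS0 : lebesgueS set0 = 0.
Proof. exact: measure0. Qed.

Let lebesgueS_ge0 A : 0 <= lebesgueS A.
Proof. exact: measure_ge0. Qed.

Let lebesgueS_sigma_additive : semi_sigma_additive lebesgueS.
Proof. exact: measure_semi_sigma_additive. Qed.

HB.instance Definition _ := isMeasure.Build _ _ _ lebesgueS
  lebesgueS0 lebesgueS_ge0 lebesgueS_sigma_additive.

Let lebesgueS_sigma_finite : sigma_finite setT lebesgueS.
Proof.
have /sigma_finiteP[F [TF ndF Foo]] := sigma_finiteT (@lebesgue_measure R).
have /sigma_finiteP[G [TG ndG Goo]] := sigma_finiteT m.
exists (fun k => @uncons_rV n @^-1` (F k `*` G k)).
  rewrite -preimage_bigcup; apply/esym/seteqP; split => // x _.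
  have : setT (uncons_rV x) by [].
  rewrite -setXTT TF TG => -[[i _ Fi] [j _ Gj]].
  exists (maxn i j) => //; split.
  - by move: Fi; exact/subsetPset/ndF/leq_maxl.
  - by move: Gj; exact/subsetPset/ndG/leq_maxr.
move=> k; have [[mF Fk] [mG Gk]] := (Foo k, Goo k); split.
  rewrite -[X in measurable X]setTI; apply: measurable_uncons_rV => //.
  exact: measurableX.
rewrite /lebesgueS /pushforward -comp_preimage.
rewrite (_ : _ \o _ = id) ?preimage_id; last exact/funext/cons_rVK.
by rewrite product_measure1E// lte_mul_pinfty// ge0_fin_numE.
Qed.

HB.instance Definition _ := Measure_isSigmaFinite.Build _ _ _ lebesgueS
  lebesgueS_sigma_finite.

End step.

(* Iterated product of the one-dimensional Lebesgue measure, transported to row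
   vectors; [lebesgue_rV_box] gives its value on boxes, which determines it. *)
Fixpoint lebesgue_rV (n : nat) : {sigma_finite_measure set 'rV[R]_n -> \bar R} :=
  if n is k.+1 then lebesgueS (lebesgue_rV k) else \d_(0 : 'rV[R]_0).

Lemma lebesgue_rV_box n (A : 'I_n -> set R) : (forall i, measurable (A i)) ->
  lebesgue_rV n [set x | forall i, A i (x ord0 i)]
  = (\prod_(i < n) @lebesgue_measure R (A i))%E.
Proof.
elim: n A => [|n IHn] A mA.
  by rewrite big_ord0 /= diracE mem_set// => -[].
rewrite big_ord_recl -IHn//= -product_measure1E//; last 2 first.
- exact: mA.
- exact: measurable_box (fun i => mA (lift ord0 i)).
congr product_measure1; apply/seteqP; split => -[a y] /=.
  move=> Ay; split=> [|i]; first by have := Ay ord0; rewrite mxE unlift_none.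
  by have := Ay (lift ord0 i); rewrite mxE liftK.
move=> [Aa Ay] i; rewrite mxE; case: unliftP => [j ->|->] //=.
Qed.
End lebesgue_rV.

Section geometry.
Context {R : realType} {d : nat}.
Implicit Types (x y : 'rV[R]_d) (U : set 'rV[R]_d).

(* The norm [`|x|] that the library puts on ['rV[R]_d] is the max norm. *)
Definition enorm x : R := Num.sqrt (\sum_i x ord0 i ^+ 2).

Definition diam U : R := sup [set enorm (x - y) | x in U & y in U].

Definition star_shaped_at U y :=
  forall x t, U x -> 0 <= t <= 1 -> U ((1 - t) *: y + t *: x).

Definition star_shaped_ball U (r : R) :=
  exists c, forall y, enorm (y - c) < r -> star_shaped_at U y.

End geometry.

Section sobolev.
Context {R : realType} {d : nat}.
Implicit Types (U : set 'rV[R]_d) (f g v phi : 'rV[R]_d -> R) (a : multinom d).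
Implicit Types (p : \bar R).

Local Notation mu := (lebesgue_rV R d).

Definition partial (i : 'I_d) f : 'rV[R]_d -> R :=
  fun x => 'D_(delta_mx ord0 i) f x.

(* The order in which the derivatives are taken is irrelevant for the smooth
   functions to which [partialm] is applied. *)
Definition partialm a f : 'rV[R]_d -> R :=
  foldr (fun i g => iter (a i) (partial i) g) f (enum 'I_d).

Definition smooth f := forall s : seq 'I_d,
  let g := foldr partial f s in
  continuous g /\ forall x i, derivable g x (delta_mx ord0 i).

Definition test_function U phi :=
  [/\ smooth phi, compact (closure [set x | phi x != 0])
    & closure [set x | phi x != 0] `<=` U].

Definition loc_integrable U f := measurable_fun U f /\
  forall K, K `<=` U -> compact K -> (\int[mu]_(x in K) `|f x|%:E < +oo)%E.

Definition is_wderiv U a v g :=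
  [/\ loc_integrable U v, loc_integrable U g &
    forall phi, test_function U phi ->
      \int[mu]_(x in U) (v x * partialm a phi x)
      = (-1) ^+ mdeg a * \int[mu]_(x in U) (g x * phi x)].

(* A representative of the weak derivative, which is unique up to
   a null set when it exists. *)
Definition wderiv U a v : 'rV[R]_d -> R := xget (cst 0) (is_wderiv U a v).

(* [f \_ U] extends by zero the restriction of [f] to [U]. *)
Definition Lp_norm U p f : \bar R := 'N[mu]_p[EFin \o (f \_ U)].

(* Elements of W^{s,p}(U) are Borel functions on [U], not classes; their values
   outside [U] are irrelevant. *)
Definition sobolev U (s : nat) p : set ('rV[R]_d -> R) :=
  [set v | forall a, (mdeg a <= s)%N ->
    exists2 g, is_wderiv U a v g & (Lp_norm U p g < +oo)%E].

(* [bmultinom d s.+1] is the finite type of multi-indices of order at most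
   [s]. *)
Definition sobolev_seminorm U (s : nat) p v : \bar R :=
  (\sum_(a : bmultinom d s.+1 | mdeg a == s) Lp_norm U p (wderiv U a v))%E.

(* [msize q <= l.+1] says that the total degree of [q] is at most [l]. *)
Definition poly_space (l : nat) : set ('rV[R]_d -> R) :=
  [set f | exists2 q : mpoly d R, (msize q <= l.+1)%N
                                & f = fun x : 'rV[R]_d => meval (x ord0) q].

Definition is_elliptic_proj U (l : nat) v : set ('rV[R]_d -> R) :=
  [set q | [/\ poly_space l q,
    forall w, poly_space l w ->
      \int[mu]_(x in U) (\sum_i partial i q x * partial i w x)
      = \int[mu]_(x in U) (\sum_i wderiv U (mnm1 i) v x * partial i w x) &
    \int[mu]_(x in U) (q x - v x) = 0]].

(* For v in W^{1,1}(U) the projection exists and is unique (as soon as [U] is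
   nonempty, since a polynomial is determined by its restriction to [U]). *)
Definition elliptic_proj U (l : nat) v : 'rV[R]_d -> R :=
  xget (cst 0) (is_elliptic_proj U l v).

End sobolev.

(* Main.v *)
Require Import Defs.
From HB Require Import structures.
From mathcomp Require Import all_boot all_order all_algebra.
From mathcomp Require mpoly.
Import -(notations) mpoly.
From mathcomp Require Import all_classical all_reals all_analysis.
From mathcomp Require Import measurable_realfun ess_sup_inf.
From mathcomp Require Import ring lra zify.

Set Implicit Arguments.
Unset Strict Implicit.
Unset Printing Implicit Defensive.
Import Order.TTheory GRing.Theory Num.Theory numFieldNormedType.Exports.
Local Open Scope classical_set_scope.
Local Open Scope ring_scope.

(* U is star-shaped with respect to every point of a cube E of edge
   comparable to h_U. For v with weak gradient g, a.e. segment from z in E to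
   x in U satisfies v(x) - v(z) = int_0^1 g(z + t(x - z)) . (x - z) dt.
   Averaging over z in E and changing variables (in z for t < 1/2, in x for
   t >= 1/2) gives a Poincare inequality, with an explicit constant, for the
   functions of zero mean on U. Let Q be the polynomial of degree < s such that
   all derivatives of v - Q of order < s have zero mean on U: iterating the
   Poincare inequality bounds the derivatives of v - Q by |v|_{W^{s,p}}.
   By Galerkin orthogonality r = pi v - Q satisfies
   int |grad r|^2 = int grad (v - Q) . grad r, and since
   sup_U |d^b q| <= C h_U^{-|b|} |U|^{-1} int_U |q| for polynomials q of bounded
   degree, this bounds the derivatives of r of order >= 1 by the L^1 norm of
   grad (v - Q). For order 0, pi v - v has zero mean, and the
   Poincare inequality reduces to order 1. *)

(** * Boxes and Borel sets of row vectors *)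

(** The constant may depend on U only through [rho], so neither compactness on U nor approximation
    by functions smooth up to its boundary can be used. Hence the Poincare constant is computed
    explicitly, and the equivalence of norms on polynomials is established on the unit cube only,
    then carried to U by scaling. The cube E stands in for the ball because Lebesgue measure is
    explicit on boxes.

    For a fixed displacement e, the identity along segments is proved by duality: it is tested
    against products of one-variable bumps, for which translation and differentiation along e are
    classical, so v itself is never regularized. The exceptional null set depends on e; this is why
    pairs (z, e) are averaged before a good z is selected.

    Galerkin orthogonality is an L^2 relation while the data are in L^p. The passage is possible
    because grad r is polynomial: its sup norm is controlled by its L^1 norm, so only the L^1 norm
    of grad (v - Q) is needed. Hoelder relates L^1 to L^p, and the norm of the constant 1 that it
    introduces cancels against the one produced when a sup bound is turned back into an L^p bound,
    uniformly in p. *)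

Section boxes.
Variables (R : realType) (n : nat).
Implicit Types (a b : 'rV[R]_n) (U : set 'rV[R]_n).
Local Notation mu := (lebesgue_rV R n).

Definition obox a b : set 'rV[R]_n :=
  [set x | forall i, a ord0 i < x ord0 i < b ord0 i].
Definition cbox a b : set 'rV[R]_n :=
  [set x | forall i, a ord0 i <= x ord0 i <= b ord0 i].

Lemma obox_itv a b :
  obox a b = [set x | forall i, `]a ord0 i, b ord0 i[%classic (x ord0 i)].
Proof. by apply/seteqP; split=> x /= h i; have := h i; rewrite in_itv. Qed.

Lemma cbox_itv a b :
  cbox a b = [set x | forall i, `[a ord0 i, b ord0 i]%classic (x ord0 i)].
Proof. by apply/seteqP; split=> x /= h i; have := h i; rewrite in_itv. Qed.

Lemma measurable_obox a b : measurable (obox a b).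
Proof. by rewrite obox_itv; exact: (measurable_box (fun i => measurable_itv _)). Qed.

Lemma measurable_cbox a b : measurable (cbox a b).
Proof. by rewrite cbox_itv; exact: (measurable_box (fun i => measurable_itv _)). Qed.

Lemma obox_sub_cbox a b : obox a b `<=` cbox a b.
Proof. by move=> x h i; have /andP[/ltW-> /ltW->] := h i. Qed.

Lemma lebesgue_obox a b : (forall i, a ord0 i <= b ord0 i) ->
  mu (obox a b) = (\prod_(i < n) (b ord0 i - a ord0 i))%:E.
Proof.
move=> ab; rewrite obox_itv.
rewrite [LHS](lebesgue_rV_box (fun i => measurable_itv _)) -prodEFin.
apply: eq_bigr => i _; rewrite lebesgue_measure_itv/= lte_fin.
have := ab i; rewrite le_eqVlt => /predU1P[->|->//].
by rewrite ltxx subrr.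
Qed.

Lemma lebesgue_cbox_lty a b : (mu (cbox a b) < +oo)%E.
Proof.
have sub : cbox a b `<=` obox (\row_i (Num.min (a ord0 i) (b ord0 i) - 1))
     (\row_i (Num.max (a ord0 i) (b ord0 i) + 1)).
  move=> x h i; rewrite !mxE; have /andP[h1 h2] := h i.
  rewrite (lt_le_trans _ h1) ?(le_lt_trans h2)//.
    by rewrite ltr_pwDr// le_max lexx orbT.
  by rewrite ltrBlDr ltr_pwDr// ge_min lexx.
apply: (le_lt_trans (le_measure mu _ _ sub)); rewrite ?inE.
- exact: measurable_cbox.
- exact: measurable_obox.
rewrite [ltLHS]lebesgue_obox ?ltry// => i; rewrite !mxE.
have : Num.min (a ord0 i) (b ord0 i) <= Num.max (a ord0 i) (b ord0 i).
  by rewrite (@le_trans _ _ (a ord0 i))// ?ge_min ?le_max lexx.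
lra.
Qed.

Lemma oboxI a b a' b' : obox a b `&` obox a' b' =
  obox (\row_i Num.max (a ord0 i) (a' ord0 i))
       (\row_i Num.min (b ord0 i) (b' ord0 i)).
Proof.
apply/seteqP; split=> x /=.
  move=> [h h'] i; rewrite !mxE gt_max lt_min.
  by have /andP[-> ->] := h i; have /andP[-> ->] := h' i.
move=> h; split=> i; have := h i; rewrite !mxE gt_max lt_min;
  by move=> /andP[/andP[? ?] /andP[? ?]]; apply/andP.
Qed.

(** Lower corner of the cube with rational centre [q.1] and half-edge [1 / (q.2 + 1)]; these
    parameters form a countable type. *)
Definition rlo (q : 'rV[rat]_n * nat) : 'rV[R]_n := \row_i (ratr (q.1 ord0 i) - q.2.+1%:R^-1).
Definition rhi (q : 'rV[rat]_n * nat) : 'rV[R]_n := \row_i (ratr (q.1 ord0 i) + q.2.+1%:R^-1).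

(** The open cubes are selected by their closures, so that each of them carries test functions of
    [U]. Countability of the family serves both measurability and the gluing of almost-everywhere
    statements. *)
Lemma open_rV_bigcup U : open U ->
  U = \bigcup_(q in [set q | cbox (rlo q) (rhi q) `<=` U]) obox (rlo q) (rhi q).
Proof.
move=> oU; apply/seteqP; split; last first.
  by move=> x [q qU /obox_sub_cbox]; exact: qU.
move=> x Ux; have /nbhs_ballP[e /= e0 eU] : nbhs x U by exact: open_nbhs_nbhs.
(* The centre is taken within [r] of [x] and the cube extends [r] further, hence the requirement
   [2 * r < e]. *)
have [k ke] : exists k, 0 + k.+1%:R^-1 < e / 2.
  by apply: ltr_add_invr; rewrite divr_gt0.
rewrite add0r in ke; have : 0 < k.+1%:R^-1 :> R by rewrite invr_gt0 ltr0n.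
move: ke; set r : R := k.+1%:R^-1 => re r0.
have /choice[q hq] : forall i, exists q, ratr q \in `](x ord0 i - r), (x ord0 i + r)[.
  by move=> i; apply: rat_in_itvoo; lra.
exists (\row_i q i, k); last first.
  by move=> i; rewrite !mxE/= -/r; have := hq i; rewrite in_itv/=; lra.
move=> y /= h; apply: eU; rewrite -ball_normE/=.
rewrite [ltLHS]mx_normrE bigmax_lt// => -[i0 i] _ /=; rewrite !mxE (ord1 i0).
rewrite ltr_norml; have := h i; rewrite !mxE/= -/r; have := hq i; rewrite in_itv/=; lra.
Qed.

Lemma open_measurable_rV U : open U -> measurable U.
Proof.
move=> /open_rV_bigcup->; rewrite bigcup_mkcond.
apply: countable_bigcupT_measurable; first exact: countableP.
by move=> q; case: ifP => // _; exact: measurable_obox.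
Qed.

Lemma closed_measurable_rV U : closed U -> measurable U.
Proof.
move=> cU; rewrite -[U]setCK; apply: measurableC; apply: open_measurable_rV.
exact: closed_openC.
Qed.

Lemma continuous_measurable_rV (f : 'rV[R]_n -> R) : continuous f -> measurable_fun setT f.
Proof.
move=> /continuousP cf; apply: (measurability _ (measurable_realfun.RGenOpens.measurableE R)).
move=> _ [_ [a [b ->] <-]]; rewrite setTI; apply: open_measurable_rV.
by apply: cf; exact: interval_open.
Qed.

(** Open boxes are stable under intersection, they generate the Borel sets because every open set is
    a countable union of them, and the cubes of half-edge [k] exhaust the space with finite
    measure. *)
Lemma rV_measure_unique (m1 m2 : {measure set 'rV[R]_n -> \bar R}) :
  (forall a b, m1 (obox a b) = m2 (obox a b)) ->
  (forall a b, m1 (obox a b) < +oo)%E ->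
  forall A, measurable A -> m1 A = m2 A.
Proof.
move=> m12 m1oo.
pose G := [set A | exists ab : 'rV[R]_n * 'rV[R]_n, A = obox ab.1 ab.2].
apply: (measure_unique G (fun k : nat => obox (const_mx (- k%:R)) (const_mx k%:R))).
- apply/seteqP; split; last first.
    by apply: smallest_sub; [exact: sigma_algebra_measurable|
      move=> _ [ab ->]; exact: measurable_obox].
  apply: smallest_sub; first exact: smallest_sigma_algebra.
  have oG U : open U -> <<s G >> U.
    move=> oU; rewrite (open_rV_bigcup oU) bigcup_mkcond.
    apply: (@countable_bigcupT_measurable _ (g_sigma_algebraType G)).
      exact: countableP.
    move=> q; case: ifP => _; last exact: (@measurable0 _ (g_sigma_algebraType G)).
    by apply: sub_sigma_algebra; exists (rlo q, rhi q).
  move=> A; rewrite -bigcup_seq => -[i _ [Y mY <-]]; rewrite setTI.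
  suff : measurable_fun (setT : set (g_sigma_algebraType G))
     (fun x : g_sigma_algebraType G => (x : 'rV[R]_n) ord0 i).
    by move=> /(_ measurableT _ mY); rewrite setTI.
  apply: (measurability _ (measurable_realfun.RGenOpens.measurableE R)).
  move=> _ [_ [u [v ->] <-]]; rewrite setTI; apply: oG.
  by have /continuousP := @coord_continuous R 1 n ord0 i; apply; exact: interval_open.
- by move=> _ _ [p ->] [q ->]; rewrite oboxI; eexists (_, _).
- by move=> k; exists (const_mx (- k%:R), const_mx k%:R).
- apply/seteqP; split => // x _; exists (Num.truncn `|x|).+1 => // i; rewrite !mxE -ltr_norml.
  apply: (le_lt_trans _ (truncnS_gt _)).
  rewrite [leRHS]mx_normrE; exact: (le_bigmax _ (fun ij : 'I_1 * 'I_n => `|x ij.1 ij.2|) (ord0, i)).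
- by move=> _ [ab ->]; exact: m12.
- by move=> k; exact: m1oo.
Qed.
End boxes.

(** * Affine changes of variables *)

Section measurable_ops.
Variables (R : realType) (n : nat) (d : measure_display) (T : measurableType d).
Implicit Types (f g : T -> 'rV[R]_n).

Lemma measurable_coord_comp f i : measurable_fun setT f ->
  measurable_fun setT (fun t => f t ord0 i).
Proof. exact: measurableT_comp (measurable_coord i). Qed.

Lemma measurable_rVD f g : measurable_fun setT f -> measurable_fun setT g ->
  measurable_fun setT (fun t => f t + g t).
Proof.
move=> mf mg; apply: measurable_fun_coordP => i; under eq_fun do rewrite mxE.
by apply: measurable_funD; exact: measurable_coord_comp.
Qed.

Lemma measurable_rVZ (r : T -> R) f : measurable_fun setT r -> measurable_fun setT f ->
  measurable_fun setT (fun t => r t *: f t).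
Proof.
move=> mf mg; apply: measurable_fun_coordP => i; under eq_fun do rewrite mxE.
by apply: measurable_funM => //; exact: measurable_coord_comp.
Qed.
End measurable_ops.

Section affine.
Variables (R : realType) (n : nat).
Local Notation mu := (lebesgue_rV R n).
Implicit Types (a : R) (c : 'rV[R]_n).

Definition aff (a : R) (c : 'rV[R]_n) (x : 'rV[R]_n) : 'rV[R]_n := c + a *: x.

Lemma measurable_aff a c : measurable_fun setT (aff a c).
Proof.
apply: measurable_rVD; first exact: measurable_cst.
by apply: measurable_rVZ; [exact: measurable_cst|exact: measurable_id].
Qed.

HB.instance Definition _ a c := isMeasurableFun.Build _ _ _ _ (aff a c) (measurable_aff a c).

Lemma aff_obox a c (u v : 'rV[R]_n) : a != 0 -> (forall i, u ord0 i <= v ord0 i) ->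
  aff a c @^-1` obox u v =
  obox (\row_i Num.min ((u ord0 i - c ord0 i) / a) ((v ord0 i - c ord0 i) / a))
       (\row_i Num.max ((u ord0 i - c ord0 i) / a) ((v ord0 i - c ord0 i) / a)).
Proof.
move=> a0 uv; apply/seteqP; split=> x /= h i; have := h i; have := uv i;
  rewrite !mxE; move: (u _ _) (v _ _) (c _ _) (x _ _) => {h uv}u {}v {}c {}x uv;
  have [a0'|a0'|a0'] := ltgtP a 0; try (by rewrite a0' eqxx in a0);
  rewrite gt_min lt_max ?(ltr_ndivlMr _ _ a0') ?(ltr_ndivrMr _ _ a0')
    ?(ltr_pdivlMr _ _ a0') ?(ltr_pdivrMr _ _ a0').
- by move=> /andP[h1 h2]; apply/andP; split; apply/orP; [right|left]; lra.
- by move=> /andP[h1 h2]; apply/andP; split; apply/orP; [left|right]; lra.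
- by move=> /andP[/orP[] ? /orP[] ?]; apply/andP; split; lra.
- by move=> /andP[/orP[] ? /orP[] ?]; apply/andP; split; lra.
Qed.

(** Both sides are measures in [A], so the comparison is needed on boxes only, where it is a product
    of one-dimensional scalings. *)
Lemma lebesgue_aff a c (A : set 'rV[R]_n) : a != 0 -> measurable A ->
  mu (aff a c @^-1` A) = ((`|a| ^+ n)^-1%:E * mu A)%E.
Proof.
move=> a0 mA.
have a0' : 0 < `|a| by rewrite normr_gt0.
have k0 : 0 <= (`|a| ^+ n)^-1 by rewrite invr_ge0 exprn_ge0.
pose m1 : {measure set 'rV[R]_n -> \bar R} := mscale (NngNum k0) mu.
have mm := measurable_aff a c.
pose m2 : {measure set 'rV[R]_n -> \bar R} := pushforward mu (aff a c).
suff : m2 mm A = m1 A by [].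
have E u v : m2 mm (obox u v) = m1 (obox u v).
  (* Boxes with corners in the wrong order are empty and treated apart: the [min] and [max] of
     [aff_obox] would reorder the corners and could give a nonempty box. *)
  have [uv|/existsNP[i /negP]] := pselect (forall i, u ord0 i <= v ord0 i).
    rewrite /m2 /= /pushforward aff_obox// /m1 /mscale/=.
    rewrite [LHS]lebesgue_obox; last first.
      move=> i; rewrite !mxE.
      by rewrite (@le_trans _ _ ((u ord0 i - c ord0 i) / a))// ?ge_min ?le_max lexx.
    rewrite [X in (_ * X)%E]lebesgue_obox// -EFinM; congr EFin.
    rewrite -exprVn -[X in _ ^+ X]card_ord -prodr_const -big_split/=.
    apply: eq_bigr => i _; rewrite !mxE maxr_absE minr_absE.
    rewrite [LHS](_ : _ = `|(u ord0 i - c ord0 i) / a - (v ord0 i - c ord0 i) / a|).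
      rewrite -mulrBl normrM normfV mulrC; congr (_ * _).
      by rewrite distrC ger0_norm ?subr_ge0 ?lerD2r//; ring.
    by field.
  rewrite -ltNge => vu.
  have -> : obox u v = set0.
    by rewrite -subset0 => x /(_ i) /andP[h1 h2]; have := lt_trans vu (lt_trans h1 h2); rewrite ltxx.
  by rewrite !measure0.
apply: rV_measure_unique => // u v; rewrite E /m1/= /mscale/= lte_mul_pinfty//.
by rewrite (le_lt_trans (le_measure _ _ _ (@obox_sub_cbox _ _ _ _)))// ?inE;
  [exact: measurable_obox|exact: measurable_cbox|exact: lebesgue_cbox_lty].
Qed.

Lemma ge0_integral_aff a c (f : 'rV[R]_n -> \bar R) : a != 0 ->
  measurable_fun setT f -> (forall x, 0 <= f x)%E ->
  (\int[mu]_x f (c + a *: x)%R = (`|a| ^+ n)^-1%:E * \int[mu]_x f x)%E.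
Proof.
move=> a0 mf f0.
have k0 : 0 <= (`|a| ^+ n)^-1 by rewrite invr_ge0 exprn_ge0.
rewrite -[LHS](@ge0_integral_pushforward _ _ _ _ _ _ (measurable_aff a c) mu setT f)//.
rewrite (eq_measure_integral (mscale (NngNum k0) mu)) ?ge0_integral_mscale//.
by move=> A mA _; exact: lebesgue_aff.
Qed.

Lemma ge0_integral_translation c (f : 'rV[R]_n -> \bar R) :
  measurable_fun setT f -> (forall x, 0 <= f x)%E ->
  (\int[mu]_x f (x + c)%R = \int[mu]_x f x)%E.
Proof.
move=> mf f0; have := @ge0_integral_aff 1 c f (oner_neq0 _) mf f0.
rewrite normr1 expr1n invr1 mul1e => <-.
by apply: eq_integral => x _; rewrite scale1r addrC.
Qed.

Lemma integrable_translation c (f : 'rV[R]_n -> \bar R) :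
  mu.-integrable setT f -> mu.-integrable setT (fun x => f (x + c)%R).
Proof.
move=> /integrableP[mf fi]; apply/integrableP; split.
  apply: (measurableT_comp (f := f)) => //; apply: measurable_rVD; first exact: measurable_id.
  exact: measurable_cst.
rewrite (ge0_integral_translation c (f := abse \o f))// => [|x]; last exact: abse_ge0.
exact: measurableT_comp.
Qed.

Lemma integral_translation c (f : 'rV[R]_n -> \bar R) : measurable_fun setT f ->
  (\int[mu]_x f (x + c)%R = \int[mu]_x f x)%E.
Proof.
move=> mf; rewrite integralE [RHS]integralE; congr (_ - _)%E.
  rewrite -(ge0_integral_translation c (f := funepos f))//; last first.
    exact: measurable_funepos.
  by apply: eq_integral => x _; rewrite !funeposE.
rewrite -(ge0_integral_translation c (f := funeneg f))//; last first.
    exact: measurable_funeneg.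
  by apply: eq_integral => x _; rewrite !funenegE.
Qed.
End affine.

(** * Smooth bump functions *)

Section smooth1.
Variable R : realType.
Implicit Types (f g : R -> R) (n : nat).

(** Only the existence of derivatives is recorded: under [Coo], each derivative is continuous
    because the next one exists. *)
Fixpoint Cn n f := if n is k.+1 then (forall x, derivable f x 1) /\ Cn k (derive1 f) else True.
Definition Coo f := forall n, Cn n f.

Lemma CnS n f g : (forall x : R, is_derive x 1 f (g x)) -> Cn n g -> Cn n.+1 f.
Proof.
move=> fg Cg; have E : (derive1 f) = g.
  by apply/funext => x; rewrite derive1E; have ? := fg x; exact: derive_val.
by split=> [x|]; [have ? := fg x; exact: ex_derive|rewrite E].
Qed.

Lemma CnSP n f (x : R) : Cn n.+1 f -> is_derive x 1 f ((derive1 f) x).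
Proof. by move=> -[df _]; rewrite derive1E; exact: derivableP. Qed.

Lemma CnW n f : Cn n.+1 f -> Cn n f.
Proof. by elim: n f => //= n IH f [df Cf]; split=> //; exact: IH. Qed.

Lemma Cn_cst n c : Cn n (cst c).
Proof.
elim: n c => // n IH c; by apply: (@CnS _ _ (cst 0)); exact: IH.
Qed.

Lemma CnD n f g : Cn n f -> Cn n g -> Cn n (f \+ g).
Proof.
elim: n f g => // n IH f g Cf Cg.
apply: (@CnS _ _ ((derive1 f) \+ (derive1 g))); last by apply: IH; [case: Cf|case: Cg].
by move=> x; have ? := CnSP x Cf; have ? := CnSP x Cg; exact: is_deriveD.
Qed.

Lemma CnM n f g : Cn n f -> Cn n g -> Cn n (f \* g).
Proof.
elim: n f g => // n IH f g Cf Cg.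
apply: (@CnS _ _ ((f \* (derive1 g)) \+ (g \* (derive1 f)))).
  by move=> x; have ? := CnSP x Cf; have ? := CnSP x Cg; exact: is_deriveM.
by apply: CnD; apply: IH; [exact: CnW|case: Cg|exact: CnW|case: Cf].
Qed.

Lemma Cn_affine n f c e : Cn n f -> Cn n (fun x => f (c * x + e)).
Proof.
elim: n f => // n IH f Cf.
apply: (@CnS _ _ (cst c \* (fun x => (derive1 f) (c * x + e)))).
  move=> x; have ? := CnSP (c * x + e) Cf.
  have d : is_derive x 1 (fun x : R => c * x + e) c.
    apply: (@is_derive_eq _ _ _ (c *: id \+ cst e)).
    by rewrite addr0 scaler1.
  by apply: (is_derive_eq (@is_derive1_comp _ f (fun x => c * x + e) x _ _ _ _)); rewrite /= mulrC.
by apply: CnM; [exact: Cn_cst|apply: IH; case: Cf].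
Qed.

Lemma CooM f g : Coo f -> Coo g -> Coo (f \* g).
Proof. by move=> Cf Cg n; exact: CnM. Qed.

Lemma Coo_affine f c e : Coo f -> Coo (fun x => f (c * x + e)).
Proof. by move=> Cf n; exact: Cn_affine. Qed.

Lemma Coo_derive1 f : Coo f -> Coo (derive1 f).
Proof. by move=> Cf n; have [] := Cf n.+1. Qed.

Lemma Coo_derive1n f k : Coo f -> Coo (derive1n k f).
Proof. by move=> Cf; elim: k => // k; exact: Coo_derive1. Qed.

Lemma Coo_is_derive f (x : R) : Coo f -> is_derive x 1 f ((derive1 f) x).
Proof. by move=> /(_ 1%N); exact: CnSP. Qed.

Lemma Coo_continuous f : Coo f -> continuous f.
Proof.
move=> Cf x; apply/differentiable_continuous; apply/derivable1_diffP.
by have [+ _] := Cf 1%N; apply.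
Qed.

(** The functions P(1/x) exp(-1/x), extended by 0 to x <= 0, form a class closed under
    differentiation, so a single derivative computation yields smoothness. *)
Definition pexp (P : {poly R}) (x : R) : R :=
  if 0 < x then P.[x^-1] * expR (- x^-1) else 0.

Lemma poly_growth (P : {poly R}) : exists2 C : R, 0 <= C &
  forall y, 1 <= y -> `|P.[y]| <= C * y ^+ size P.
Proof.
exists (\sum_(i < size P) `|P`_i|); first exact: sumr_ge0.
move=> y y1; rewrite horner_coef mulr_suml (le_trans (ler_norm_sum _ _ _))//.
apply: ler_sum => i _; rewrite normrM ler_wpM2l// ger0_norm.
  by rewrite ler_weXn2l// ltnW.
by rewrite exprn_ge0// (le_trans ler01).
Qed.

(** Quadratic decay at 0 is what forces the derivative at 0 to be 0. With y = 1/x, the term y^(N+2)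
    / (N+2)! of exp(y) beats the growth y^N of P. *)
Lemma pexp_flat P : exists2 C : R, 0 <= C &
  forall x, x <= 1 -> `|pexp P x| <= C * x ^+ 2.
Proof.
have [C C0 hC] := poly_growth P.
pose N := size P; exists (C * (N.+2)`!%:R); first by rewrite mulr_ge0.
move=> x x1; rewrite /pexp; case: ltP => [x0|_]; last first.
  by rewrite normr0 mulr_ge0 ?sqr_ge0// mulr_ge0.
set y := x^-1; have y1 : 1 <= y by rewrite /y invf_ge1.
have y0 : 0 < y by rewrite invr_gt0.
rewrite normrM [X in _ * X]gtr0_norm ?expR_gt0// expRN.
rewrite (le_trans (ler_wpM2r _ (hC y y1))) ?invr_ge0 ?expR_ge0//.
rewrite -!mulrA ler_wpM2l//.
have -> : x = y^-1 by rewrite /y invrK.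
rewrite ler_pdivrMr ?expR_gt0//.
have E := expR_ge1Dxn N.+1 (ltW y0).
have {}E : y ^+ N.+2 / (N.+2)`!%:R <= expR y by rewrite (le_trans _ E)// lerDr.
rewrite ler_pdivrMr ?ltr0n ?fact_gt0// in E.
have -> : y ^+ N = y^-1 ^+ 2 * y ^+ N.+2.
  by rewrite !exprS expr0 mulr1; field; rewrite gt_eqF.
have -> : (N.+2)`!%:R * y^-1 ^+ 2 * expR y = y^-1 ^+ 2 * (expR y * (N.+2)`!%:R) by ring.
by apply: ler_wpM2l => //; exact: sqr_ge0.
Qed.

Lemma is_derive_pexp P (x : R) :
  is_derive x 1 (pexp P) (pexp ((P - P^`()) * 'X^2)%R x).
Proof.
have [x0|x0|->] := ltgtP x 0.
- rewrite {2}/pexp ltNge (ltW x0)/=.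
  apply: (@near_eq_is_derive _ _ _ (cst (0:R))).
  near=> z; rewrite /pexp ltNge ifF//; apply/negbTE/negPn.
  by apply/ltW; near: z; exact: lt_nbhsl.
- rewrite {2}/pexp x0.
  pose f2 (z : R) : R := P.[z^-1] * expR (- z^-1).
  apply: (@near_eq_is_derive _ _ _ f2).
    by near=> z; rewrite /f2 /pexp ifT//; near: z; exact: lt_nbhsr.
  have xn0 : x != 0 by rewrite gt_eqF.
  have d1 : is_derive x 1 (fun z : R => z^-1) (- x ^- 2).
    have d0 := @is_deriveV R id x 1 1 xn0 (is_derive_id x 1).
    by apply: (is_derive_eq d0); rewrite scaler1.
  have d2 : is_derive x 1 (fun z : R => P.[z^-1]) (P^`().[x^-1] * - x ^- 2).
    exact: (@is_derive1_comp _ (horner P) (fun z => z^-1)).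
  have d3 : is_derive x 1 (fun z : R => expR (- z^-1)) (expR (- x^-1) * x ^- 2).
    have d4 : is_derive x 1 (fun z : R => - z^-1) (x ^- 2).
      have d0 := @is_deriveN _ _ _ _ _ _ _ d1.
      by apply: (is_derive_eq d0); rewrite opprK.
    exact: (@is_derive1_comp _ expR (fun z => - z^-1)).
  have d0 := @is_deriveM _ _ _ _ _ _ _ _ d2 d3.
  apply: (is_derive_eq d0).
  rewrite !hornerE /=  /GRing.scale/=; field.
  exact: xn0.
have [C C0 hC] := pexp_flat P.
rewrite {2}/pexp ltxx.
(* Caratheodory's criterion with slope [pexp P z / z]. Its value at 0 is 0 by the convention
   [0^-1 = 0], and [pexp_flat] makes it continuous there. *)
apply/is_derive1_caratheodory; exists (fun z => pexp P z / z); split.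
- move=> z; rewrite subr0 {2}/pexp ltxx subr0.
  have [->|z0] := eqVneq z 0; first by rewrite /pexp ltxx mulr0.
  by rewrite divfK.
- rewrite /prop_for /continuous_at /= invr0 mulr0.
  apply/cvgr0Pnorm_lt => /= e e0.
  near=> z.
  have [->|z0] := eqVneq z 0; first by rewrite invr0 mulr0 normr0.
  rewrite normrM normfV ltr_pdivrMr ?normr_gt0//.
  have z1 : z <= 1 by apply/ltW; near: z; apply: lt_nbhsl.
  apply: (le_lt_trans (hC z z1)).
  rewrite -(real_normK (num_real z)) expr2 mulrA ltr_pM2r ?normr_gt0//.
  have : `|z| < e / (C + 1).
    near: z; apply: (@cvgr0_norm_lt _ _ _ (nbhs (0:R)) _ id) => //.
    by rewrite divr_gt0// ltr_wpDl.
  rewrite ltr_pdivlMr ?ltr_wpDl//; apply: le_lt_trans.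
  by rewrite mulrC ler_wpM2l// lerDl.
- by rewrite invr0 mulr0.
Unshelve. all: by end_near. Qed.

Lemma Coo_pexp P : Coo (pexp P).
Proof.
move=> n; elim: n P => // n IH P.
by apply: CnS; [exact: is_derive_pexp|exact: IH].
Qed.

(** A smooth function vanishing outside ]a, b[ that tends to the indicator of ]a, b[ as [k] grows,
    since exp(-1/((k+1)u)) tends to 1 for every u > 0. The arguments are spelled as affine maps to
    match [Coo_affine]. *)
Definition bump1 (k : nat) (a b x : R) : R :=
  pexp 1 (k.+1%:R * x + - (k.+1%:R * a)) * pexp 1 (- k.+1%:R * x + k.+1%:R * b).

Lemma Coo_bump1 k a b : Coo (bump1 k a b).
Proof. by apply: CooM; apply: Coo_affine; exact: Coo_pexp. Qed.

Lemma pexp1_ge0_le1 x : 0 <= pexp 1 x <= 1.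
Proof.
rewrite /pexp hornerC mul1r; case: ifPn => [x0|_]; last by rewrite lexx ler01.
by rewrite expR_ge0 expR_le1// oppr_le0 invr_ge0 ltW.
Qed.

Lemma bump1_ge0_le1 k a b x : 0 <= bump1 k a b x <= 1.
Proof.
have /andP[h1 h2] := pexp1_ge0_le1 (k.+1%:R * x + - (k.+1%:R * a)).
have /andP[h3 h4] := pexp1_ge0_le1 (- k.+1%:R * x + k.+1%:R * b).
by rewrite /bump1 mulr_ge0// mulr_ile1.
Qed.

Lemma bump1_out k a b x : ~~ (a < x < b) -> bump1 k a b x = 0.
Proof.
have k0 : 0 < k.+1%:R :> R by rewrite ltr0n.
rewrite /bump1 /pexp -mulrBr pmulr_rgt0// subr_gt0.
have -> : - k.+1%:R * x + k.+1%:R * b = k.+1%:R * (b - x) by ring.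
rewrite pmulr_rgt0// subr_gt0.
by rewrite negb_and => /orP[] /negbTE->; rewrite ?mul0r ?mulr0.
Qed.

Lemma cvg_bump1 a b x : a < x < b -> bump1 k a b x @[k --> \oo] --> (1 : R).
Proof.
move=> /andP[ax xb].
have H u : 0 < u -> pexp 1 (k.+1%:R * u) @[k --> \oo] --> (1 : R).
  move=> u0; have -> : (fun k => pexp 1 (k.+1%:R * u)) = (fun k => expR (- (u^-1 * k.+1%:R^-1))).
    by apply/funext => k; rewrite /pexp hornerC mul1r pmulr_rgt0 ?ltr0n// u0 invfM mulrC.
  rewrite -[X in _ --> X]expR0; apply: continuous_cvg; first exact: continuous_expR.
  rewrite -[X in _ --> X]oppr0; apply: cvgN; rewrite -[X in _ --> X](mulr0 u^-1).
  apply: cvgM; first exact: cvg_cst.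
  exact: cvg_harmonic.
have -> : (fun k => bump1 k a b x) = (fun k => pexp 1 (k.+1%:R * (x - a)) * pexp 1 (k.+1%:R * (b - x))).
  apply/funext => k; rewrite /bump1; congr (pexp _ _ * pexp _ _); ring.
by rewrite -[X in _ --> X]mulr1; apply: cvgM; apply: H; rewrite subr_gt0.
Qed.
End smooth1.

Section lines.
Variables (R : realType) (n : nat).
Implicit Types (f : 'rV[R]_n -> R) (x v : 'rV[R]_n).

(** Directional derivatives thus become accessible to the one-variable chain rule and to the
    fundamental theorem of calculus. *)
Lemma is_derive_line f x v (t df : R) :
  is_derive t 1 (fun s : R => f (x + s *: v)) df <-> is_derive (x + t *: v) v f df.
Proof.
have E : (fun h : R => h^-1 *: (((fun s : R => f (x + s *: v)) \o shift t) (h *: (1:R)) - f (x + t *: v)))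
       = (fun h : R => h^-1 *: ((f \o shift (x + t *: v)) (h *: v) - f (x + t *: v))).
  apply/funext => h /=; congr (_ *: (f _ - _)).
  by rewrite [h *: 1]mulr1 scalerDl addrCA.
split=> -[d1 d2]; split.
- by move: d1; rewrite /derivable E.
- by move: d2; rewrite /derive E.
- by move: d1; rewrite /derivable -E.
- by move: d2; rewrite /derive -E.
Qed.

Lemma is_derive_line0 f x v (df : R) :
  is_derive (0 : R) 1 (fun s : R => f (x + s *: v)) df <-> is_derive x v f df.
Proof. by rewrite is_derive_line scale0r addr0. Qed.
End lines.

(** * Products of one-variable functions *)

Section prodbump.
Variables (R : realType).

(** Leibniz rule. A term of the sum is identified by the index [j] of its differentiated factor,
    hence the absence of duplicates. *)
Lemma is_derive_prod_seq (I : eqType) (s : seq I) (F : I -> R -> R) (F' : I -> R) (t : R) :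
  uniq s -> (forall i, is_derive t 1 (F i) (F' i)) ->
  is_derive t 1 (fun u => \prod_(i <- s) F i u)
    (\sum_(j <- s) \prod_(i <- s) (if i == j then F' i else F i t)).
Proof.
move=> us dF; elim: s us => [_|i0 s IH /= /andP[i0s us]].
  rewrite big_nil; have -> : (fun u : R => \prod_(i <- [::]) F i u) = cst 1.
    by apply/funext => u; rewrite big_nil.
  exact: is_derive_cst.
have -> : (fun u : R => \prod_(i <- i0 :: s) F i u) = F i0 \* (fun u => \prod_(i <- s) F i u).
  by apply/funext => u; rewrite big_cons.
have d0 := @is_deriveM _ _ _ _ _ _ _ _ (dF i0) (IH us).
apply: (is_derive_eq d0); rewrite big_cons addrC; congr (_ + _).
  rewrite big_cons eqxx [LHS]mulrC; congr (_ * _).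
  rewrite !big_seq; apply: eq_bigr => i si.
  by case: eqP => // ii0; rewrite ii0 (negbTE i0s) in si.
rewrite [LHS]mulr_sumr !big_seq; apply: eq_bigr => j sj.
rewrite big_cons ifN//; apply: contraNneq i0s => ->; exact: sj.
Qed.

Variable n : nat.
Implicit Types (x v a b : 'rV[R]_n) (B : 'I_n -> R -> R).

(** These products are stable under translation and under partial derivatives ([upd] differentiates
    one factor), and their mixed derivatives are computed factor by factor. Uniqueness of weak
    derivatives and the identity along segments are obtained by testing against them alone. *)
Definition pb B x : R := \prod_i B i (x ord0 i).
Definition upd B j : 'I_n -> R -> R := fun i => if i == j then derive1 (B i) else B i.

Lemma upd_Coo B j : (forall i, Coo (B i)) -> forall i, Coo (upd B j i).
Proof. by move=> CB i; rewrite /upd; case: ifP => _ //; exact: Coo_derive1. Qed.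

Lemma is_derive_pb B x v : (forall i, Coo (B i)) ->
  is_derive x v (pb B) (\sum_j v ord0 j * pb (upd B j) x).
Proof.
move=> CB; apply/is_derive_line0.
have dF i : is_derive (0 : R) 1 (fun s : R => B i (x ord0 i + s * v ord0 i))
    (derive1 (B i) (x ord0 i) * v ord0 i).
  have d1 := Coo_is_derive (x ord0 i) (CB i).
  have d2 : is_derive (0:R) 1 (fun s : R => x ord0 i + s * v ord0 i) (v ord0 i).
    have d3 := @is_deriveD _ _ _ (cst (x ord0 i)) (v ord0 i *: id) (0:R) 1 _ _
      (is_derive_cst _ _ _) (is_deriveZ _ (is_derive_id _ _)).
    rewrite [X in is_derive _ _ X](_ : _ = (cst (x ord0 i) + v ord0 i *: id)).
      by apply: (is_derive_eq d3); rewrite add0r [LHS]mulr1.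
    by apply/funext => s /=; rewrite mulrC.
  apply: (@is_derive1_comp _ (B i) (fun s : R => x ord0 i + s * v ord0 i)).
  by rewrite mul0r addr0.
have := is_derive_prod_seq (index_enum_uniq _) dF.
have -> : (fun s : R => pb B (x + s *: v)) = (fun u : R => \prod_(i <- index_enum 'I_n) B i (x ord0 i + u * v ord0 i)).
  by apply/funext => s; apply: eq_bigr => i _; rewrite !mxE.
move=> d; apply: (is_derive_eq d); apply: eq_bigr => j _.
rewrite /pb (bigD1 j)//= eqxx [in RHS](bigD1 j)//= /upd eqxx mulrA [_ * v _ _]mulrC.
congr (_ * _); apply: eq_bigr => i ij; rewrite (negbTE ij) mul0r addr0//.
Qed.

Lemma partial_pb B j : (forall i, Coo (B i)) -> partial j (pb B) = pb (upd B j).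
Proof.
move=> CB; apply/funext => x; rewrite /partial.
have d := is_derive_pb x (delta_mx ord0 j) CB; rewrite derive_val (bigD1 j)//=.
rewrite mxE !eqxx mul1r big1 ?addr0// => i ij.
by rewrite mxE eqxx /= (negbTE ij) mul0r.
Qed.

Lemma continuous_pb B : (forall i, Coo (B i)) -> continuous (pb B).
Proof.
move=> CB x; rewrite /pb.
elim: (index_enum 'I_n) => [|i s IH].
  rewrite (_ : (fun _ => _) = cst (1 : R)); first exact: cst_continuous.
  by apply/funext => y; rewrite big_nil.
rewrite (_ : (fun _ => _) = (fun y : 'rV[R]_n => B i (y ord0 i) * \prod_(k <- s) B k (y ord0 k))); last first.
  by apply/funext => y; rewrite big_cons.
apply: (@continuousM _ _ (fun y : 'rV[R]_n => B i (y ord0 i))); last exact: IH.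
have c1 : {for x, continuous (fun y : 'rV[R]_n => y ord0 i)} by exact: coord_continuous.
have c2 : {for x ord0 i, continuous (B i)} by exact: Coo_continuous.
exact: (continuous_comp c1 c2).
Qed.

Lemma smooth_pb B : (forall i, Coo (B i)) -> smooth (pb B).
Proof.
move=> CB s; suff [B' CB' ->] : exists2 B', (forall i, Coo (B' i)) & foldr partial (pb B) s = pb B'.
  split=> [|x i]; first exact: continuous_pb.
  by have d := is_derive_pb x (delta_mx ord0 i) CB'; exact: ex_derive.
elim: s => [|j s [B' CB' E]]; first by exists B.
by exists (upd B' j); [exact: upd_Coo|rewrite /= E partial_pb].
Qed.

Lemma iter_partial_pb B j k : (forall i, Coo (B i)) ->
  iter k (partial j) (pb B) = pb (fun i => if i == j then derive1n k (B i) else B i).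
Proof.
move=> CB; elim: k => [|k IH].
  by congr pb; apply/funext => i; case: eqP.
rewrite iterS IH partial_pb.
  by congr pb; apply/funext => i; rewrite /upd; case: eqP.
by move=> i; case: eqP => // _; exact: Coo_derive1n.
Qed.

Lemma partialm_pb B (a : multinom n) : (forall i, Coo (B i)) ->
  partialm a (pb B) = pb (fun i => derive1n (a i) (B i)).
Proof.
move=> CB; rewrite /partialm.
have : uniq (enum 'I_n) by exact: enum_uniq.
have E : pb (fun i => derive1n (a i) (B i)) =
   pb (fun i => if i \in enum 'I_n then derive1n (a i) (B i) else B i).
  by congr pb; apply/funext => i; rewrite mem_enum.
rewrite {}E; elim: (enum 'I_n) => [_|j s IH /= /andP[js us]]//.
rewrite IH// iter_partial_pb.
  congr pb; apply/funext => i; rewrite in_cons.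
  by case: eqP => [->|_]//=; rewrite (negbTE js).
by move=> i; case: ifP => // _; exact: Coo_derive1n.
Qed.

Definition pbump a b B :=
  forall i, Coo (B i) /\ forall x : R, ~~ (a ord0 i <= x <= b ord0 i) -> B i x = 0.

Lemma pbump_Coo a b B : pbump a b B -> forall i, Coo (B i).
Proof. by move=> H i; case: (H i). Qed.

Lemma pbump_out a b B x : pbump a b B -> ~ cbox a b x -> pb B x = 0.
Proof.
move=> H /existsNP[i /negP Hi]; have [_ /(_ _ Hi) E] := H i.
by rewrite /pb (bigD1 i)//= E mul0r.
Qed.

(** Outside the closed interval a factor vanishes on a neighbourhood, hence so does its
    derivative. *)
Lemma pbump_upd a b B j : pbump a b B -> pbump a b (upd B j).
Proof.
move=> H i; split; first by apply: upd_Coo => k; case: (H k).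
move=> x hx; rewrite /upd; have [CB HB] := H i.
case: eqP => // _; last exact: HB.
have d : is_derive x 1 (B i) 0.
  apply: (@near_eq_is_derive _ _ _ (cst (0:R))).
  move: hx; rewrite negb_and -!ltNge => /orP[h|h]; near=> z; rewrite HB// negb_and -!ltNge.
    by apply/orP; left; near: z; exact: lt_nbhsl.
  by apply/orP; right; near: z; exact: lt_nbhsr.
by rewrite derive1E derive_val.
Unshelve. all: by end_near. Qed.

Lemma closed_cbox a b : closed (cbox a b).
Proof.
have -> : cbox a b = \bigcap_(i in setT)
   ((fun x : 'rV[R]_n => x ord0 i) @^-1` `[a ord0 i, b ord0 i]%classic).
  apply/seteqP; split => x /= h i => [_|]; have := h i; rewrite /= in_itv/= => h'; exact: h'.
apply: closed_bigI => i _; apply: preimage_closed; last exact: interval_closed.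
by move=> x _; exact: coord_continuous.
Qed.

Lemma compact_cbox a b : compact (cbox a b).
Proof.
rewrite cbox_itv; apply: (@rV_compact _ _ (fun i => `[a ord0 i, b ord0 i]%classic)) => i.
exact: segment_compact.
Qed.

Lemma test_function_pb (U : set 'rV[R]_n) a b B : cbox a b `<=` U -> pbump a b B ->
  test_function U (pb B).
Proof.
move=> abU H; have CB := pbump_Coo H.
have sub : closure [set x | pb B x != 0] `<=` cbox a b.
  have /closure_id-> := @closed_cbox a b; apply: closureS.
  by move=> x /= hx; apply: contrapT => /(pbump_out H) E; rewrite E eqxx in hx.
split; first exact: smooth_pb.
- by apply: (subclosed_compact _ (@compact_cbox a b)) => //; exact: closed_closure.
- exact: subset_trans abU.
Qed.

Lemma pb_bounded a b B : pbump a b B -> exists M : R, forall x, `|pb B x| <= M.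
Proof.
move=> H; have CB := pbump_Coo H.
have /compact_bounded[M [_ HM]] : compact (pb B @` cbox a b).
  apply: continuous_compact; last exact: compact_cbox.
  by apply: continuous_subspaceT; exact: continuous_pb.
exists (Num.max (M + 1) 0) => x; have [xab|xab] := pselect (cbox a b x).
  by rewrite le_max (HM (M + 1))// ?ltrDl//; exists x.
by rewrite (pbump_out H xab) normr0 le_max lexx orbT.
Qed.

Lemma measurable_pb B : (forall i, Coo (B i)) -> measurable_fun setT (pb B).
Proof. by move=> CB; apply: continuous_measurable_rV; exact: continuous_pb. Qed.
End prodbump.

(** * The fundamental lemma of the calculus of variations *)

Section induced_measure.
Context (d : measure_display) (T : measurableType d) (R : realType).
Variables (mu : {measure set T -> \bar R}) (f : T -> \bar R).
Hypotheses (mf : measurable_fun setT f) (f0 : forall x, (0 <= f x)%E).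

(** The two proofs are arguments so that the measure structure can be inferred from the term
    itself. *)
Definition dens (_ : measurable_fun setT f) (_ : forall x, (0 <= f x)%E) (A : set T) : \bar R :=
  (\int[mu]_(x in A) f x)%E.

Let dens0 : dens mf f0 set0 = 0%E. Proof. exact: integral_set0. Qed.
Let dens_ge0 A : (0 <= dens mf f0 A)%E. Proof. by apply: integral_ge0 => x _. Qed.
Let dens_sigma : semi_sigma_additive (dens mf f0).
Proof. exact: semi_sigma_additive_nng_induced. Qed.
HB.instance Definition _ := isMeasure.Build _ _ _ (dens mf f0) dens0 dens_ge0 dens_sigma.
End induced_measure.

Section fundamental.
Variables (R : realType) (n : nat).
Implicit Types (a b x : 'rV[R]_n) (f : 'rV[R]_n -> R).
Local Notation mu := (lebesgue_rV R n).

(** The positive and negative parts of [F] are densities of two measures that agree on boxes, hence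
    on all Borel sets. *)
Lemma integral_obox_eq0 (F : 'rV[R]_n -> \bar R) : mu.-integrable setT F ->
  (forall a b, \int[mu]_(x in obox a b) F x = 0)%E ->
  ae_eq mu setT F (cst 0%E).
Proof.
move=> iF F0; have mF := measurable_int _ iF.
have ipos := integrable_funepos measurableT iF.
have ineg := integrable_funeneg measurableT iF.
apply: integral_ae_eq => //= E _ mE; rewrite integral0.
pose m1 : {measure set 'rV[R]_n -> \bar R} :=
  dens mu (measurable_funepos mF) (funepos_ge0 F).
pose m2 : {measure set 'rV[R]_n -> \bar R} :=
  dens mu (measurable_funeneg mF) (funeneg_ge0 F).
have fin A G : measurable A -> mu.-integrable setT G -> (\int[mu]_(x in A) G x)%E \is a fin_num.
  by move=> mA iG; apply: integrable_fin_num => //; exact: integrableS iG.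
have m12 : m1 E = m2 E.
  apply: rV_measure_unique => // a b.
    have := F0 a b; rewrite integralE => /eqP; rewrite sube_eq ?add0e//.
    - by move/eqP.
    - by apply: fin => //; exact: measurable_obox.
  rewrite ltey_eq; apply/orP; left; apply: fin => //; exact: measurable_obox.
rewrite integralE; have -> : (\int[mu]_(x in E) F^\+ x = \int[mu]_(x in E) F^\- x)%E by exact: m12.
by rewrite subee//; exact: fin.
Qed.

Lemma cvg_prod_seq (I : Type) (s : seq I) (G : I -> nat -> R) (l : I -> R) :
  (forall i, G i k @[k --> \oo] --> l i) ->
  \prod_(i <- s) G i k @[k --> \oo] --> \prod_(i <- s) l i.
Proof.
move=> H; elim: s => [|i s IH].
  rewrite big_nil; under eq_fun do rewrite big_nil; exact: cvg_cst.
rewrite big_cons; under eq_fun do rewrite big_cons.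
by apply: cvgM.
Qed.

Definition boxbump a b k : 'I_n -> R -> R := fun i => bump1 k (a ord0 i) (b ord0 i).

Lemma pbump_boxbump a b k : pbump a b (boxbump a b k).
Proof.
move=> i; split; first exact: Coo_bump1.
move=> x h; apply: bump1_out; apply: contra h => /andP[h1 h2].
by rewrite !ltW.
Qed.

Lemma cvg_boxbump a b x : pb (boxbump a b k) x @[k --> \oo] --> (\1_(obox a b) x : R).
Proof.
rewrite indicE; have [xab|xab] := pselect (obox a b x).
  rewrite mem_set//= -[X in _ --> X](_ : \prod_(i < n) 1 = _); last by rewrite big1.
  by apply: cvg_prod_seq => i; apply: cvg_bump1; exact: xab.
rewrite memNset//=; have /existsNP[i /negP hi] := xab.
rewrite (_ : (fun _ => _) = cst (0 : R)); first exact: cvg_cst.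
by apply/funext => k; rewrite /pb (bigD1 i)//= /boxbump bump1_out// mul0r.
Qed.

Lemma boxbump_le1 a b k x : `|pb (boxbump a b k) x| <= 1.
Proof.
rewrite /pb normr_prod -[leRHS](_ : \prod_(i < n) 1 = _); last by rewrite big1.
apply: ler_prod => i _.
have /andP[h1 h2] := bump1_ge0_le1 k (a ord0 i) (b ord0 i) (x ord0 i).
by rewrite normr_ge0/= ger0_norm.
Qed.

(** The bumps converge to the indicator of the box and are at most 1, so dominated convergence
    applies with [|f|] as bound. *)
Lemma integral_obox_lim f a b (D : set 'rV[R]_n) : measurable D -> obox a b `<=` D ->
  mu.-integrable D (EFin \o f) ->
  (forall k, \int[mu]_(x in D) (f x * pb (boxbump a b k) x)%:E = 0)%E ->
  (\int[mu]_(x in obox a b) (f x)%:E = 0)%E.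
Proof.
move=> mD abD iD H.
have mf := measurable_int _ iD.
have mp k : measurable_fun D (fun x => pb (boxbump a b k) x).
  by apply: measurable_funTS; apply: measurable_pb => i; exact: Coo_bump1.
have [| | | | |_ _] := @dominated_convergence _ _ _ mu D mD
   (fun k x => (f x * pb (boxbump a b k) x)%:E)
   (fun x => (f x * \1_(obox a b) x)%:E) (fun x => `|f x|%:E).
- by move=> k; apply/measurable_EFinP; apply: measurable_funM => //; exact/measurable_EFinP.
- apply/measurable_EFinP; apply: measurable_funM; first exact/measurable_EFinP.
  apply: measurable_indic; exact: measurable_obox.
- apply: aeW => x Dx; apply: cvg_EFin; first exact: nearW.
  by apply: cvgM; [exact: cvg_cst|exact: cvg_boxbump].
- by have := integrable_abse iD.
- apply: aeW => x k Dx; rewrite /= lee_fin normrM ler_piMr// boxbump_le1//.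
move=> /cvg_lim; rewrite (_ : (fun _ => _) = cst 0%E); last by apply/funext => k; exact: H.
rewrite lim_cst// => /(_ (@ereal_hausdorff _)) E.
rewrite -(setIidr abD) integral_mkcondr [RHS]E; apply: eq_integral => x _.
by rewrite patchE indicE; case: ifPn => _; rewrite ?mulr1 ?mulr0.
Qed.

(** Within a closed box contained in [U], bumps tend to indicators of smaller boxes, so [f] has zero
    integral on all of them and vanishes almost everywhere. Countably many rational cubes then cover
    [U]. *)
Lemma fundamental_lemma (U : set 'rV[R]_n) f : open U -> measurable_fun U f ->
  (forall a b, cbox a b `<=` U -> mu.-integrable (cbox a b) (EFin \o f)) ->
  (forall a b B, cbox a b `<=` U -> pbump a b B ->
     \int[mu]_(x in U) (f x * pb B x) = 0) ->
  {ae mu, forall x, U x -> f x = 0}.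
Proof.
move=> oU mf iF H; have mU := open_measurable_rV oU.
have key a b : cbox a b `<=` U -> {ae mu, forall x, obox a b x -> f x = 0}.
  move=> abU; pose F := (EFin \o f) \_ (obox a b).
  have mo := @measurable_obox R n a b.
  have iab : mu.-integrable (obox a b) (EFin \o f).
    apply: (integrableS (@measurable_cbox R n a b)) => //; first exact: obox_sub_cbox.
    exact: iF.
  have : ae_eq mu setT F (cst 0%E).
    apply: integral_obox_eq0 => [|u v]; first exact: (iffLR (integrable_mkcond (EFin \o f) mo) iab).
    rewrite /F -integral_mkcondr oboxI.
    (* An arbitrary test box is cut down to its part in the box from [a] to [b], whose closure still
       lies in [U]. *)
    set a' := \row_i _; set b' := \row_i _.
    have sub : cbox a' b' `<=` cbox a b.
      move=> x h i; have := h i; rewrite !mxE ge_max le_min.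
      by move=> /andP[/andP[_ ->] /andP[_ ->]].
    apply: (@integral_obox_lim f a' b' (cbox a b)).
    - exact: measurable_cbox.
    - by apply: subset_trans sub; exact: obox_sub_cbox.
    - exact: iF.
    move=> k; have pk := pbump_boxbump a' b' k.
    have := H a' b' _ (subset_trans sub abU) pk.
    rewrite /Rintegral => E0; have {E0}E := congr1 EFin E0.
    have -> : (\int[mu]_(x in cbox a b) (f x * pb (boxbump a' b' k) x)%:E =
       \int[mu]_(x in U) (f x * pb (boxbump a' b' k) x)%:E)%E.
      rewrite -(setIidr abU) integral_mkcondr; apply: eq_integral => x _.
      rewrite patchE; case: ifPn => // /negP xab.
      rewrite (pbump_out pk) ?mulr0// => /sub xab2; apply: xab; exact: mem_set.
    (* A real integral equal to 0 could hide an infinite one, since [fine] sends infinities to 0;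
       integrability of the product is therefore deduced from that of [f] on [cbox a b]. *)
    apply: etrans E; rewrite fineK//; apply: integrable_fin_num; first exact: mU.
    apply/integrableP; split.
      apply/measurable_EFinP; apply: measurable_funM => //.
      by apply: measurable_funTS; apply: measurable_pb; exact: pbump_Coo pk.
    have /integrableP[_] := iF a b abU; apply: le_lt_trans.
    rewrite -(setIidr abU) integral_mkcondr; apply: ge0_le_integral => //=.
    - apply/measurable_EFinP; apply: measurableT_comp => //; apply: measurable_funM => //.
      by apply: measurable_funTS; apply: measurable_pb; exact: pbump_Coo pk.
    - apply/(measurable_restrict _ (@measurable_cbox R n a b) mU).
      apply/measurable_EFinP; apply: measurableT_comp => //.
      by apply: measurable_funS mf => //; exact: subIsetl.
    - move=> x Ux; rewrite patchE; case: ifPn => [_|/negP xab].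
        by rewrite lee_fin normrM ler_piMr// boxbump_le1.
      by rewrite (pbump_out pk) ?mulr0 ?normr0// => /sub xab2; apply: xab; exact: mem_set.
  apply: filterS => x /(_ I); rewrite /F patchE => + xab.
  by rewrite mem_set// => -[].
(* The exceptional set inside the cube coded by [k], empty if [k] codes no cube. *)
pose N (k : nat) : set 'rV[R]_n := if unpickle k is Some q then
  [set x | [/\ cbox (rlo R q) (rhi R q) `<=` U, obox (rlo R q) (rhi R q) x & f x <> 0]] else set0.
apply: (@negligibleS _ _ _ _ (\bigcup_k N k)).
  move=> x /= /not_implyP[Ux fx]; have := Ux; rewrite {1}(open_rV_bigcup oU) => -[q qU qx].
  by exists (pickle q) => //; rewrite /N pickleK.
apply: negligible_bigcup => k; rewrite /N; case: unpickle => [q|]; last exact: negligible_set0.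
have [qU|qU] := pselect (cbox (rlo R q) (rhi R q) `<=` U).
  apply: negligibleS (key _ _ qU) => x [_ qx fx] /=; exact/not_implyP.
by apply: negligibleS (negligible_set0 _) => x [].
Qed.

End fundamental.

(** * Weak gradients along segments *)

Lemma RintegrableB (d : measure_display) (T : measurableType d) (R : realType)
    (mu : {measure set T -> \bar R}) (f g : T -> R) :
  mu.-integrable setT (EFin \o f) -> mu.-integrable setT (EFin \o g) ->
  mu.-integrable setT (EFin \o (fun x => f x - g x)).
Proof.
move=> a b; have := integrableB measurableT a b; congr (_.-integrable _ _).
Qed.

Lemma RintegrableZ (d : measure_display) (T : measurableType d) (R : realType)
    (mu : {measure set T -> \bar R}) (k : R) (f : T -> R) :
  mu.-integrable setT (EFin \o f) -> mu.-integrable setT (EFin \o (fun x => k * f x)).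
Proof. exact: (integrableZl measurableT k). Qed.

(** * Fubini for real-valued integrals *)

Section Rfubini.
Context (d1 d2 : measure_display) (T1 : measurableType d1) (T2 : measurableType d2) (R : realType).
Variables (m1 : {sigma_finite_measure set T1 -> \bar R}) (m2 : {sigma_finite_measure set T2 -> \bar R}).

(** The real integral is [fine] of the extended one, so the two are only known to agree on slices
    where [h] is integrable, that is, on almost every slice. *)
Lemma ae_eq_Rint (h : T1 * T2 -> R) : (m1 \x m2)%E.-integrable setT (EFin \o h) ->
  {ae m1, forall x, (\int[m2]_y h (x, y))%:E = (\int[m2]_y (h (x, y))%:E)%E}.
Proof.
move=> /ae_integrable1; apply: filterS => x ix.
by rewrite /Rintegral fineK//; exact: integrable_fin_num.
Qed.

Lemma Rfubini1 (h : T1 * T2 -> R) : (m1 \x m2)%E.-integrable setT (EFin \o h) ->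
  m1.-integrable setT (fun x => (\int[m2]_y h (x, y))%:E) /\
  (\int[m1]_x (\int[m2]_y h (x, y))%:E = \int[(m1 \x m2)%E]_z (h z)%:E)%E.
Proof.
move=> ih; have i1 := integrable_fubini_F ih.
have mF := measurable_int _ i1.
have mR : measurable_fun setT (fun x => (\int[m2]_y h (x, y))%:E).
  by apply/measurable_EFinP; apply: (measurableT_comp (@fine_measurable _ _ measurableT)).
split.
  apply: le_integrable i1 => // x _ /=; rewrite /fubini_F /Rintegral /comp.
  by case: (\int[_]_ _ _)%E => [r| |]//=; rewrite leey.
rewrite -integral12_prod_meas1//; apply: ae_eq_integral => //.
by apply: filterS (ae_eq_Rint ih) => x + _.
Qed.
End Rfubini.

Section Rfubini2.
Context (d1 d2 : measure_display) (T1 : measurableType d1) (T2 : measurableType d2) (R : realType).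
Variables (m1 : {sigma_finite_measure set T1 -> \bar R}) (m2 : {sigma_finite_measure set T2 -> \bar R}).

Lemma Rfubini (h : T1 * T2 -> R) : (m1 \x m2)%E.-integrable setT (EFin \o h) ->
  \int[m1]_x (\int[m2]_y h (x, y)) = \int[m2]_y (\int[m1]_x h (x, y)).
Proof.
move=> ih; congr fine.
have [_ ->] := Rfubini1 ih; rewrite -integral21_prod_meas1//.
apply: ae_eq_integral => //.
- exact: measurable_fubini_G ih.
- apply/measurable_EFinP; apply: (measurableT_comp (@fine_measurable _ _ measurableT)).
  exact: measurable_fubini_G ih.
- apply: filterS (ae_integrable2 ih) => y iy _.
  by rewrite /Rintegral fineK//; exact: integrable_fin_num.
Qed.
End Rfubini2.

Section uniform01.
Variable R : realType.
(* Averages over [0, 1] are integrals of functions of [clamp t] against a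
   probability on the whole line, so that Tonelli applies without restricting
   the domain. *)
Definition unif : probability (measurableTypeR R) R := uniform_prob (@ltr01 R).
Definition clamp (t : measurableTypeR R) : R := Num.max 0 (Num.min 1 t).

Lemma clamp01 t : 0 <= clamp t <= 1.
Proof. by rewrite /clamp le_max lexx/= ge_max ler01 ge_min lexx. Qed.

Lemma clamp_id t : 0 <= t <= 1 -> clamp t = t.
Proof. by move=> /andP[t0 t1]; rewrite /clamp (min_idPr t1) (max_idPr t0). Qed.

Lemma measurable_clamp : measurable_fun setT clamp.
Proof.
rewrite /clamp; by apply: measurable_maxr; [exact: measurable_cst|apply: measurable_minr;
  [exact: measurable_cst|exact: measurable_id]].
Qed.

Lemma integral_unif (f : R -> \bar R) : measurable_fun setT f ->
  (\int[unif]_t f t = \int[lebesgue_measure]_(t in `[0%R, 1%R]) f t)%E.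
Proof.
move=> mf; rewrite integralE [RHS]integralE; congr (_ - _)%E.
  rewrite integral_uniform//; last exact: measurable_funepos.
  by rewrite subr0 invr1 mul1e.
rewrite integral_uniform//; last exact: measurable_funeneg.
by rewrite subr0 invr1 mul1e.
Qed.

Lemma FTC_unif (g dg : R -> R) : (forall t : R, is_derive t 1 g (dg t)) -> continuous dg ->
  \int[unif]_t dg (clamp t) = g 1 - g 0.
Proof.
move=> dgE cdg.
have mdg : measurable_fun setT dg by exact: continuous_measurable_fun.
rewrite /Rintegral integral_unif; last first.
  by apply/measurable_EFinP; exact: measurableT_comp measurable_clamp.
rewrite [X in fine X](_ : _ = \int[lebesgue_measure]_(t in `[0%R, 1%R]) (dg t)%:E)%E; last first.
  apply: eq_integral => t.
  by rewrite inE/= in_itv/= => /clamp_id->.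
rewrite (@continuous_FTC2 _ dg g)//.
- exact: continuous_subspaceT.
- have cg : continuous g.
    move=> x; apply/differentiable_continuous; apply/derivable1_diffP.
    have ? := dgE x; exact: ex_derive.
  split=> [x _| |].
  + by have ? := dgE x; exact: ex_derive.
  + by apply: cvg_at_right_filter; exact: cg.
  + by apply: cvg_at_left_filter; exact: cg.
- by move=> x _; rewrite derive1E; have ? := dgE x; exact: derive_val.
Qed.
End uniform01.

Lemma norm1_le1 (R : realType) : `|1 : R| <= 1. Proof. by rewrite normr1. Qed.

Section shift.
Variables (R : realType) (n : nat).
Local Notation V := 'rV[R]_n.
Local Notation mu := (lebesgue_rV R n).
Local Notation nu := (unif R).

Lemma measurable_shift (e : V) (G : V -> R) : measurable_fun setT G ->
  measurable_fun setT (fun z : V * measurableTypeR R => G (z.1 + clamp z.2 *: e)).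
Proof.
move=> mG; apply: (measurableT_comp mG); apply: measurable_rVD; first exact: measurable_fst.
apply: measurable_rVZ; last exact: measurable_cst.
have ms : measurable_fun setT (fun z : V * measurableTypeR R => z.2) by exact: measurable_snd.
have mc := @measurable_clamp R.
have := measurableT_comp mc ms.
by [].
Qed.

(** Integrating in space first, translation invariance makes the inner integral of |G| independent
    of [t]; the kernel costs a factor [M] and [unif] has mass 1. *)
Lemma integrable_shift (e : V) (G : V -> R) (K : V * measurableTypeR R -> R) (M : R) :
  mu.-integrable setT (EFin \o G) -> measurable_fun setT K -> (forall z, `|K z| <= M) ->
  (mu \x nu)%E.-integrable setT (EFin \o (fun z => K z * G (z.1 + clamp z.2 *: e))).
Proof.
move=> iG mK KM; have /integrableP[mG fG] := iG.
have mG' : measurable_fun setT G by exact/measurable_EFinP.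
have mKG : measurable_fun setT (fun z : V * measurableTypeR R => K z * G (z.1 + clamp z.2 *: e)).
  by apply: measurable_funM => //; exact: measurable_shift.
apply/integrable21ltyP; first exact/measurable_EFinP.
have M0 : 0 <= M by rewrite (le_trans _ (KM point)).
have le t : (\int[mu]_y `|(K (y, t) * G (y + clamp t *: e))%:E| <= M%:E * \int[mu]_y `|(G y)%:E|)%E.
  rewrite -(ge0_integral_translation (clamp t *: e) (f := fun y => `|(G y)%:E|%E))//; last first.
    exact: measurableT_comp.
  rewrite -ge0_integralZl//; last first.
    apply/measurable_EFinP; apply: measurableT_comp => //; apply: (measurableT_comp mG').
    by apply: measurable_rVD => //; exact: measurable_cst.
  apply: ge0_le_integral => //.
  - apply/measurable_EFinP; apply: measurableT_comp => //.
    exact: (measurableT_comp mKG (pair2_measurable t)).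
  - apply: measurable_funeM; apply/measurable_EFinP; apply: measurableT_comp => //; apply: (measurableT_comp mG').
    by apply: measurable_rVD => //; exact: measurable_cst.
  - by move=> y _; rewrite /= -EFinM lee_fin normrM ler_wpM2r.
apply: (@le_lt_trans _ _ (\int[nu]_t (M%:E * \int[mu]_y `|(G y)%:E|))%E).
  apply: ge0_le_integral => //.
  - by move=> t _; exact: integral_ge0.
  - have mz : measurable_fun setT (fun z : V * measurableTypeR R => `|(K z * G (z.1 + clamp z.2 *: e))%:E|%E).
      by apply/measurable_EFinP; apply: measurableT_comp.
    have hG := @measurable_fun_fubini_tonelli_G _ _ _ _ _ mu _ mz (fun z => abse_ge0 _).
    exact: hG.
  - by move=> t _; exact: le.
rewrite integral_cst//= (_ : uniform_prob _ _ = 1%E); last exact: (@probability_setT _ _ _ nu).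
by rewrite mule1 lte_mul_pinfty.
Qed.

(** The product translated by [u], with each argument in the affine form of [Coo_affine]. *)
Definition pshift (u : V) (B : 'I_n -> R -> R) : 'I_n -> R -> R :=
  fun i x => B i (1 * x + - u ord0 i).

Lemma pb_pshift u B y : pb (pshift u B) y = pb B (y - u).
Proof. by apply: eq_bigr => i _; rewrite /pshift !mxE mul1r. Qed.

Lemma upd_pshift u B j : (forall i, Coo (B i)) -> upd (pshift u B) j = pshift u (upd B j).
Proof.
move=> CB; apply/funext => i; rewrite /upd /pshift; case: eqP => // _.
apply/funext => x; rewrite derive1E.
have d1 := Coo_is_derive (1 * x + - u ord0 i) (CB i).
have d : is_derive x 1 (fun x : R => 1 * x + - u ord0 i) 1.
  have -> : (fun x : R => 1 * x + - u ord0 i) = (id \+ cst (- u ord0 i)).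
    by apply/funext => z; rewrite mul1r.
  have d3 := @is_deriveD _ _ _ id (cst (- u ord0 i)) x 1 _ _ (is_derive_id _ _) (is_derive_cst _ _ _).
  by apply: (is_derive_eq d3); rewrite addr0.
have d2 := @is_derive1_comp _ (B i) (fun x : R => 1 * x + - u ord0 i) x _ _ d1 d.
by have := @derive_val _ _ _ _ _ _ _ d2; rewrite mulr1.
Qed.

Lemma pbump_pshift u a b B : pbump a b B -> pbump (a + u) (b + u) (pshift u B).
Proof.
move=> H i; have [CB HB] := H i; split; first exact: Coo_affine.
move=> x hx; apply: HB; apply: contra hx; rewrite mul1r !mxE lerBrDr lerBlDr; exact.
Qed.

Lemma Rint_translation (e : V) (f : V -> R) : measurable_fun setT f ->
  \int[mu]_x f (x + e) = \int[mu]_x f x.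
Proof.
move=> mf; congr fine; apply: (integral_translation e (f := EFin \o f)).
exact/measurable_EFinP.
Qed.

Lemma integrable_bndM (G K : V -> R) (M : R) : mu.-integrable setT (EFin \o G) ->
  measurable_fun setT K -> (forall x, `|K x| <= M) ->
  mu.-integrable setT (fun x => (K x * G x)%:E).
Proof.
move=> iG mK KM; have mG := measurable_int _ iG.
apply: (@le_integrable _ _ _ mu setT measurableT _ (fun x => (M * G x)%:E)).
- by apply/measurable_EFinP; apply: measurable_funM => //; exact/measurable_EFinP.
- move=> x _; rewrite /= lee_fin !normrM ler_wpM2r// (le_trans (KM x))// ler_norm//.
- by under eq_fun do rewrite EFinM; exact: integrableZl.
Qed.

Lemma Rint_sum (s : seq 'I_n) (F : 'I_n -> V -> R) :
  (forall i, mu.-integrable setT (EFin \o F i)) ->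
  \int[mu]_x (\sum_(i <- s) F i x) = \sum_(i <- s) \int[mu]_x F i x /\
  mu.-integrable setT (fun x => (\sum_(i <- s) F i x)%:E).
Proof.
move=> iF; elim: s => [|i s [E I]].
  split; last by under eq_fun do rewrite big_nil; exact: integrable0.
  rewrite big_nil; under eq_Rintegral do rewrite big_nil.
  by rewrite /Rintegral integral0.
split.
  rewrite big_cons -E -RintegralD//.
  by apply: eq_Rintegral => x _; rewrite big_cons.
under eq_fun do rewrite big_cons EFinD; apply: integrableD => //; exact: iF.
Qed.

Lemma continuous_sum_seq (T : topologicalType) (s : seq 'I_n) (F : 'I_n -> T -> R) :
  (forall i, continuous (F i)) -> continuous (fun x => \sum_(i <- s) F i x).
Proof.
move=> cF; elim: s => [|i s IH] x.
  rewrite (_ : (fun _ => _) = cst (0 : R)); first exact: cst_continuous.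
  by apply/funext => y; rewrite big_nil.
rewrite (_ : (fun _ => _) = (fun y => F i y + \sum_(k <- s) F k y)); last first.
  by apply/funext => y; rewrite big_cons.
by apply: continuousD; [exact: cF|exact: IH].
Qed.

Lemma ae_eq_Rintegral (f g : V -> R) : measurable_fun setT f -> measurable_fun setT g ->
  {ae mu, forall x, f x = g x} -> \int[mu]_x f x = \int[mu]_x g x.
Proof.
move=> mf mg fg; congr fine; apply: ae_eq_integral => //; try exact/measurable_EFinP.
by apply: filterS fg => x -> _.
Qed.

Definition segint (G : V -> R) (e y : V) : R := \int[nu]_t G (y + clamp t *: e).

Lemma integrable_segint (G : V -> R) (e : V) : mu.-integrable setT (EFin \o G) ->
  mu.-integrable setT (EFin \o segint G e).
Proof.
move=> iG; have := @integrable_shift e G (cst 1) 1 iG.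
move=> /(_ (measurable_cst _)) H.
have {}H : (mu \x nu)%E.-integrable setT (EFin \o
    (fun z : V * measurableTypeR R => cst 1 z * G (z.1 + clamp z.2 *: e))).
  by apply: H => z; rewrite normr1.
have [+ _] := Rfubini1 H; congr (_.-integrable _ _).
by apply/funext => y /=; congr EFin; apply: eq_Rintegral => t _; rewrite mul1r.
Qed.

(** The identity is tested against a bump B in [W], and all translations are moved onto B.
    Integrating by parts against B(y - t e), which is supported in [U], turns the pairing with
    [segint] into the integral of v(y) times the t-derivative of B(y - t e); integrating in t leaves
    v(y) (B(y - e) - B(y)). The exceptional null set depends on [e]. *)
Lemma segment_identity (U W : set V) (v : V -> R) (g : 'I_n -> V -> R) (e : V) :
  mu.-integrable setT (EFin \o v) -> (forall i, mu.-integrable setT (EFin \o g i)) ->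
  (forall i a b B, cbox a b `<=` U -> pbump a b B ->
    \int[mu]_x (v x * pb (upd B i) x) = - \int[mu]_x (g i x * pb B x)) ->
  open W -> (forall y t, W y -> 0 <= t <= 1 -> U (y + t *: e)) ->
  {ae mu, forall y, W y ->
    v (y + e) - v y = segint (fun x => \sum_i e ord0 i * g i x) e y}.
Proof.
move=> iv ig IBP oW WU; pose G x := \sum_i e ord0 i * g i x.
have iG : mu.-integrable setT (EFin \o G).
  apply: (Rint_sum _ _).2 => i; exact: (integrableZl measurableT _ (ig i)).
have ive : mu.-integrable setT (EFin \o (fun y => v (y + e))).
  exact: (integrable_translation e iv).
have iS := integrable_segint e iG.
pose f y := v (y + e) - v y - segint G e y.
have if_ : mu.-integrable setT (EFin \o f).
  exact: RintegrableB (RintegrableB ive iv) iS.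
have mf : measurable_fun setT f by apply/measurable_EFinP; exact: measurable_int if_.
suff : {ae mu, forall y, W y -> f y = 0}.
  apply: filterS => y + Wy => /(_ Wy) /eqP.
  by rewrite subr_eq0 => /eqP.
apply: (fundamental_lemma oW).
- exact: measurable_funTS.
- by move=> a b _; apply: (integrableS measurableT) => //; exact: measurable_cbox.
move=> a b B abW pB; have CB := pbump_Coo pB.
rewrite Rintegral_mkcond (_ : (fun x => f x * pb B x) \_ W = (fun x => f x * pb B x)); last first.
  apply/funext => x; rewrite patchE; case: ifPn => // /negP xW.
  by rewrite (pbump_out pB) ?mulr0// => /abW /mem_set.
have [M BM] := pb_bounded pB.
have mB := measurable_pb CB.
have I1 := integrable_bndM ive mB BM.
have I2 := integrable_bndM iv mB BM.
have I3 := integrable_bndM iS mB BM.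
have mv : measurable_fun setT v by apply/measurable_EFinP; exact: measurable_int iv.
have mG : measurable_fun setT G by apply/measurable_EFinP; exact: measurable_int iG.
have mg i : measurable_fun setT (g i) by apply/measurable_EFinP; exact: measurable_int (ig i).
have -> : \int[mu]_x (f x * pb B x) = \int[mu]_x (pb B x * v (x + e)) -
    \int[mu]_x (pb B x * v x) - \int[mu]_x (pb B x * segint G e x).
  rewrite -!RintegralB//; last exact: RintegrableB.
  by apply: eq_Rintegral => x _; rewrite /f !mulrBl ![_ * pb _ _]mulrC.
have E1 : \int[mu]_x (pb B x * v (x + e)) = \int[mu]_x (pb B (x - e) * v x).
  rewrite -[RHS](Rint_translation e).
    by apply: eq_Rintegral => x _; rewrite addrK.
  apply: measurable_funM => //; apply: (measurableT_comp mB).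
  by apply: measurable_rVD => //; exact: measurable_cst.
have E2 : \int[mu]_x (pb B x * segint G e x) =
   \int[mu]_x ((pb B (x - e) - pb B x) * v x).
  have I0 := @integrable_shift e G (cst 1) 1 iG (measurable_cst _) (fun _ => norm1_le1 R).
  have mKB : measurable_fun setT (fun z : V * measurableTypeR R => pb B z.1).
    exact: (measurableT_comp mB measurable_fst).
  have I5 := @integrable_shift e G (fun z => pb B z.1) M iG mKB (fun z => BM z.1).
  have -> : \int[mu]_x (pb B x * segint G e x) =
      \int[mu]_x \int[nu]_t (pb B x * G (x + clamp t *: e)).
    apply: ae_eq_Rintegral.
    - by apply: measurable_funM => //; apply/measurable_EFinP; exact: measurable_int iS.
    - by apply/measurable_EFinP; exact: measurable_int (Rfubini1 I5).1.
    - apply: filterS (ae_integrable1 I0) => x ix.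
      rewrite /segint RintegralZl//.
      by move: ix; congr (_.-integrable _ _); apply/funext => t /=; rewrite mul1r.
  rewrite (Rfubini I5).
  (* [K2 (y, t)] is the derivative of [pb B (y - s *: e)] with respect to [s], at [s = clamp t]. *)
  pose K2 (z : V * measurableTypeR R) := \sum_j (- e) ord0 j * pb (upd B j) (z.1 + clamp z.2 *: (- e)).
  have [M2 HM2] : exists M2, forall z, `|K2 z| <= M2.
    have /choice[N HN] : forall j, exists M, forall x, `|pb (upd B j) x| <= M.
      by move=> j; exact: pb_bounded (pbump_upd j pB).
    exists (\sum_j `|(- e) ord0 j| * N j) => z; apply: (le_trans (ler_norm_sum _ _ _)).
    by apply: ler_sum => j _; rewrite normrM ler_wpM2l.
  have mK2 : measurable_fun setT K2.
    apply: measurable_sum => j; apply: measurable_funM; first exact: measurable_cst.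
    by apply: measurable_shift; apply: measurable_pb; exact: upd_Coo.
  have I6 : (mu \x nu)%E.-integrable setT (EFin \o (fun z : V * measurableTypeR R => K2 z * v z.1)).
    have := @integrable_shift 0 v K2 M2 iv mK2 HM2; congr (_.-integrable _ _).
    by apply/funext => z /=; rewrite scaler0 addr0.
  transitivity (\int[nu]_t \int[mu]_y (K2 (y, t) * v y)).
    apply: eq_Rintegral => t _.
    set u := clamp t *: e.
    transitivity (\int[mu]_y (pb (pshift u B) y * G y)).
      rewrite -[RHS](Rint_translation u).
        by apply: eq_Rintegral => y _; rewrite pb_pshift addrK.
      apply: measurable_funM => //; apply: measurable_pb => i; exact: Coo_affine.
    have pS := pbump_pshift u pB.
    (* A point of the shifted box is w + [u] with w in [W], so it lies on one of the segments that
       [WU] places in [U]. *)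
    have sub : cbox (a + u) (b + u) `<=` U.
      move=> z hz; rewrite -(subrK u z); apply: WU; last exact: clamp01.
      by apply: abW => i; have := hz i; rewrite !mxE lerBrDr lerBlDr.
    have [N HN] := pb_bounded pS.
    have mS := measurable_pb (pbump_Coo pS).
    transitivity (\sum_i e ord0 i * \int[mu]_y (g i y * pb (pshift u B) y)).
      rewrite -[RHS](_ : \sum_i \int[mu]_y (e ord0 i * (g i y * pb (pshift u B) y)) = _).
        rewrite -(Rint_sum _ _).1.
          apply: eq_Rintegral => y _; rewrite mulr_sumr; apply: eq_bigr => i _.
          by rewrite mulrCA [pb _ _ * _]mulrC.
        move=> i; apply: RintegrableZ.
        have := integrable_bndM (ig i) mS HN; congr (_.-integrable _ _).
        by apply/funext => y; rewrite mulrC.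
      apply: eq_bigr => i _; rewrite RintegralZl//.
      have := integrable_bndM (ig i) mS HN; congr (_.-integrable _ _).
      by apply/funext => y; rewrite /= mulrC.
    have mSu j := measurable_pb (upd_Coo j (pbump_Coo pS)).
    have /choice[N' HN'] : forall j, exists M, forall x, `|pb (upd (pshift u B) j) x| <= M.
      by move=> j; exact: pb_bounded (pbump_upd j pS).
    have IS i : mu.-integrable setT (fun y => (v y * pb (upd (pshift u B) i) y)%:E).
      have := integrable_bndM iv (mSu i) (HN' i); congr (_.-integrable _ _).
      by apply/funext => y; rewrite mulrC.
    transitivity (\sum_i - e ord0 i * \int[mu]_y (v y * pb (upd (pshift u B) i) y)).
      by apply: eq_bigr => i _; rewrite (IBP _ _ _ _ sub pS) mulrNN.
    rewrite -[LHS](_ : \sum_i \int[mu]_y (- e ord0 i * (v y * pb (upd (pshift u B) i) y)) = _); last first.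
      by apply: eq_bigr => i _; rewrite RintegralZl//; exact: IS.
    rewrite -(Rint_sum _ _).1; last by move=> i; exact: RintegrableZ (IS i).
    apply: eq_Rintegral => y _; rewrite /K2 mulr_suml; apply: eq_bigr => i _.
    rewrite upd_pshift// pb_pshift /= !mxE /u scalerN -mulrA; congr (_ * _); exact: mulrC.
  rewrite -(Rfubini I6); apply: eq_Rintegral => y _.
  have mKy : measurable_fun setT (fun t : measurableTypeR R => K2 (y, t)).
    exact: (measurableT_comp mK2 (pair1_measurable y)).
  transitivity (\int[nu]_t (K2 (y, t) * v y)); first by [].
  rewrite RintegralZr//; last first.
    apply/integrableP; split; first exact/measurable_EFinP.
    apply: (@le_lt_trans _ _ (\int[nu]_t (cst M2%:E t))%E).
      apply: ge0_le_integral => //.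
      - by apply/measurable_EFinP; exact: measurableT_comp.
      - by move=> t _; rewrite /= lee_fin.
    rewrite integral_cst//= (_ : uniform_prob _ _ = 1%E); last exact: (@probability_setT _ _ _ nu).
    by rewrite mule1 ltry.
  congr (_ * _).
  have FTC := @FTC_unif _ (fun s : R => pb B (y + s *: (- e)))
     (fun s : R => \sum_j (- e) ord0 j * pb (upd B j) (y + s *: (- e))).
  rewrite scale1r scale0r addr0 in FTC; apply: FTC.
    by move=> s; apply/is_derive_line; exact: is_derive_pb.
  apply: continuous_sum_seq => j s.
  apply: (@continuousM _ _ (cst ((- e) ord0 j)) (fun s : R => pb (upd B j) (y + s *: (- e)))).
    exact: cst_continuous.
  have d := is_derive_pb (y + s *: (- e)) (- e) (upd_Coo j CB).
  have d' := iffRL (is_derive_line _ _ _ _ _) d.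
  apply/differentiable_continuous; apply/derivable1_diffP.
  by have [] := d'.
rewrite E1 E2 -RintegralB//; last first.
  apply: (@integrable_bndM v (fun x => pb B (x - e)) M) => //.
  apply: (measurableT_comp mB).
  by apply: measurable_rVD => //; exact: measurable_cst.
apply/eqP; rewrite subr_eq0; apply/eqP; apply: eq_Rintegral => x _.
by rewrite mulrBl.
Qed.
End shift.

(** * Polynomial functions and test functions *)

Section poly_eval.
Variables (R : realType) (n : nat).
Local Notation V := 'rV[R]_n.
Implicit Types (q : mpoly n R) (x : V).

Definition pev q : V -> R := fun x => meval (x ord0) q.

Lemma mpoly_elim (P : mpoly n R -> Prop) : (forall c, P (mpolyC n c)) ->
  (forall i, P (mpolyX R (mnm1 i))) -> (forall p q, P p -> P q -> P (p + q)) ->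
  (forall p q, P p -> P q -> P (p * q)) -> forall q, P q.
Proof.
move=> PC PX PD PM; elim/mpolyind => [|c m q _ _ IH]; first by rewrite -mpolyC0.
apply: PD => //; rewrite -mul_mpolyC; apply: (PM _ _) => //.
rewrite mpolyXE_id; elim/big_ind : _ => [|u w|i _]; [by rewrite -mpolyC1|exact: PM|].
by elim: (m i) => [|k IHk]; rewrite ?expr0 -?mpolyC1// exprS; exact: PM.
Qed.

Lemma pevD p q : pev (p + q) = (fun x => pev p x + pev q x).
Proof. by apply/funext => x; rewrite /pev mevalD. Qed.
Lemma pevB p q : pev (p - q) = (fun x => pev p x - pev q x).
Proof. by apply/funext => x; rewrite /pev mevalB. Qed.
Lemma pevM p q : pev (p * q) = (fun x => pev p x * pev q x).
Proof. by apply/funext => x; rewrite /pev mevalM. Qed.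
Lemma pevZ c q : pev (c *: q) = (fun x => c * pev q x).
Proof. by apply/funext => x; rewrite /pev mevalZ. Qed.
Lemma pevC c : pev (mpolyC n c) = cst c.
Proof. by apply/funext => x; rewrite /pev mevalC. Qed.
Lemma pev0 : pev 0 = cst 0.
Proof. by apply/funext => x; rewrite /pev meval0. Qed.
Lemma pevXU i : pev (mpolyX R (mnm1 i)) = (fun x => x ord0 i).
Proof. by apply/funext => x; rewrite /pev mevalXU. Qed.

Lemma is_derive_coord i j (x : V) :
  is_derive x (delta_mx ord0 i) (fun y : V => y ord0 j) ((i == j)%:R : R).
Proof.
apply/is_derive_line0.
have d3 := @is_deriveD _ _ _ (cst (x ord0 j)) (((i == j)%:R : R) *: id) (0:R) 1 _ _
      (is_derive_cst _ _ _) (is_deriveZ _ (is_derive_id _ _)).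
rewrite [X in is_derive _ _ X](_ : _ = (cst (x ord0 j) + ((i == j)%:R : R) *: id)).
  by apply: (is_derive_eq d3); rewrite add0r [LHS]mulr1.
by apply/funext => s /=; rewrite !mxE eqxx /= [j == i]eq_sym mulrC.
Qed.

Lemma is_derive_pev i q x : is_derive x (delta_mx ord0 i) (pev q) (pev (mderiv i q) x).
Proof.
elim/mpoly_elim : q => [c|j|p q dp dq|p q dp dq].
- by rewrite mderivC pevC pev0; exact: is_derive_cst.
- rewrite pevXU mderivX; apply: (is_derive_eq (is_derive_coord i j x)).
  rewrite pevZ mnm1E eq_sym; case: eqP => [->|_]; last by rewrite mul0r.
  by rewrite mul1r (_ : mnm_sub _ _ = mnm0) ?mpolyX0 -?mpolyC1 ?pevC//; apply/mnmP => k; rewrite mnmBE subnn mnm0E.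
- rewrite mderivD !pevD; exact: (@is_deriveD _ _ _ _ _ _ _ _ _ dp dq).
- rewrite mderivM pevD !pevM; have d := @is_deriveM _ _ _ _ _ _ _ _ dp dq.
  by apply: (is_derive_eq d); rewrite addrC; congr (_ + _); rewrite mulrC.
Qed.

Lemma partial_pev i q : partial i (pev q) = pev (mderiv i q).
Proof. by apply/funext => x; have d := is_derive_pev i q x; exact: derive_val. Qed.

Lemma continuous_pev q : continuous (pev q).
Proof.
elim/mpoly_elim : q => [c|j|p q dp dq|p q dp dq] x.
- by rewrite pevC; exact: cst_continuous.
- by rewrite pevXU; exact: coord_continuous.
- by rewrite pevD; apply: continuousD; [exact: dp|exact: dq].
- by rewrite pevM; apply: continuousM; [exact: dp|exact: dq].
Qed.

Lemma measurable_pev q : measurable_fun setT (pev q).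
Proof. by apply: continuous_measurable_rV; exact: continuous_pev. Qed.
End poly_eval.

Section test_functions.
Variables (R : realType) (n : nat).
Local Notation V := 'rV[R]_n.
Local Notation mu := (lebesgue_rV R n).
Implicit Types (f phi : V -> R) (U : set V) (a : multinom n).

Lemma compact_measurable_rV (K : set V) : compact K -> measurable K.
Proof. by move=> cK; apply: closed_measurable_rV; apply: compact_closed => //; exact: norm_hausdorff. Qed.

Lemma bounded_cbox (K : set V) : bounded_set K -> exists a b : V, K `<=` cbox a b.
Proof.
move=> [M [_ HM]]; exists (const_mx (- (M + 1))), (const_mx (M + 1)) => x Kx i.
rewrite !mxE -ler_norml; apply: le_trans (HM (M + 1) _ x Kx); last by rewrite ltrDl.
rewrite [leRHS]mx_normrE; exact: (le_bigmax _ (fun ij : 'I_1 * 'I_n => `|x ij.1 ij.2|) (ord0, i)).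
Qed.

Lemma bounded_lty (K : set V) : measurable K -> bounded_set K -> (mu K < +oo)%E.
Proof.
move=> mK /bounded_cbox[a [b Kab]].
by apply: (le_lt_trans (le_measure mu _ _ Kab)); rewrite ?inE//;
  [exact: measurable_cbox|exact: lebesgue_cbox_lty].
Qed.

Lemma smooth_partial i phi : smooth phi -> smooth (partial i phi).
Proof. by move=> sp s; have := sp (rcons s i); rewrite foldr_rcons. Qed.

Lemma smooth_continuous phi : smooth phi -> continuous phi.
Proof. by move=> /(_ [::]) []. Qed.

Lemma smooth_is_derive phi i x : smooth phi -> is_derive x (delta_mx ord0 i) phi (partial i phi x).
Proof. by move=> /(_ [::]) [_ /(_ x i)] d; exact: derivableP. Qed.

Lemma test_partial U i phi : test_function U phi -> test_function U (partial i phi).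
Proof.
move=> [sp cp pU].
have sub : closure [set x | partial i phi x != 0] `<=` closure [set x | phi x != 0].
  have -> : closure [set x | phi x != 0] = closure (closure [set x | phi x != 0]).
    by apply/closure_id; exact: closed_closure.
  apply: closureS => x /= /eqP px; apply: contrapT => xn; apply: px.
  have oC : open (~` closure [set x | phi x != 0]) by apply: closed_openC; exact: closed_closure.
  have : \near x, cst 0 x = phi x.
    have : nbhs x (~` closure [set x | phi x != 0]) by exact: open_nbhs_nbhs.
    apply: filterS => y /= yn; apply/esym; apply: contra_notP yn => /eqP hy.
    exact: subset_closure.
  move=> /near_eq_is_derive /(_ (is_derive_cst _ _ _)) d.
  exact: derive_val.
split; first exact: smooth_partial.
- by apply: subclosed_compact cp sub; exact: closed_closure.
- exact: subset_trans pU.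
Qed.

Lemma test_iter U i k phi : test_function U phi -> test_function U (iter k (partial i) phi).
Proof. by move=> tp; elim: k => // k; exact: test_partial. Qed.

Lemma test_foldr U a s phi : test_function U phi ->
  test_function U (foldr (fun i g => iter (a i) (partial i) g) phi s).
Proof. by move=> tp; elim: s => //= i s; exact: test_iter. Qed.

Lemma test_partialm U a phi : test_function U phi -> test_function U (partialm a phi).
Proof. exact: test_foldr. Qed.

Lemma test_out U phi x : test_function U phi -> ~ U x -> phi x = 0.
Proof.
move=> [_ _ pU] nU; apply: contra_notP nU => /eqP h; apply: pU; exact: subset_closure.
Qed.

Lemma test_bounded U phi : test_function U phi -> exists M : R, forall x, `|phi x| <= M.
Proof.
move=> [sp cp pU].
have /compact_bounded[M [_ HM]] : compact (phi @` closure [set x | phi x != 0]).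
  apply: continuous_compact => //.
  by apply: continuous_subspaceT; exact: smooth_continuous.
exists (Num.max (M + 1) 0) => x; have [->|p0] := eqVneq (phi x) 0.
  by rewrite normr0 le_max lexx orbT.
rewrite le_max (HM (M + 1))// ?ltrDl//; exists x => //; exact: subset_closure.
Qed.

Lemma measurable_test U phi : test_function U phi -> measurable_fun setT phi.
Proof. by move=> [sp _ _]; apply: continuous_measurable_rV; exact: smooth_continuous. Qed.

Lemma integrable_loc_test U v phi : open U -> loc_integrable U v -> test_function U phi ->
  mu.-integrable U (fun x => (v x * phi x)%:E).
Proof.
move=> oU [mv lv] tp; have mU := open_measurable_rV oU.
have [M HM] := test_bounded tp.
have [_ cp pU] := tp; pose K := closure [set x | phi x != 0].
have mK : measurable K by exact: compact_measurable_rV.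
have mp : measurable_fun U phi by apply: measurable_funTS; exact: measurable_test tp.
have M0 : 0 <= M by rewrite (le_trans _ (HM 0)).
apply/integrableP; split.
  by apply/measurable_EFinP; apply: measurable_funM.
apply: (@le_lt_trans _ _ (\int[mu]_(x in K) (M%:E * `|v x|%:E))%E).
  have pU' : K `<=` U by exact: pU.
  rewrite -(setIidr pU') integral_mkcondr; apply: ge0_le_integral => //=.
  - by apply/measurable_EFinP; apply: measurableT_comp => //; apply: measurable_funM.
  - apply/(measurable_restrict _ mK mU); apply: measurable_funeM.
    apply/measurable_EFinP; apply: measurableT_comp => //.
    by apply: measurable_funS mv => //; exact: subIsetl.
  - move=> x Ux; rewrite patchE; case: ifPn => [_|/negP xK].
      by rewrite -EFinM lee_fin normrM mulrC ler_wpM2r.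
    have -> : phi x = 0 by apply: contra_notP xK => /eqP h; apply/mem_set; exact: subset_closure.
    by rewrite mulr0 normr0.
rewrite ge0_integralZl//; last first.
  by apply/measurable_EFinP; apply: measurableT_comp => //; apply: measurable_funS mv.
by rewrite lte_mul_pinfty//; exact: lv.
Qed.

Lemma loc_integrable_continuous U f : open U -> continuous f -> loc_integrable U f.
Proof.
move=> oU cf; have mf := continuous_measurable_rV cf; split; first exact: measurable_funTS.
move=> K KU cK; have mK := compact_measurable_rV cK.
have /compact_bounded[M [_ HM]] : compact (f @` K).
  by apply: continuous_compact => //; exact: continuous_subspaceT.
have M0 : 0 <= `|M + 1| by [].
apply: (@le_lt_trans _ _ (\int[mu]_(x in K) (cst `|M + 1|%:E x))%E).
  apply: ge0_le_integral => //.
  - by apply/measurable_EFinP; apply: measurableT_comp => //; exact: measurable_funTS.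
  - move=> x Kx; rewrite lee_fin (le_trans _ (ler_norm _))//; apply: HM; first by rewrite ltrDl.
    by exists x.
rewrite integral_cst// lte_mul_pinfty//.
by apply: bounded_lty => //; exact: compact_bounded.
Qed.

(** By translation invariance f(x + e) - f(x) has zero integral. It is also the integral over t in
    [0, 1] of df(x + t e), and after Fubini every t contributes the same integral of [df]. *)
Lemma integral_partial_eq0 (f df : V -> R) (i : 'I_n) :
  (forall x, is_derive x (delta_mx ord0 i) f (df x)) -> continuous df ->
  measurable_fun setT f ->
  mu.-integrable setT (EFin \o f) -> mu.-integrable setT (EFin \o df) ->
  \int[mu]_x df x = 0.
Proof.
move=> dE cdf mf if_ idf; set e : V := delta_mx ord0 i.
have I0 := @integrable_shift R n e df (cst 1) 1 idf (measurable_cst _) (fun _ => norm1_le1 R).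
have E1 : \int[mu]_x (f (x + e) - f x) = 0.
  rewrite RintegralB//; last exact: (integrable_translation e if_).
  by rewrite Rint_translation// subrr.
have mdf := continuous_measurable_rV cdf.
transitivity (\int[unif R]_t \int[mu]_x (cst 1 (x, t) * df (x + clamp t *: e))).
  transitivity (\int[unif R]_t \int[mu]_x df x).
    rewrite [RHS]Rintegral_cst//= (_ : uniform_prob _ _ = 1%E) ?mulr1//.
    exact: (@probability_setT _ _ _ (unif R)).
  apply: eq_Rintegral => t _; rewrite -(Rint_translation (clamp t *: e))//.
  by apply: eq_Rintegral => x _; rewrite mul1r.
rewrite -(Rfubini I0) -[RHS]E1; apply: eq_Rintegral => x _.
transitivity (\int[unif R]_t df (x + clamp t *: e)).
  by apply: eq_Rintegral => t _ /=; rewrite mul1r.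
have FTC := @FTC_unif _ (fun s : R => f (x + s *: e)) (fun s : R => df (x + s *: e)).
rewrite scale1r scale0r addr0 in FTC; apply: FTC.
  by move=> s; apply/is_derive_line.
move=> s; apply: (@continuous_comp _ _ _ (fun s : R => x + s *: e) df); last exact: cdf.
apply: continuousD; first exact: cst_continuous.
by apply: continuousZl; exact: cvg_id.
Qed.
End test_functions.

(** * Weak derivatives *)

Section weak_derivatives.
Variables (R : realType) (n : nat).
Local Notation V := 'rV[R]_n.
Local Notation mu := (lebesgue_rV R n).
Implicit Types (v w g h phi : V -> R) (U : set V) (a : multinom n) (q : mpoly n R).

Lemma test_functionS U W phi : U `<=` W -> test_function U phi -> test_function W phi.
Proof. by move=> UW [? ? pU]; split => //; exact: subset_trans UW. Qed.

Lemma Rint_test U v phi : test_function U phi ->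
  \int[mu]_(x in U) (v x * phi x) = \int[mu]_x (v x * phi x).
Proof.
move=> tp; rewrite Rintegral_mkcond; apply: eq_Rintegral => x _; rewrite patchE.
by case: ifPn => // /negP xU; rewrite (test_out tp) ?mulr0// => /mem_set.
Qed.

Lemma integrable_pev_test U q phi : test_function U phi ->
  mu.-integrable setT (fun x => (pev q x * phi x)%:E).
Proof.
move=> tp; apply: integrable_loc_test; first exact: openT.
- by apply: loc_integrable_continuous; [exact: openT|exact: continuous_pev].
- exact: test_functionS tp.
Qed.

Lemma IBP_pev U i q phi : test_function U phi ->
  \int[mu]_x (pev q x * partial i phi x) = - \int[mu]_x (pev (mderiv i q) x * phi x).
Proof.
move=> tp; have tp' := test_partial i tp; have [sp _ _] := tp; have [sp' _ _] := tp'.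
have I1 := integrable_pev_test q tp'; have I2 := integrable_pev_test (mderiv i q) tp.
apply/eqP; rewrite -addr_eq0 -RintegralD//; apply/eqP.
apply: (@integral_partial_eq0 _ _ (fun x => pev q x * phi x) _ i).
- move=> x; have d := @is_deriveM _ _ _ _ _ _ _ _ (is_derive_pev i q x) (smooth_is_derive i x sp).
  by apply: (is_derive_eq d); congr (_ + _); exact: mulrC.
- move=> x; apply: (@continuousD _ _ _ (fun x => pev q x * partial i phi x)); apply: continuousM.
  + exact: continuous_pev.
  + exact: (smooth_continuous sp').
  + exact: continuous_pev.
  + exact: (smooth_continuous sp).
- by apply: measurable_funM; [exact: measurable_pev|exact: measurable_test tp].
- exact: integrable_pev_test tp.
- exact: (integrableD measurableT I1 I2).
Qed.

Lemma IBP_pev_iter U i k q phi : test_function U phi ->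
  \int[mu]_x (pev q x * iter k (partial i) phi x) =
  (-1) ^+ k * \int[mu]_x (pev (iter k (mderiv i) q) x * phi x).
Proof.
move=> tp; elim: k q => [|k IH] q; first by rewrite mul1r.
by rewrite [iter k.+1 _ phi]/= (IBP_pev _ _ (test_iter i k tp)) IH iterSr exprS mulN1r mulNr.
Qed.

Lemma IBP_pev_m U a q phi : test_function U phi ->
  \int[mu]_x (pev q x * partialm a phi x) =
  (-1) ^+ mdeg a * \int[mu]_x (pev (mderivm a q) x * phi x).
Proof.
move=> tp; rewrite /partialm.
have H s q' : \int[mu]_x (pev q' x * foldr (fun i g => iter (a i) (partial i) g) phi s x) =
   (-1) ^+ (\sum_(i <- s) a i) *
     \int[mu]_x (pev (mderivm (\big[@mnm_add n/@mnm0 n]_(i <- s) mnm_muln (mnm1 i) (a i)) q') x * phi x).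
  elim: s q' => [|i s IH] q'; first by rewrite !big_nil expr0 mul1r mderivm0m.
  rewrite /= (IBP_pev_iter _ _ _ (test_foldr a s tp)) IH !big_cons exprD mulrA mderivmDm.
  by rewrite mderivn_iter.
rewrite H; congr (_ * _).
  by rewrite mdegE big_enum.
by rewrite {2}(multinomUE_id a) big_enum.
Qed.

Lemma is_wderiv_pev U a q : open U -> is_wderiv U a (pev q) (pev (mderivm a q)).
Proof.
move=> oU; split; [| |move=> phi tp].
- by apply: loc_integrable_continuous => //; exact: continuous_pev.
- by apply: loc_integrable_continuous => //; exact: continuous_pev.
by rewrite !Rint_test//; [exact: IBP_pev_m tp|exact: test_partialm].
Qed.

Lemma loc_integrableB U v w : measurable U -> loc_integrable U v -> loc_integrable U w ->
  loc_integrable U (v \- w).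
Proof.
move=> mU [mv lv] [mw lw]; split; first exact: measurable_funB.
move=> K KU cK; have mK := compact_measurable_rV cK.
have mvK : measurable_fun K (fun x => `|v x|%:E).
  by apply/measurable_EFinP; apply: measurableT_comp => //; exact: measurable_funS mv.
have mwK : measurable_fun K (fun x => `|w x|%:E).
  by apply/measurable_EFinP; apply: measurableT_comp => //; exact: measurable_funS mw.
apply: (@le_lt_trans _ _ (\int[mu]_(x in K) (`|v x|%:E + `|w x|%:E))%E).
  apply: ge0_le_integral => //=.
  - apply/measurable_EFinP; apply: measurableT_comp => //.
    by apply: measurable_funB; [exact: measurable_funS mv|exact: measurable_funS mw].
  - exact: emeasurable_funD.
  - by move=> x Kx; rewrite -EFinD lee_fin ler_normB.
by rewrite ge0_integralD//; apply: lte_add_pinfty; [exact: lv|exact: lw].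
Qed.

Lemma is_wderivB U a v g w h : open U -> is_wderiv U a v g -> is_wderiv U a w h ->
  is_wderiv U a (v \- w) (g \- h).
Proof.
move=> oU [lv lg H] [lw lh H']; have mU := open_measurable_rV oU.
split; [exact: loc_integrableB|exact: loc_integrableB|move=> phi tp].
have tpm := test_partialm a tp.
have E u u' psi : loc_integrable U u -> loc_integrable U u' -> test_function U psi ->
   \int[mu]_(x in U) ((u \- u') x * psi x) =
   \int[mu]_(x in U) (u x * psi x) - \int[mu]_(x in U) (u' x * psi x).
  move=> lu lu' tpsi; rewrite -RintegralB//; try exact: integrable_loc_test.
  by apply: eq_Rintegral => x _; rewrite /= mulrBl.
by rewrite !E// H// H'// mulrBr.
Qed.

Lemma loc_integrable_cbox U v (a b : V) : measurable U -> cbox a b `<=` U -> loc_integrable U v ->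
  mu.-integrable (cbox a b) (EFin \o v).
Proof.
move=> mU abU [mv lv]; apply/integrableP; split.
  by apply/measurable_EFinP; exact: measurable_funS mv.
exact: (lv _ abU (@compact_cbox _ _ _ _)).
Qed.

Lemma wderiv_unique U a v g h : open U -> is_wderiv U a v g -> is_wderiv U a v h ->
  {ae mu, forall x, U x -> g x = h x}.
Proof.
move=> oU [_ lg H] [_ lh H']; have mU := open_measurable_rV oU.
suff : {ae mu, forall x, U x -> (g \- h) x = 0}.
  by apply: filterS => x + Ux => /(_ Ux)/eqP; rewrite subr_eq0 => /eqP.
apply: fundamental_lemma => //.
- by have [] := loc_integrableB mU lg lh.
- by move=> b c bcU; exact: (loc_integrable_cbox mU bcU (loc_integrableB mU lg lh)).
move=> b c B bcU pB; have tp := test_function_pb bcU pB.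
rewrite -[LHS](_ : \int[mu]_(x in U) (g x * pb B x) - \int[mu]_(x in U) (h x * pb B x) = _); last first.
  rewrite -RintegralB//; try exact: integrable_loc_test.
  by apply: eq_Rintegral => x _; rewrite /= mulrBl.
apply/eqP; rewrite subr_eq0 -(inj_eq (mulfI (negbT (signr_eq0 R (mdeg a))))).
by rewrite -H// H'.
Qed.

(** Up to sign, both integrals equal that of [v] against the derivative of order [a] + e_i of the
    bump. On products this derivative is taken factor by factor, so no commutation of partial
    derivatives is required. The result is the first-order relation between successive weak
    derivatives on which the Poincare inequality rests. *)
Lemma wderiv_step U a i v g h (b c : V) (B : 'I_n -> R -> R) :
  is_wderiv U a v g -> is_wderiv U (mnm_add a (mnm1 i)) v h ->
  cbox b c `<=` U -> pbump b c B ->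
  \int[mu]_(x in U) (g x * pb (upd B i) x) = - \int[mu]_(x in U) (h x * pb B x).
Proof.
move=> [_ _ H] [_ _ H'] bcU pB.
have CB := pbump_Coo pB.
have := H _ (test_function_pb bcU (pbump_upd i pB)).
have := H' _ (test_function_pb bcU pB).
rewrite !partialm_pb//; last exact: upd_Coo.
have -> : (fun k => derive1n (mnm_add a (mnm1 i) k) (B k)) = (fun k => derive1n (a k) (upd B i k)).
  apply/funext => k; rewrite mnmDE mnm1E /upd eq_sym; case: eqP => _; rewrite ?addn0//.
  by rewrite addn1 /derive1n iterSr.
move=> -> /eqP; rewrite mdegD mdeg1 addn1 exprS mulN1r mulNr -mulrN.
by rewrite (inj_eq (mulfI _)) ?signr_eq0// => /eqP.
Qed.
End weak_derivatives.

(** * Lp norms *)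

Section Lnorm_facts.
Context (d : measure_display) (T : measurableType d) (R : realType).
Variable mu : {measure set T -> \bar R}.
Implicit Types (f g : T -> R) (p : \bar R) (U : set T).
Local Open Scope ereal_scope.

Lemma measurable_powe f (r : R) : measurable_fun setT f ->
  measurable_fun setT (fun x => `|(f x)%:E| `^ r).
Proof.
move=> mf; apply: (measurableT_comp (measurable_poweR r)).
by apply/measurable_EFinP; exact: measurableT_comp.
Qed.

Lemma Lnorm_le f g p : measurable_fun setT f -> measurable_fun setT g -> 1 <= p ->
  {ae mu, forall x, (`|f x| <= `|g x|)%R} -> 'N[mu]_p[EFin \o f] <= 'N[mu]_p[EFin \o g].
Proof.
move=> mf mg; rewrite unlock; case: p => [r r1|_ fg|//].
  rewrite lee_fin in r1; have r0 : (0 <= r)%R by rewrite (le_trans _ r1).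
  move=> fg; apply: gt0_ler_poweR; rewrite ?invr_ge0//.
  - by rewrite in_itv/= leey andbT; apply: integral_ge0 => x _; rewrite ?lee_fin ?poweR_ge0 ?powR_ge0.
  - by rewrite in_itv/= leey andbT; apply: integral_ge0 => x _; rewrite ?lee_fin ?poweR_ge0 ?powR_ge0.
  apply: ae_ge0_le_integral => //.
  - by move=> x _; exact: poweR_ge0.
  - exact: measurable_powe.
  - by move=> x _; exact: poweR_ge0.
  - exact: measurable_powe.
  - apply: filterS fg => x fgx _ /=.
    by rewrite lee_fin; apply: ge0_ler_powR => //; rewrite nnegrE.
case: ifPn => // mu0; apply: le_ess_sup.
by apply: filterS fg => x /=; rewrite lee_fin.
Qed.

Lemma Lnorm_scale f p (c : R) : measurable_fun setT f -> 1 <= p ->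
  'N[mu]_p[EFin \o (fun x => c * f x)%R] = `|c|%:E * 'N[mu]_p[EFin \o f].
Proof.
move=> mf; rewrite unlock; case: p => [r r1| _|//].
  rewrite lee_fin in r1; have r0 : (0 < r)%R by rewrite (lt_le_trans _ r1).
  under eq_integral do rewrite /= normrM powRM// EFinM.
  rewrite ge0_integralZl//; last by move: (measurable_powe r mf).
  rewrite -poweR_EFin.
  rewrite poweRM ?poweR_ge0//; last by apply: integral_ge0 => x _; rewrite lee_fin powR_ge0.
  by rewrite -poweRrM mulfV ?gt_eqF// poweRe1.
case: ifPn => [mu0|]; last by rewrite mule0.
rewrite -ess_supZl//; congr ess_sup.
by apply/funext => x /=; rewrite normrM EFinM.
Qed.

Lemma Lnorm_indic U (r : R) : measurable U -> (1 <= r)%R ->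
  'N[mu]_r%:E[EFin \o \1_U] = mu U `^ r^-1.
Proof.
move=> mU r1; rewrite unlock; congr (_ `^ _).
rewrite (_ : mu U = \int[mu]_x (\1_U x)%:E); last by rewrite integral_indic// setIT.
apply: eq_integral => x _ /=.
rewrite indicE; case: (_ \in _); rewrite ?normr1 ?normr0 ?powR1// powR0//.
by rewrite gt_eqF// (lt_le_trans _ r1).
Qed.

(** Writing the norm of [\1_U] instead of a power of the measure gives one formula for finite and
    infinite [p]. For finite [p], the powers with the two conjugate exponents multiply to the
    measure of [U]. *)
Lemma Lnorm_hoelder1 U f p : measurable U -> mu U < +oo -> measurable_fun setT f ->
  (forall x, ~ U x -> f x = 0%R) -> 1 <= p ->
  'N[mu]_1[EFin \o f] * 'N[mu]_p[EFin \o \1_U] <= mu U * 'N[mu]_p[EFin \o f].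
Proof.
move=> mU Uoo mf fU; case: p => [r|_|//].
  (* The exponent 1 is separated because its conjugate [r / (r - 1)] is not finite. *)
  rewrite lee_fin le_eqVlt => /predU1P[<-|r1].
    by rewrite Lnorm_indic// invr1 poweRe1// muleC.
  have r0 : (0 < r)%R by rewrite (lt_trans _ r1).
  pose q := (r / (r - 1))%R.
  have q0 : (0 < q)%R by rewrite divr_gt0// subr_gt0.
  have rq : (r^-1 + q^-1 = 1)%R by rewrite /q invf_div; field; rewrite gt_eqF.
  have q1 : (1 <= q)%R by rewrite /q ler_pdivlMr ?subr_gt0// mul1r lerBlDr lerDl.
  have H := hoelder mu mf (measurable_indic mU) r0 q0 rq.
  have E : (f \* \1_U)%R = f.
    apply/funext => x /=; rewrite indicE; case: (boolP (x \in U)) => [_|xU]; rewrite ?mulr1//.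
    by rewrite fU ?mulr0//; move/negP: xU; exact/contra_not/mem_set.
  rewrite E in H; rewrite Lnorm_indic// in H; rewrite Lnorm_indic ?(ltW r1)//.
  apply: (le_trans (lee_wpmul2r (poweR_ge0 _ _) H)).
  have E2 : mu U `^ q^-1 * mu U `^ r^-1 = mu U.
    have sum1 : (q^-1 + r^-1 = 1)%R by rewrite addrC.
    rewrite -poweRD; first by rewrite sum1 poweRe1.
    by apply: add_neq0_poweRD_def; rewrite sum1 oner_neq0.
  by rewrite -muleA E2 muleC.
have [->|N1] := eqVneq 'N[mu]_1[EFin \o f] 0.
  by rewrite mul0e mule_ge0// Lnorm_ge0.
have mT0 : 0 < mu setT.
  rewrite lt0e measure_ge0 andbT; apply: contra N1 => /eqP mT0.
  rewrite Lnorm1; apply/eqP; apply: null_set_integral => //.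
  by apply: measurableT_comp => //; exact/measurable_EFinP.
have H1 : 'N[mu]_+oo[EFin \o \1_U] <= 1.
  rewrite unlock mT0; apply/ess_supP/nearW => x /=.
  by rewrite indicE; case: (_ \in _); rewrite ?normr1 ?normr0.
apply: (le_trans (lee_wpmul2l (Lnorm_ge0 _ _ _) H1)); rewrite mule1 Lnorm1.
have -> : \int[mu]_x `|(EFin \o f) x| = \int[mu]_(x in U) `|(EFin \o f) x|.
  rewrite [RHS]integral_mkcond; apply: eq_integral => x _; rewrite patchE; case: ifPn => // /negP xU.
  by rewrite /= fU ?normr0// => Ux; apply: xU; exact: mem_set.
rewrite muleC unlock mT0 -integral_cst//; apply: ae_ge0_le_integral => //.
- by apply: measurable_funTS; apply: measurableT_comp => //; exact/measurable_EFinP.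
- by move=> x _ /=; apply: ess_sup_gee => //; apply: nearW => y /=.
- by apply: filterS (ess_sup_ge mu (abse \o (EFin \o f))) => x + _.
Qed.

End Lnorm_facts.

(** The previous inequality on the whole space: for a probability the constant 1 has norm 1 for
    every [p]. *)
Lemma Lnorm_jensen (d : measure_display) (T : measurableType d) (R : realType)
  (nu : probability T R) (f : T -> R) p : measurable_fun setT f -> (1 <= p)%E ->
  ('N[nu]_1[EFin \o f] <= 'N[nu]_p[EFin \o f])%E.
Proof.
move=> mf p1.
have PT : nu setT = 1%E by exact: probability_setT.
have H : ('N[nu]_1[EFin \o f] * 'N[nu]_p[EFin \o \1_setT] <= nu setT * 'N[nu]_p[EFin \o f])%E.
  apply: (@Lnorm_hoelder1 _ _ _ nu setT f p measurableT _ mf (fun x h => False_ind _ (h I)) p1).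
  by rewrite [ltLHS]PT ltry.
have nu1 : (0 < nu setT)%E by rewrite PT lte01.
move: H; rewrite PT mul1e.
suff -> : ('N[nu]_p[EFin \o \1_setT] = 1)%E by rewrite mule1.
case: p p1 => [r r1| _|//]; first by rewrite Lnorm_indic//; rewrite [X in (X `^ _)%E]PT poweR1r.
rewrite unlock ifT//.
apply: ess_sup_ae_cst => //.
by apply: nearW => x /=; rewrite indicT normr1.
Qed.

Section Lp_norm_facts.
Variables (R : realType) (n : nat) (U : set 'rV[R]_n) (p : \bar R).
Hypotheses (mU : measurable U) (p1 : (1 <= p)%E).
Local Notation V := 'rV[R]_n.
Local Notation mu := (lebesgue_rV R n).
Implicit Types (f g : V -> R).

Definition Lfin f := measurable_fun U f /\ (Lp_norm U p f < +oo)%E.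
(* [nrm f] is [0] if [f] has infinite norm: it is meaningful under [Lfin f]. *)
Definition nrm f : R := fine (Lp_norm U p f).

Lemma measurable_rest f : measurable_fun U f -> measurable_fun setT (f \_ U).
Proof. by move=> mf; apply: (iffLR (measurable_restrictT f mU)). Qed.

Lemma nrm_ge0 f : 0 <= nrm f.
Proof. by rewrite fine_ge0// Lnorm_ge0. Qed.

Lemma nrmE f : Lfin f -> (nrm f)%:E = Lp_norm U p f.
Proof. by move=> [_ f1]; rewrite /nrm fineK// ge0_fin_numE// Lnorm_ge0. Qed.

Lemma Lp_norm_le f g : measurable_fun U f -> measurable_fun U g ->
  {ae mu, forall x, U x -> `|f x| <= `|g x|} -> (Lp_norm U p f <= Lp_norm U p g)%E.
Proof.
move=> mf mg fg; apply: Lnorm_le => //; [exact: measurable_rest|exact: measurable_rest|].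
apply: filterS fg => x h; rewrite !patchE; case: ifPn => // xU; apply: h; exact: set_mem.
Qed.

Lemma Lp_norm_ae_eq f g : measurable_fun U f -> measurable_fun U g ->
  {ae mu, forall x, U x -> f x = g x} -> Lp_norm U p f = Lp_norm U p g.
Proof.
move=> mf mg fg; apply/eqP; rewrite eq_le !Lp_norm_le//;
by apply: filterS fg => x h /h ->.
Qed.

Lemma Lp_normD f g : measurable_fun U f -> measurable_fun U g ->
  (Lp_norm U p (fun x => f x + g x)%R <= Lp_norm U p f + Lp_norm U p g)%E.
Proof.
move=> mf mg; rewrite /Lp_norm (_ : (fun x => f x + g x) \_ U = (f \_ U) \+ (g \_ U)).
  by apply: eminkowski => //; exact: measurable_rest.
by apply/funext => x /=; rewrite !patchE; case: ifPn; rewrite ?addr0.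
Qed.

Lemma Lp_normZ c f : measurable_fun U f -> Lp_norm U p (fun x => c * f x) = (`|c|%:E * Lp_norm U p f)%E.
Proof.
move=> mf; rewrite -Lnorm_scale//; last exact: measurable_rest.
congr Lnorm; apply/funext => x /=; rewrite !patchE; case: ifPn; rewrite ?mulr0//.
Qed.

Lemma LfinZ c f : Lfin f -> Lfin (fun x => c * f x).
Proof.
move=> [mf ff]; split; first by apply: measurable_funM.
by rewrite Lp_normZ// lte_mul_pinfty.
Qed.

Lemma nrmZ c f : Lfin f -> nrm (fun x => c * f x) = `|c| * nrm f.
Proof.
move=> Lf; apply: EFin_inj; rewrite EFinM !nrmE//; last exact: LfinZ.
by rewrite Lp_normZ//; case: Lf.
Qed.

Lemma LfinD f g : Lfin f -> Lfin g -> Lfin (fun x => f x + g x).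
Proof.
move=> [mf ff] [mg fg]; split; first exact: measurable_funD.
by apply: (le_lt_trans (Lp_normD mf mg)); exact: lte_add_pinfty.
Qed.

Lemma nrmD f g : Lfin f -> Lfin g -> nrm (fun x => f x + g x) <= nrm f + nrm g.
Proof.
move=> Lf Lg; rewrite -lee_fin EFinD !nrmE//; last exact: LfinD.
by apply: Lp_normD; [case: Lf|case: Lg].
Qed.

Lemma LfinN f : Lfin f -> Lfin (fun x => - f x).
Proof. by move=> /(LfinZ (-1)); congr Lfin; apply/funext => x; rewrite mulN1r. Qed.

Lemma nrmN f : Lfin f -> nrm (fun x => - f x) = nrm f.
Proof.
move=> /(nrmZ (-1)); rewrite normrN normr1 mul1r => <-; congr nrm.
by apply/funext => x; rewrite mulN1r.
Qed.

Lemma LfinB f g : Lfin f -> Lfin g -> Lfin (fun x => f x - g x).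
Proof. by move=> Lf /LfinN; exact: LfinD. Qed.

Lemma nrmB f g : Lfin f -> Lfin g -> nrm (fun x => f x - g x) <= nrm f + nrm g.
Proof. by move=> Lf Lg; rewrite -(nrmN Lg); apply: nrmD => //; exact: LfinN. Qed.

Lemma nrm_le f g : measurable_fun U f -> Lfin g -> {ae mu, forall x, U x -> `|f x| <= `|g x|} ->
  Lfin f /\ nrm f <= nrm g.
Proof.
move=> mf Lg fg; have le := Lp_norm_le mf (proj1 Lg) fg.
have Lf : Lfin f by split => //; apply: (le_lt_trans le); case: Lg.
by split => //; rewrite -lee_fin !nrmE.
Qed.

Lemma nrm_ae_eq f g : measurable_fun U f -> Lfin g -> {ae mu, forall x, U x -> f x = g x} ->
  Lfin f /\ nrm f = nrm g.
Proof.
move=> mf Lg fg; have E := Lp_norm_ae_eq mf (proj1 Lg) fg.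
by split; rewrite /nrm ?E//; split => //; rewrite E; case: Lg.
Qed.

Lemma nrm_sum (I : Type) (s : seq I) (F : I -> V -> R) : (forall i, Lfin (F i)) ->
  Lfin (fun x => \sum_(i <- s) F i x) /\
  nrm (fun x => \sum_(i <- s) F i x) <= \sum_(i <- s) nrm (F i).
Proof.
move=> LF; elim: s => [|i s [L1 L2]].
  have E : (fun x : V => \sum_(i <- [::]) F i x) = cst 0 by apply/funext => x; rewrite big_nil.
  have E0 : Lp_norm U p (cst 0) = 0%E.
    rewrite /Lp_norm (_ : EFin \o _ = cst 0%E) ?Lnorm0 ?gt_eqF ?(lt_le_trans _ p1)//.
    by apply/funext => x /=; rewrite patchE; case: ifP.
  rewrite E big_nil /nrm E0; split=> //; split; first exact: measurable_cst.
  by rewrite E0.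
have E : (fun x : V => \sum_(i <- i :: s) F i x) = (fun x => F i x + \sum_(i <- s) F i x).
  by apply/funext => x; rewrite big_cons.
rewrite E big_cons; split; first exact: LfinD.
by apply: (le_trans (nrmD _ _)) => //; rewrite lerD2l.
Qed.
End Lp_norm_facts.

(** * The Poincare inequality on star-shaped sets *)

Section tonelli3.
Context d1 d2 d3 (T1 : measurableType d1) (T2 : measurableType d2)
  (T3 : measurableType d3) (R : realType).
Variables (m1 : {sigma_finite_measure set T1 -> \bar R})
  (m2 : {sigma_finite_measure set T2 -> \bar R})
  (m3 : {sigma_finite_measure set T3 -> \bar R}).
Variable f : (T1 * T2) * T3 -> \bar R.
Hypotheses (mf : measurable_fun setT f) (f0 : forall z, (0 <= f z)%E).

Let f1 (y : (T1 * T3) * T2) := f ((y.1.1, y.2), y.1.2).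

Let mf1 : measurable_fun setT f1.
Proof.
apply: (measurableT_comp mf); apply: measurable_fun_pair; last first.
  exact: (measurableT_comp measurable_snd measurable_fst).
apply: measurable_fun_pair; last exact: measurable_snd.
exact: (measurableT_comp measurable_fst measurable_fst).
Qed.

Let mF := @measurable_fun_fubini_tonelli_F _ _ _ _ _ m2 _ mf1 (fun y => f0 _).

Let F0 (y : T1 * T3) : (0 <= fubini_F m2 f1 y)%E.
Proof. by apply: integral_ge0 => t _; exact: f0. Qed.

Let mf_t (t : T3) : measurable_fun setT (fun z : T1 * T2 => f (z, t)).
Proof. exact: (measurableT_comp mf (pair2_measurable t)). Qed.

Let mf_x (x : T1) : measurable_fun setT (fun z : T2 * T3 => f ((x, z.1), z.2)).
Proof.
apply: (measurableT_comp mf); apply: measurable_fun_pair; last exact: measurable_snd.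
apply: measurable_fun_pair; [exact: measurable_cst|exact: measurable_fst].
Qed.

Let inner t : (\int[m1 \x m2]_z f (z, t) = \int[m1]_x fubini_F m2 f1 (x, t))%E.
Proof. by rewrite fubini_tonelli1. Qed.

(** The variable [t] is exchanged with one component of the pair at a time; [f1] regroups the
    arguments accordingly. *)
Lemma tonelli3 : (\int[m1 \x m2]_z \int[m3]_t f (z, t)
  = \int[m3]_t \int[m1 \x m2]_z f (z, t))%E.
Proof.
have mf3 := @measurable_fun_fubini_tonelli_F _ _ _ _ _ m3 _ mf f0.
rewrite (@fubini_tonelli1 _ _ _ _ _ m1 m2 _ mf3); last first.
  by move=> z; apply: integral_ge0 => t _; exact: f0.
under [RHS]eq_integral do rewrite inner.
rewrite -[RHS](@fubini_tonelli _ _ _ _ _ m1 m3 _ mF F0); apply: eq_integral => x _.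
exact: (@fubini_tonelli _ _ _ _ _ m2 m3 _ (mf_x x) (fun=> f0 _)).
Qed.

Lemma measurable_tonelli3 :
  measurable_fun setT (fun t => \int[m1 \x m2]_z f (z, t))%E.
Proof.
under eq_fun do rewrite inner.
exact: (@measurable_fun_fubini_tonelli_G _ _ _ _ _ m1 _ mF F0).
Qed.

End tonelli3.

(** * Averaging over segments issued from a set *)

Section kernel.
Variables (R : realType) (n : nat).
Local Notation V := 'rV[R]_n.
Local Notation mu := (lebesgue_rV R n).
Local Notation nu := (unif R).
Implicit Types (E U : set V) (H : V -> \bar R).
Local Open Scope ereal_scope.

Lemma measurable_pairD : measurable_fun setT (fun z : V * V => (z.1 + z.2)%R).
Proof. by apply: measurable_rVD; [exact: measurable_fst|exact: measurable_snd]. Qed.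

Lemma measurable_indic_comp (d : measure_display) (T : measurableType d) (k : T -> V) U :
  measurable U -> measurable_fun setT k -> measurable_fun setT (fun x => (\1_U (k x))%:E : \bar R).
Proof.
move=> mU mk; apply/measurable_EFinP.
exact: (measurableT_comp (measurable_indic mU) mk).
Qed.

Lemma integral_indicM (d : measure_display) (T : measurableType d)
    (m : {measure set T -> \bar R}) (U : set T) (f : T -> \bar R) :
  \int[m]_x ((\1_U x)%:E * f x) = \int[m]_(x in U) f x.
Proof.
rewrite [RHS]integral_mkcond; apply: eq_integral => x _; rewrite patchE indicE.
by case: (_ \in _); rewrite ?mul1e ?mul0e.
Qed.

Lemma half_pow_bound (t : R) : (1 / 2 <= t)%R -> ((`|t| ^+ n)^-1 <= 2 ^+ n)%R.
Proof.
move=> t2; have t0 : (0 < t)%R by lra.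
rewrite gtr0_norm// -exprVn; apply: lerXn2r; rewrite ?nnegrE ?invr_ge0 ?(ltW t0)//.
by rewrite invf_ple ?posrE// (le_trans _ t2)// div1r.
Qed.

(* The point [z.1 + t *: z.2] is substituted for [z.2], with [z.1] fixed if
   [t >= 1 / 2] and [z.1 + z.2] fixed otherwise: the Jacobian, [t ^+ n] or
   [(1 - t) ^+ n], is at least [2 ^- n]. *)
Lemma kernel_t E U H (t : R) : measurable E -> measurable U ->
  measurable_fun setT H -> (forall x, 0 <= H x) -> (0 <= t <= 1)%R ->
  \int[(mu \x mu)]_z ((\1_E z.1)%:E * ((\1_U (z.1 + z.2)%R)%:E * H (z.1 + t *: z.2)%R))
  <= (2 ^+ n)%:E * ((mu E + mu U) * \int[mu]_x H x).
Proof.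
move=> mE mU mH H0 t01.
have mF : measurable_fun setT (fun z : V * V => (\1_E z.1)%:E * ((\1_U (z.1 + z.2)%R)%:E * H (z.1 + t *: z.2)%R)).
  apply: emeasurable_funM; first exact: measurable_indic_comp measurable_fst.
  apply: emeasurable_funM; first exact: measurable_indic_comp measurable_pairD.
  apply: (measurableT_comp mH); apply: measurable_rVD; first exact: measurable_fst.
  by apply: measurable_rVZ; [exact: measurable_cst|exact: measurable_snd].
have F0 z : 0 <= (\1_E z.1)%:E * ((\1_U (z.1 + z.2)%R)%:E * H (z.1 + t *: z.2)%R).
  by rewrite !mule_ge0// lee_fin.
have I0 : 0 <= \int[mu]_x H x by exact: integral_ge0.
have mHa a c : measurable_fun setT (fun x : V => H (c + a *: x)%R).
  by apply: (measurableT_comp mH); exact: measurable_aff.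
have c2 : (0 <= 2 ^+ n :> R)%R by rewrite exprn_ge0.
have [t2|t2] := leP (1 / 2)%R t.
  rewrite fubini_tonelli1//.
  apply: (@le_trans _ _ (\int[mu]_(x in E) ((2 ^+ n)%:E * \int[mu]_x H x))).
    rewrite -[X in _ <= X](integral_indicM mu E (fun=> (2 ^+ n)%:E * \int[mu]_x H x)); apply: ge0_le_integral => //.
    - by move=> x _; exact: integral_ge0.
    - exact: measurable_fun_fubini_tonelli_F.
    - by apply: emeasurable_funM; [exact: measurable_indic_comp|exact: measurable_cst].
    move=> x _; rewrite /fubini_F /= ge0_integralZl//; last 2 first.
    - apply: emeasurable_funM => //; apply: measurable_indic_comp => //.
      by apply: measurable_rVD => //; exact: measurable_cst.
    - by move=> y _; rewrite mule_ge0// lee_fin.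
    rewrite lee_wpmul2l ?lee_fin//.
    apply: (@le_trans _ _ (\int[mu]_e H (x + t *: e)%R)).
      apply: ge0_le_integral => //.
      - by move=> y _; rewrite mule_ge0// lee_fin.
      - apply: emeasurable_funM => //; apply: measurable_indic_comp => //.
        by apply: measurable_rVD => //; exact: measurable_cst.
      - by move=> y _; rewrite indicE; case: (_ \in _); rewrite ?mul1e ?mul0e.
    rewrite ge0_integral_aff//; last by rewrite gt_eqF//; lra.
    by rewrite lee_wpmul2r// lee_fin half_pow_bound.
  rewrite integral_cst// muleC muleA [X in _ <= X]muleA lee_wpmul2r//.
  by rewrite muleC lee_wpmul2l ?lee_fin// leeDl.
rewrite fubini_tonelli2//.
have mG' : measurable_fun setT (fun z : V * V => (\1_U z.1)%:E * H (z.1 + (t - 1) *: z.2)%R).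
  apply: emeasurable_funM; first exact: measurable_indic_comp measurable_fst.
  apply: (measurableT_comp mH); apply: measurable_rVD; first exact: measurable_fst.
  by apply: measurable_rVZ; [exact: measurable_cst|exact: measurable_snd].
have G0 z : 0 <= (\1_U z.1)%:E * H (z.1 + (t - 1) *: z.2)%R by rewrite mule_ge0// lee_fin.
apply: (@le_trans _ _ (\int[mu]_e \int[mu]_x ((\1_U x)%:E * H (x + (t - 1) *: e)%R))).
  apply: ge0_le_integral => //.
  - by move=> x _; exact: integral_ge0.
  - exact: measurable_fun_fubini_tonelli_G.
  - have hFG := @measurable_fun_fubini_tonelli_G _ _ _ _ _ mu _ mG' G0; exact: hFG.
  move=> e _; rewrite /fubini_G.
  have mG e' : measurable_fun setT (fun x : V => (\1_U x)%:E * H (x + e')%R).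
    apply: emeasurable_funM; first exact: measurable_indic_comp.
    by apply: (measurableT_comp mH); apply: measurable_rVD => //; exact: measurable_cst.
  rewrite -(ge0_integral_translation e (f := fun x => (\1_U x)%:E * H (x + (t - 1) *: e)%R))//; last first.
    by move=> x; rewrite mule_ge0// lee_fin.
  apply: ge0_le_integral => //.
  - exact: (measurableT_comp mF (pair2_measurable e)).
  - apply: (measurableT_comp (mG _)).
    by apply: measurable_rVD => //; exact: measurable_cst.
  move=> x _ /=.
  have -> : (x + e + (t - 1) *: e = x + t *: e)%R.
    by rewrite scalerBl scale1r -addrA [(e + _)%R]addrC subrK.
  by rewrite [\1_E _]indicE; case: (_ \in _); rewrite ?mul1e// mul0e mule_ge0// lee_fin.
have /= ft := @fubini_tonelli _ _ _ _ _ mu mu (fun z : V * V => (\1_U z.1)%:E * H (z.1 + (t - 1) *: z.2)%R) mG' G0.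
rewrite -[leLHS]ft {ft}.
apply: (@le_trans _ _ (\int[mu]_(x in U) ((2 ^+ n)%:E * \int[mu]_x H x))).
  rewrite -[X in _ <= X](integral_indicM mu U (fun=> (2 ^+ n)%:E * \int[mu]_x H x)); apply: ge0_le_integral.
  - by [].
  - by move=> x _; apply: integral_ge0 => y _; exact: (G0 (x, y)).
  - have hFG := @measurable_fun_fubini_tonelli_F _ _ _ _ _ mu _ mG' G0; exact: hFG.
  - by apply: emeasurable_funM; [exact: measurable_indic_comp|exact: measurable_cst].
  move=> x _; have U0 : 0 <= (\1_U x : R)%:E by rewrite lee_fin.
  have -> := @ge0_integralZl _ _ _ mu setT measurableT _ (mHa (t - 1)%R x) _ (fun y _ => H0 _) U0.
  apply: (lee_wpmul2l U0).
  rewrite ge0_integral_aff//; last by rewrite lt_eqF//; lra.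
  by rewrite lee_wpmul2r// lee_fin -normrN half_pow_bound//; lra.
rewrite integral_cst// muleC muleA [X in _ <= X]muleA lee_wpmul2r//.
by rewrite muleC lee_wpmul2l ?lee_fin// leeDr.
Qed.

(** The factor 2 avoids a strict inequality between integrals: if [f] exceeded [2 * K] throughout
    [E], the large inequality would already give [2 * K <= K]. *)
Lemma exists_le_average E (f : V -> \bar R) (K : \bar R) : measurable E ->
  0 < mu E -> mu E < +oo -> measurable_fun E f -> (forall x, 0 <= f x) ->
  \int[mu]_(x in E) f x <= mu E * K -> 0 <= K ->
  exists2 z, E z & f z <= 2%:E * K.
Proof.
move=> mE E0 Eoo mf f0 fK K0; apply: contrapT => /forall2NP h.
have {}h z : E z -> 2%:E * K < f z.
  by move=> Ez; have [//|/negP] := h z; rewrite -ltNge.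
have Efin : mu E \is a fin_num by rewrite ge0_fin_numE.
have [z Ez] : E !=set0.
  by apply/set0P; apply: contraTneq E0 => ->; rewrite measure0 ltxx.
have Kfin : K \is a fin_num.
  rewrite ge0_fin_numE//; have := h z Ez; case: (K) => [r| |]//; first by rewrite ltry.
  by rewrite mulry gtr0_sg// mul1e ltNge leey.
(* For [K = 0] the comparison is not contradictory; here [f] vanishes almost everywhere on [E], so
   [f > 0] on all of [E] would make [E] negligible. *)
have [K00|K00] := eqVneq K 0.
  rewrite K00 mule0 in fK; have fI : \int[mu]_(x in E) f x = 0.
    by apply/eqP; rewrite eq_le fK integral_ge0.
  have : \int[mu]_(x in E) `|f x| = 0.
    by rewrite -[RHS]fI; apply: eq_integral => x _; rewrite gee0_abs.
  move=> /(ae_eq_integral_abs mu mE mf) fae.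
  have : mu.-negligible E.
    apply: negligibleS fae => x Ex /= /(_ Ex) fx0; have := h x Ex.
    by rewrite K00 mule0 fx0 ltxx.
  move=> /(negligibleP _ mE); move=> E00; by rewrite E00 ltxx in E0.
have Kpos : 0 < K by rewrite lt0e K00.
have : mu E * (2%:E * K) <= mu E * K.
  apply: le_trans fK; rewrite muleC -integral_cst//; apply: ge0_le_integral => //.
  - by move=> x _ /=; rewrite mule_ge0.
  - by move=> x Ex /=; exact/ltW/h.
rewrite lee_pmul2l// -[X in _ <= X]mul1e lee_pmul2r// lee_fin.
by rewrite leNgt ltr1n.
Qed.

(* The case [Phi = |.|^p] handles finite [p]; for [p = +oo], [Phi] and [H] are
   indicators of superlevel sets. *)
Lemma averaged_bound E U (H : V -> \bar R) (Phi : R -> \bar R) (v : V -> R)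
    (Good : V -> V -> Prop) (k : R) :
  measurable E -> 0 < mu E -> mu E < +oo -> measurable U -> mu U <= k%:E * mu E ->
  measurable_fun setT H -> (forall x, 0 <= H x) ->
  measurable_fun setT Phi -> (forall w, 0 <= Phi w) ->
  measurable_fun setT v ->
  (forall e, {ae mu, forall z, E z -> U (z + e)%R -> Good z e}) ->
  (forall z e, E z -> U (z + e)%R -> Good z e ->
     Phi (v (z + e) - v z)%R <= \int[nu]_t H (z + clamp t *: e)%R) ->
  exists2 z, E z & \int[mu]_(x in U) Phi (v x - v z)%R
     <= (2 * (2 ^+ n * (1 + k)))%:E * \int[mu]_x H x.
Proof.
move=> mE E0 Eoo mU UE mH H0 mPhi Phi0 mv G1 G2.
have k0 : (0 <= k)%R.
  have : 0 <= k%:E * mu E by exact: le_trans (measure_ge0 mu U) UE.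
  by rewrite leNgt => H1; rewrite leNgt; apply: contra H1 => k0; rewrite nmule_rlt0// lte_fin.
have I0 : 0 <= \int[mu]_x H x by exact: integral_ge0.
pose A (z : V * V) : \bar R := (\1_E z.1)%:E * (\1_U (z.1 + z.2)%R)%:E.
have A0 z : 0 <= A z by rewrite /A mule_ge0// lee_fin.
have mA : measurable_fun setT A.
  apply: emeasurable_funM; first exact: measurable_indic_comp measurable_fst.
  exact: measurable_indic_comp measurable_pairD.
have mvd : measurable_fun setT (fun z : V * V => v (z.1 + z.2)%R - v z.1)%R.
  apply: measurable_funB; first exact: (measurableT_comp mv measurable_pairD).
  exact: (measurableT_comp mv measurable_fst).
have mAP : measurable_fun setT (fun z : V * V => A z * Phi (v (z.1 + z.2) - v z.1)%R).
  by apply: emeasurable_funM => //; exact: (measurableT_comp mPhi mvd).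
have AP0 z : 0 <= A z * Phi (v (z.1 + z.2) - v z.1)%R by rewrite mule_ge0.
have mHt : measurable_fun setT (fun y : (V * V) * measurableTypeR R => H (y.1.1 + clamp y.2 *: y.1.2)%R).
  apply: (measurableT_comp mH); apply: measurable_rVD.
    exact: (measurableT_comp measurable_fst measurable_fst).
  apply: measurable_rVZ; last exact: (measurableT_comp measurable_snd measurable_fst).
  have ms : measurable_fun setT (fun z : (V * V) * measurableTypeR R => z.2) by exact: measurable_snd.
  by have := measurableT_comp (@measurable_clamp R) ms.
have mAH : measurable_fun setT (fun y : (V * V) * measurableTypeR R => A y.1 * H (y.1.1 + clamp y.2 *: y.1.2)%R).
  by apply: emeasurable_funM => //; exact: (measurableT_comp mA measurable_fst).
have AH0 y : 0 <= A y.1 * H (y.1.1 + @clamp R y.2 *: y.1.2)%R by rewrite mule_ge0.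
have step1 : \int[(mu \x mu)]_z (A z * Phi (v (z.1 + z.2) - v z.1)%R)
    <= \int[(mu \x mu)]_z \int[nu]_t (A z * H (z.1 + clamp t *: z.2)%R).
  (* The displacement is made the outer variable, because the null set of bad points [z] given by
     [G1] depends on it. *)
  rewrite fubini_tonelli2// [X in _ <= X]fubini_tonelli2//; last 2 first.
  - have hFG := @measurable_fun_fubini_tonelli_F _ _ _ _ _ nu _ mAH AH0; exact: hFG.
  - by move=> z; apply: integral_ge0 => t _; exact: (AH0 (z, t)).
  have mF := @measurable_fun_fubini_tonelli_F _ _ _ _ _ nu _ mAH AH0.
  have F0 z : 0 <= fubini_F nu (fun y : (V * V) * measurableTypeR R => A y.1 * H (y.1.1 + clamp y.2 *: y.1.2)%R) z.
    by apply: integral_ge0 => t _.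
  apply: ge0_le_integral => //.
  - by move=> e _; apply: integral_ge0 => z _.
  - have hFG := @measurable_fun_fubini_tonelli_G _ _ _ _ _ mu _ mAP AP0; exact: hFG.
  - have hFG := @measurable_fun_fubini_tonelli_G _ _ _ _ _ mu _ mF F0; exact: hFG.
  move=> e _; apply: ae_ge0_le_integral => //.
  - exact: (measurableT_comp mAP (pair2_measurable e)).
  - by move=> z _; exact: F0.
  - exact: (measurableT_comp mF (pair2_measurable e)).
  apply: filterS (G1 e) => z Gz _ /=.
  rewrite ge0_integralZl//; last first.
    have := measurableT_comp mHt (pair1_measurable (z, e)); exact.
  rewrite /A /= !indicE; case: (boolP (z \in E)) => [/set_mem Ez|_]; last by rewrite !mul0e.
  case: (boolP (_ \in U)) => [/set_mem Uz|_]; last by rewrite mule0 !mul0e.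
  by rewrite !mul1e; apply: G2 => //; exact: Gz.
have step2 : \int[(mu \x mu)]_z \int[nu]_t (A z * H (z.1 + clamp t *: z.2)%R)
    <= (2 ^+ n)%:E * ((mu E + mu U) * \int[mu]_x H x).
  rewrite [leLHS](tonelli3 mu mu nu mAH AH0).
  apply: (@le_trans _ _ (\int[nu]_t cst ((2 ^+ n)%:E * ((mu E + mu U) * \int[mu]_x H x)) t)).
    apply: ge0_le_integral => //.
    - by move=> t _; apply: integral_ge0 => z _; exact: (AH0 (z, t)).
    - have hG := measurable_tonelli3 mu mu mAH AH0; exact: hG.
    move=> t _; rewrite /A /=.
    under eq_integral do rewrite -muleA.
    exact: kernel_t (clamp01 t).
  rewrite integral_cst//= (_ : uniform_prob _ _ = 1); last exact: (@probability_setT _ _ _ nu).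
  by rewrite mule1.
have := le_trans step1 step2.
rewrite fubini_tonelli1// => step3.
have mPU : measurable_fun setT (fun z : V * V => (\1_U z.2)%:E * Phi (v z.2 - v z.1)%R).
  apply: emeasurable_funM; first exact: measurable_indic_comp measurable_snd.
  apply: (measurableT_comp mPhi); apply: measurable_funB.
    exact: (measurableT_comp mv measurable_snd).
  exact: (measurableT_comp mv measurable_fst).
have PU0 z : 0 <= (\1_U z.2)%:E * Phi (v z.2 - v z.1)%R by rewrite mule_ge0// lee_fin.
pose f z := \int[mu]_(x in U) Phi (v x - v z)%R.
have mf : measurable_fun setT f.
  have := @measurable_fun_fubini_tonelli_F _ _ _ _ _ mu _ mPU PU0; congr (measurable_fun _ _).
  by apply/funext => z; rewrite /fubini_F /= integral_indicM.
have f0 z : 0 <= f z by apply: integral_ge0.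
(* For fixed z, the substitution x = z + e turns displacements into points of [U]. *)
have fE : \int[mu]_z fubini_F mu (fun z : V * V => A z * Phi (v (z.1 + z.2) - v z.1)%R) z = \int[mu]_(z in E) f z.
  rewrite -[RHS]integral_indicM; apply: eq_integral => z _; rewrite /fubini_F /A /=.
  under eq_integral do rewrite -muleA.
  rewrite ge0_integralZl//; last 2 first.
  - have mz : measurable_fun setT (fun e : V => (z + e)%R).
      by apply: measurable_rVD => //; exact: measurable_cst.
    exact: (measurableT_comp (measurableT_comp mPU (pair1_measurable z)) mz).
  - by move=> e _; exact: (PU0 (z, z + e)%R).
  congr (_ * _); rewrite /f -[RHS]integral_indicM.
  rewrite -(ge0_integral_translation z (f := fun x => (\1_U x)%:E * Phi (v x - v z)%R)).
  - by apply: eq_integral => e _; rewrite addrC.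
  - exact: (measurableT_comp mPU (pair1_measurable z)).
  - by move=> x; exact: (PU0 (z, x)).
rewrite fE in step3.
have [|//||z Ez fz] := @exists_le_average E f ((2 ^+ n * (1 + k))%:E * \int[mu]_x H x) mE E0 Eoo _ f0.
- exact: measurable_funTS.
(* By hypothesis |E| + |U| <= (1 + k) |E|, which produces the factor |E| expected of an average. *)
- apply: (le_trans step3).
  rewrite EFinM -[X in mu E * X]muleA [leRHS]muleCA lee_wpmul2l ?lee_fin ?exprn_ge0// muleA lee_wpmul2r//.
  rewrite [leRHS]muleC EFinD ge0_muleDl ?lee_fin// mul1e; exact: leeD2l.
- by rewrite mule_ge0// lee_fin mulr_ge0 ?exprn_ge0// addr_ge0.
- exists z => //; apply: (le_trans fz); by rewrite muleA -EFinM.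
Qed.
End kernel.

(** * L^p functions on a set of finite positive measure *)

Section Lp_finite_measure.
Variables (R : realType) (n : nat) (U : set 'rV[R]_n) (p : \bar R).
Local Notation V := 'rV[R]_n.
Local Notation mu := (lebesgue_rV R n).
Hypotheses (mU : measurable U) (p1 : (1 <= p)%E) (U0 : (0 < mu U)%E) (Uoo : (mu U < +oo)%E).
Implicit Types (f g : V -> R).

Lemma muU_fin : mu U \is a fin_num. Proof. by rewrite ge0_fin_numE. Qed.

Lemma restrict_cst1 : (cst (1 : R) : V -> R) \_ U = \1_U.
Proof. by apply/funext => x; rewrite patchE indicE; case: ifP. Qed.

Lemma muT_gt0 : (0 < mu setT)%E.
Proof. by apply: (lt_le_trans U0); apply: le_measure; rewrite ?inE. Qed.

Lemma Lp_norm_cst1_oo : (Lp_norm U +oo (cst (1 : R)%R) <= 1)%E.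
Proof.
rewrite /Lp_norm restrict_cst1 unlock muT_gt0; apply/ess_supP/nearW => x /=.
by rewrite indicE; case: (_ \in _); rewrite ?normr1 ?normr0.
Qed.

Lemma Lfin_cst1 : Lfin U p (cst 1 : V -> R).
Proof.
split; first exact: measurable_cst.
case: p p1 => [r r1| _|//]; last by rewrite (le_lt_trans Lp_norm_cst1_oo)// ltry.
by rewrite /Lp_norm restrict_cst1 Lnorm_indic// poweR_lty.
Qed.

Lemma Lfin_cst c : Lfin U p (cst c : V -> R).
Proof.
have := LfinZ mU p1 c Lfin_cst1; congr Lfin; apply/funext => x /=; exact: mulr1.
Qed.

Lemma nrm_cst c : nrm U p (cst c : V -> R) = `|c| * nrm U p (cst 1 : V -> R).
Proof.
rewrite -nrmZ//; last exact: Lfin_cst1.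
by congr nrm; apply/funext => x /=; rewrite mulr1.
Qed.

Lemma nrm_cst1_gt0 : 0 < nrm U p (cst 1 : V -> R).
Proof.
rewrite -lte_fin nrmE//; last exact: Lfin_cst1.
case: p p1 => [r r1| _|//].
  by rewrite /Lp_norm restrict_cst1 Lnorm_indic// poweR_gt0.
rewrite /Lp_norm restrict_cst1 unlock muT_gt0.
rewrite ltNge; apply/negP => /ess_supP h.
have : mu.-negligible U.
  apply: negligibleS h => x Ux /=.
  by rewrite indicE mem_set// normr1 lee_fin ler10.
by move=> /(negligibleP _ mU) U00; move: (U0); rewrite U00 ltxx.
Qed.

(** The left integral is kept in the extended reals because its finiteness is itself deduced from
    this bound, in [Lfin_integrable]. *)
Lemma hoelder_nrmE f : Lfin U p f ->
  ((\int[mu]_(x in U) `|f x|%:E) * (nrm U p (cst 1))%:E <= (fine (mu U) * nrm U p f)%:E)%E.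
Proof.
move=> Lf; have mf := measurable_rest mU (proj1 Lf).
have := Lnorm_hoelder1 mU Uoo mf _ p1; rewrite -restrict_cst1.
rewrite -[X in (_ * X <= _)%E](nrmE Lfin_cst1) -[X in (_ <= _ * X)%E](nrmE Lf).
rewrite -[X in (_ <= X * _)%E]fineK ?muU_fin// -EFinM Lnorm1.
rewrite [X in (_ -> _ <= _)%E -> (X * _ <= _)%E]integral_mkcond.
rewrite (_ : (fun x : V => `|(EFin \o f \_ U) x|)%E = (fun x => `|f x|%:E)%E \_ U).
  by apply=> x Ux; rewrite patchE memNset.
by apply/funext => x; rewrite /= !patchE; case: ifP; rewrite ?normr0.
Qed.

Lemma Lfin_integrable f : Lfin U p f -> mu.-integrable U (EFin \o f).
Proof.
move=> Lf; apply/integrableP; split; first by apply/measurable_EFinP; case: Lf.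
have := hoelder_nrmE Lf; rewrite [X in (X * _ <= _ -> _)%E](_ : _ = (\int[mu]_(x in U) `|(EFin \o f) x|)%E)//.
case: (\int[mu]_(x in U) _)%E => [r _| | _]//; rewrite ?ltry// ?ltNyr//.
by rewrite mulyr gtr0_sg ?nrm_cst1_gt0// mul1e leye_eq.
Qed.

Lemma hoelder_nrm f : Lfin U p f ->
  (\int[mu]_(x in U) `|f x|) * nrm U p (cst 1) <= fine (mu U) * nrm U p f.
Proof.
move=> Lf; have := hoelder_nrmE Lf.
have i1 := integrable_fin_num mU (integrable_abse (Lfin_integrable Lf)).
by rewrite -lee_fin [X in _ -> (X <= _)%E]EFinM /Rintegral (fineK i1).
Qed.

Lemma nrm_oo_ge f : p = +oo%E -> Lfin U p f -> {ae mu, forall x, U x -> `|f x| <= nrm U p f}.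
Proof.
move=> poo Lf; have := ess_sup_ge mu (abse \o (EFin \o f \_ U)).
apply: filterS => x + Ux; rewrite -lee_fin nrmE// poo /Lp_norm unlock muT_gt0.
by rewrite /= patchE mem_set.
Qed.

End Lp_finite_measure.

Section segment_bounds.
Variables (R : realType) (n : nat).
Local Notation V := 'rV[R]_n.
Local Notation mu := (lebesgue_rV R n).
Local Notation nu := (unif R).
Implicit Types (G : V -> R) (e z : V).

Lemma measurable_along G e z : measurable_fun setT G ->
  measurable_fun setT (fun t : measurableTypeR R => G (z + clamp t *: e)).
Proof.
move=> mG; apply: (measurableT_comp mG); apply: measurable_rVD; first exact: measurable_cst.
by apply: measurable_rVZ; [exact: measurable_clamp|exact: measurable_cst].
Qed.

Lemma segint_le G e z : measurable_fun setT G ->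
  (`|segint G e z|%:E <= \int[nu]_t `|G (z + clamp t *: e)|%:E)%E.
Proof.
move=> mG; have := @le_abse_integral _ _ _ nu setT (fun t => (G (z + clamp t *: e))%:E) measurableT.
have mt : measurable_fun setT (fun t : measurableTypeR R => (G (z + clamp t *: e))%:E).
  by apply/measurable_EFinP; exact: measurable_along.
move=> /(_ mt); apply: le_trans; rewrite /segint /Rintegral.
by case: (\int[_]_ _ _)%E => [r| |]//=; rewrite ?leey// normr0 leey.
Qed.

(** Jensen's inequality for the probability [unif], raised to the power [r]. *)
Lemma segint_powR G e z (r : R) : measurable_fun setT G -> 1 <= r ->
  ((`|segint G e z| `^ r)%:E <= \int[nu]_t (`|G (z + clamp t *: e)| `^ r)%:E)%E.
Proof.
move=> mG r1; have r0 : 0 < r by rewrite (lt_le_trans _ r1).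
have le1 := segint_le e z mG.
have := @Lnorm_jensen _ _ _ nu (fun t => G (z + clamp t *: e)) r%:E (measurable_along e z mG) r1.
rewrite Lnorm1 /= => /(le_trans le1) => {}le1.
have := gt0_ler_poweR (ltW r0) _ _ le1; rewrite poweR_EFin unlock -poweRrM.
rewrite mulVf ?gt_eqF// poweRe1; last by apply: integral_ge0 => t _; rewrite lee_fin powR_ge0.
move=> /(_ _ _)/le_trans; apply => //; rewrite in_itv /= ?leey ?andbT ?lee_fin//.
exact: poweR_ge0.
Qed.

Lemma sum_coord_le (h : R) e (g : 'I_n -> R) : (forall i, `|e ord0 i| <= h) ->
  `|\sum_i e ord0 i * g i| <= h * \sum_i `|g i|.
Proof.
move=> eh; apply: (le_trans (ler_norm_sum _ _ _)); rewrite mulr_sumr; apply: ler_sum => i _.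
by rewrite normrM ler_wpM2r.
Qed.
End segment_bounds.

Lemma continuous_addr_rV (R : realType) (n : nat) (e : 'rV[R]_n) : continuous (fun x : 'rV[R]_n => x + e).
Proof.
move=> x A /nbhs_ballP[r r0 sub]; apply/nbhs_ballP; exists r => //= y xy.
by apply: sub; split=> // i j; have := xy.2 i j; rewrite /ball /= !mxE opprD addrACA subrr addr0.
Qed.

Section poincare.
Variables (R : realType) (n : nat) (U E : set 'rV[R]_n) (p : \bar R) (h k : R).
Local Notation V := 'rV[R]_n.
Local Notation mu := (lebesgue_rV R n).
Local Notation nu := (unif R).
Hypotheses (p1 : (1 <= p)%E) (oU : open U) (oE : open E) (EU : E `<=` U).
Hypotheses (E0 : (0 < mu E)%E) (Uoo : (mu U < +oo)%E) (h0 : 0 <= h).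
Hypothesis star : forall z x t, E z -> U x -> 0 <= t <= 1 -> U ((1 - t) *: z + t *: x).
Hypothesis width : forall x y i, U x -> U y -> `|x ord0 i - y ord0 i| <= h.
Hypothesis UE : (mu U <= k%:E * mu E)%E.

Let mU : measurable U. Proof. exact: open_measurable_rV. Qed.
Let mE : measurable E. Proof. exact: open_measurable_rV. Qed.
Let Eoo : (mu E < +oo)%E.
Proof. by apply: le_lt_trans Uoo; apply: le_measure; rewrite ?inE. Qed.
Let U0 : (0 < mu U)%E.
Proof. by apply: (lt_le_trans E0); apply: le_measure; rewrite ?inE. Qed.

Let k0 : 0 <= k.
Proof.
have : (0 <= k%:E * mu E)%E by apply: le_trans UE; exact: measure_ge0.
by rewrite !leNgt; apply: contra => kn; rewrite nmule_rlt0// lte_fin.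
Qed.

(** The constant of [averaged_bound]: 2 from selecting a point near the average, [2 ^+ n] from the
    Jacobian, [1 + k] from comparing |E| + |U| with |E|. *)
Let K : R := 2 * (2 ^+ n * (1 + k)).
Let K1 : 1 <= K.
Proof.
have a : 1 <= 2 ^+ n :> R by rewrite exprn_ege1// ler1n.
rewrite /K; have : 1 * 1 <= 2 ^+ n * (1 + k) by apply: ler_pM; rewrite ?ler01 ?lerDl.
by rewrite mulr1 => b; rewrite -[leLHS]mulr1; apply: ler_pM => //; rewrite ler1n.
Qed.

Lemma nrm_abs f : Lfin U p f -> Lfin U p (fun x => `|f x|) /\ nrm U p (fun x => `|f x|) <= nrm U p f.
Proof.
move=> Lf; apply: nrm_le => //; first by apply: measurableT_comp => //; case: Lf.
by apply: nearW => x _; rewrite normr_id.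
Qed.

Lemma nrm_pow f (r : R) : p = r%:E -> Lfin U p f ->
  ((nrm U p f `^ r)%:E = \int[mu]_(x in U) (`|f x| `^ r)%:E)%E.
Proof.
move=> pr Lf; have r1 : 1 <= r by move: p1; rewrite pr.
have r0 : 0 < r by rewrite (lt_le_trans _ r1).
rewrite -poweR_EFin nrmE// pr /Lp_norm unlock -poweRrM mulVf ?gt_eqF// poweRe1; last first.
  by apply: integral_ge0 => x _; rewrite lee_fin powR_ge0.
rewrite [RHS]integral_mkcond; apply: eq_integral => x _ /=; rewrite !patchE.
by case: ifP => //; rewrite normr0 powR0// gt_eqF.
Qed.

Variables (v : V -> R) (g : 'I_n -> V -> R).
Hypotheses (Lv : Lfin U p v) (Lg : forall i, Lfin U p (g i)).
Hypothesis IBP : forall i a b B, cbox a b `<=` U -> pbump a b B ->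
  \int[mu]_(x in U) (v x * pb (upd B i) x) = - \int[mu]_(x in U) (g i x * pb B x).

Let v' := v \_ U.
Let g' i := g i \_ U.
Let mg' i : measurable_fun setT (g' i). Proof. exact: measurable_rest (proj1 (Lg i)). Qed.
Let mv' : measurable_fun setT v'. Proof. exact: measurable_rest (proj1 Lv). Qed.
Let G (e x : V) : R := \sum_i e ord0 i * g' i x.
Let mG e : measurable_fun setT (G e).
Proof. by apply: measurable_sum => i; exact: measurable_funM. Qed.
Let S x : R := \sum_i `|g' i x|.
Let mS : measurable_fun setT S.
Proof. by apply: measurable_sum => i; exact: measurableT_comp. Qed.

Lemma segment_identity_star e : {ae mu, forall z, E z -> U (z + e) ->
  v' (z + e) - v' z = segint (G e) e z}.
Proof.
have L : {ae mu, forall y, (E `&` (fun z => z + e) @^-1` U) y -> v' (y + e) - v' y = segint (G e) e y}.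
  apply: (@segment_identity R n U _ v' g' e).
  - have /(integrable_mkcond _ mU).1 := Lfin_integrable mU p1 U0 Uoo Lv.
    by rewrite restrict_EFin.
  - move=> i; have /(integrable_mkcond _ mU).1 := Lfin_integrable mU p1 U0 Uoo (Lg i).
    by rewrite restrict_EFin.
  - move=> i a b B abU pB; have := IBP i abU pB; rewrite !(Rintegral_mkcond _ U).
    congr (_ = - _); apply: eq_Rintegral => x _; rewrite /v' /g' !patchE; case: ifP => // _;
      by rewrite mul0r.
  - apply: openI => //; apply: open_comp => // x _.
    exact: continuous_addr_rV.
  - move=> y t [Ey Uy] t01; have := star Ey Uy t01; congr U.
    by rewrite scalerDr addrA -scalerDl subrK scale1r.
by apply: filterS L => z Lz Ez Uz; exact: Lz.
Qed.

Lemma star_coord e z x : E z -> U (z + e) -> `|G e x| <= h * S x.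
Proof.
move=> Ez Uz; apply: sum_coord_le => i.
by have := width i Uz (EU Ez); rewrite mxE addrAC subrr add0r.
Qed.

Lemma nrm_hS : Lfin U p (fun x => h * \sum_i `|g i x|) /\
  nrm U p (fun x => h * \sum_i `|g i x|) <= h * \sum_i nrm U p (g i).
Proof.
have [L1 L2] := nrm_sum mU p1 (index_enum 'I_n) (fun i => (nrm_abs (Lg i)).1).
split; first exact: LfinZ.
rewrite nrmZ// ger0_norm// ler_wpM2l//; apply: (le_trans L2); apply: ler_sum => i _.
exact: (nrm_abs (Lg i)).2.
Qed.

Lemma hS_restrict x : h * S x = (fun x => h * \sum_i `|g i x|) \_ U x.
Proof.
rewrite /S /g' patchE; case: ifPn => xU; first by under eq_bigr do rewrite patchE xU.
by rewrite big1 ?mulr0// => i _; rewrite patchE (negbTE xU) normr0.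
Qed.

(** The constant c is the value of v at a point z of [E] selected by averaging: along almost every
    segment from z the increment of v is at most the average of [h * S]. *)
Lemma poincare_shift : exists c : R, nrm U p (fun x => v x - c) <= K * (h * \sum_i nrm U p (g i)).
Proof.
have [Lh nh] := nrm_hS; have M0 : 0 <= h * \sum_i nrm U p (g i).
  by rewrite mulr_ge0// sumr_ge0// => i _; exact: nrm_ge0.
have LvB c : Lfin U p (fun x => v x - c) by apply: LfinB => //; exact: Lfin_cst.
case pE : p p1 => [r| |//] r1; last clear r1.
  rewrite lee_fin in r1.
  have r0 : 0 < r by rewrite (lt_le_trans _ r1).
  have E1 c : (\int[mu]_(x in U) (`|v' x - c| `^ r)%:E = (nrm U p (fun x => v x - c) `^ r)%:E)%E.
    rewrite (nrm_pow pE (LvB c)); apply: eq_integral => x xU.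
    by rewrite [v' x]patchE xU.
  have E2 : (\int[mu]_x (`|h * S x| `^ r)%:E = (nrm U p (fun x => h * \sum_i `|g i x|) `^ r)%:E)%E.
    rewrite (nrm_pow pE Lh) [RHS]integral_mkcond; apply: eq_integral => x _.
    rewrite hS_restrict !patchE; case: (x \in U) => //; by rewrite normr0 powR0// gt_eqF.
  have mpow : measurable_fun setT (fun w : R => (`|w| `^ r)%:E).
    by have := measurable_powe r (@measurable_id _ R setT).
  have [||||z Ez] := @averaged_bound R n E U (fun x => (`|h * S x| `^ r)%:E) (fun w => (`|w| `^ r)%:E)
    v' (fun z e => v' (z + e) - v' z = segint (G e) e z) k mE E0 Eoo mU UE _ _ mpow _ mv'
    segment_identity_star.
  - apply: (measurableT_comp mpow); exact: measurable_funM.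
  - by move=> x; rewrite lee_fin powR_ge0.
  - by move=> x; rewrite lee_fin powR_ge0.
  - move=> z e Ez Uz ->; apply: (le_trans (segint_powR _ _ (mG e) r1)).
    apply: ge0_le_integral => //.
    + by apply: (measurableT_comp mpow); exact: measurable_along.
    + have mhS : measurable_fun setT (fun x => h * S x) by exact: measurable_funM.
      exact: (measurableT_comp mpow (measurable_along e z mhS)).
    move=> t _; rewrite lee_fin; apply: ge0_ler_powR; rewrite ?nnegrE ?(ltW r0)//.
    by apply: (le_trans (star_coord _ Ez Uz)); exact: ler_norm.
  move=> H; exists (v' z); rewrite -pE.
  rewrite E1 E2 -EFinM lee_fin -/K in H.
  apply: (@le_trans _ _ (K * nrm U p (fun x => h * \sum_i `|g i x|))); last first.
    by rewrite ler_wpM2l// (le_trans _ K1).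
  have Kn : 0 <= K * nrm U p (fun x => h * \sum_i `|g i x|).
    by rewrite mulr_ge0 ?nrm_ge0// (le_trans _ K1).
  have : nrm U p (fun x => v x - v' z) `^ r <= (K * nrm U p (fun x => h * \sum_i `|g i x|)) `^ r.
    apply: (le_trans H); rewrite powRM ?nrm_ge0 ?(le_trans _ K1)// ler_wpM2r ?powR_ge0//.
    (* Since K >= 1, K is at most its [r]-th power, which makes the final constant the same for
       every exponent. *)
    rewrite -[leLHS]powRr1 ?(le_trans _ K1)//; exact: ler_powR.
  move=> /(ge0_ler_powR (r := r^-1)); rewrite !nnegrE !powR_ge0 invr_ge0 (ltW r0).
  by move=> /(_ isT isT isT); rewrite -!powRrM mulfV ?gt_eqF// !powRr1// nrm_ge0.
pose M := \sum_i nrm U p (g i).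
(* The weight is infinite on the superlevel set: an increment above [h * M] only forces [S > M] on a
   set of times of positive measure, possibly small, and the integral along the segment must still
   reach 1. *)
pose H x : \bar R := (+oo * (\1_[set x | M < S x] x)%:E)%E.
have mMS : measurable [set x | M < S x].
  have := mS measurableT (measurable_itv `]M, +oo[); rewrite setTI.
  by congr measurable; apply/seteqP; split => x /=; rewrite in_itv/= andbT.
have mH : measurable_fun setT H.
  by apply: emeasurable_funM => //; apply/measurable_EFinP; exact: measurable_indic.
have H0 x : (0 <= H x)%E by rewrite mule_ge0// ?leey// lee_fin.
have mPhi : measurable_fun setT (fun w : R => (\1_[set w : R | h * M < `|w|] w)%:E : \bar R).
  apply/measurable_EFinP; apply: measurable_indic.
  have := @normr_measurable R setT measurableT _ (measurable_itv `]h * M, +oo[); rewrite setTI.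
  by congr measurable; apply/seteqP; split => x /=; rewrite in_itv/= andbT.
have IH : (\int[mu]_x H x = 0)%E.
  rewrite -[RHS](@integral0 _ _ _ mu setT); apply: ae_eq_integral => //.
  have : {ae mu, forall x i, U x -> `|g i x| <= nrm U p (g i)}.
    by apply: filter_forall => i; exact: nrm_oo_ge.
  apply: filterS => x gx _; rewrite /H indicE memNset ?mule0//= => /lt_geF/negbT/negP; apply.
  rewrite /S /M; apply: ler_sum => i _; rewrite /g' patchE.
  by case: ifP => [/set_mem /gx//|_]; rewrite normr0 nrm_ge0.
have [||z Ez] := @averaged_bound R n E U H (fun w => (\1_[set w : R | h * M < `|w|] w)%:E)
    v' (fun z e => v' (z + e) - v' z = segint (G e) e z) k mE E0 Eoo mU UE mH H0 mPhi _ mv'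
    segment_identity_star.
- by move=> w; rewrite lee_fin.
- move=> z e Ez Uz ->; rewrite indicE; case: (boolP (_ \in _)) => [|_]; last exact: integral_ge0.
  (* If the integral of [H] along the segment were below 1, [H] would be finite, hence [S <= M], at
     almost every time, and the increment could not exceed [h * M]. *)
  rewrite inE /= => Mlt; rewrite leNgt; apply/negP => lt1.
  have mHt : measurable_fun setT (fun t : measurableTypeR R => H (z + clamp t *: e)).
    apply: (measurableT_comp mH); apply: measurable_rVD; first exact: measurable_cst.
    by apply: measurable_rVZ; [exact: measurable_clamp|exact: measurable_cst].
  have iH : nu.-integrable setT (fun t : measurableTypeR R => H (z + clamp t *: e)).
    apply/integrableP; split => //; under eq_integral do rewrite gee0_abs//.
    by apply: (lt_trans lt1); rewrite ltry.
  have := Mlt; rewrite ltNge => /negP; apply; rewrite -lee_fin.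
  apply: (le_trans (segint_le _ _ (mG e))).
  apply: (@le_trans _ _ (\int[nu]_t (cst (h * M)%:E t))%E); last first.
    by rewrite integral_cst//= (_ : uniform_prob _ _ = 1%E) ?mule1//; exact: (@probability_setT _ _ _ nu).
  apply: ae_ge0_le_integral => //.
    by apply/measurable_EFinP; apply: measurableT_comp => //; exact: measurable_along.
  have := integrable_ae measurableT iH; apply: filterS => t /(_ I) Hf _.
  rewrite lee_fin; apply: (le_trans (star_coord _ Ez Uz)); rewrite ler_wpM2l//.
  rewrite leNgt; apply/negP => MS; move: Hf; rewrite /H indicE mem_set//.
  by rewrite mule1.
rewrite IH mule0 => PhiI; exists (v' z).
have mPhiU : measurable_fun setT (fun x => (\1_[set w : R | h * M < `|w|] (v' x - v' z))%:E : \bar R).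
  by apply: (measurableT_comp mPhi); apply: measurable_funB.
have : (\int[mu]_(x in U) `|(\1_[set w : R | h * M < `|w|] (v' x - v' z))%:E| = 0)%E.
  apply/eqP; rewrite eq_le integral_ge0// andbT; apply: le_trans PhiI.
  rewrite le_eqVlt; apply/orP; left; apply/eqP; apply: eq_integral => x _.
  by rewrite gee0_abs// lee_fin.
move=> /(ae_eq_integral_abs mu mU (measurable_funTS mPhiU)) ae0.
rewrite -pE -/M; have [|||_] := @nrm_le R n U p mU p1 (fun x => v x - v' z) (cst (h * M)).
- by have := (LvB (v' z)).1.
- exact: Lfin_cst.
- apply: filterS ae0 => x + Ux => /(_ Ux) /= []; rewrite indicE.
  case: (boolP (_ \in _)) => [_ /eqP|]; first by rewrite oner_eq0.
  rewrite (_ : v' x = v x); last by rewrite [LHS]patchE mem_set.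
  rewrite notin_setE /= => /negP; rewrite -leNgt => le _.
  by apply: (le_trans le); exact: ler_norm.
move=> le; apply: (le_trans le); rewrite (nrm_cst mU p1 U0 Uoo) ger0_norm//.
have : nrm U p (cst 1) <= K.
  apply: le_trans K1; rewrite -lee_fin (nrmE (Lfin_cst1 mU p1 U0 Uoo)) pE.
  exact: Lp_norm_cst1_oo.
by move=> H1; rewrite mulrC; apply: ler_wpM2r.
Qed.

(** The zero mean controls the constant c of [poincare_shift]: |c| |U| is at most the integral of |v
    - c|, and Hoelder turns this into a bound of the norm of c by that of v - c. The triangle
    inequality then accounts for the factor 2. *)
Lemma poincare : \int[mu]_(x in U) v x = 0 ->
  nrm U p v <= 2 * K * h * \sum_i nrm U p (g i).
Proof.
move=> v0; have [c cle] := poincare_shift.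
have Lc := Lfin_cst mU p1 U0 Uoo c; have LB := LfinB mU p1 Lv Lc.
have A0 := nrm_cst1_gt0 mU p1 U0 Uoo.
have mf : fine (mu U) > 0 by rewrite fine_gt0// U0.
have H := hoelder_nrm mU p1 U0 Uoo LB.
have iv := Lfin_integrable mU p1 U0 Uoo Lv; have ic := Lfin_integrable mU p1 U0 Uoo Lc.
have I1 : `|c| * fine (mu U) <= \int[mu]_(x in U) `|v x - cst c x|.
  have iB := Lfin_integrable mU p1 U0 Uoo LB.
  apply: le_trans (le_normr_Rintegral mU iB).
  by rewrite RintegralB// v0 Rintegral_cst// sub0r normrN normrM (gtr0_norm mf).
have c1 : nrm U p (cst c) <= nrm U p (fun x => v x - c).
  rewrite nrm_cst// -(ler_pM2l mf); apply: le_trans H; rewrite mulrA ler_pM2r//.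
  by rewrite mulrC.
have -> : v = (fun x => (v x - c) + cst c x) by apply/funext => x /=; rewrite subrK.
apply: (le_trans (nrmD mU p1 LB Lc)).
apply: (@le_trans _ _ (2 * nrm U p (fun x => v x - c))); first by rewrite mulr2n mulrDl mul1r lerD2l.
by rewrite -(mulrA (2 * K)) -(mulrA 2) ler_pM2l.
Qed.
End poincare.

(** * Inverse inequalities for polynomials *)

Section gram.
Variables (R : realType) (N : nat).

Lemma posdef_unitmx (A : 'M[R]_N) :
  (forall b : 'rV[R]_N, (b *m A *m b^T) = 0 -> b = 0) -> A \in unitmx.
Proof.
move=> H; rewrite -row_free_unit; apply: inj_row_free => b bA.
by apply: H; rewrite bA mul0mx.
Qed.
End gram.

Section mpoly_facts.
Variables (R : realType) (n : nat).
Local Notation V := 'rV[R]_n.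
Implicit Types (p q : mpoly n R) (m a b : multinom n).

Lemma msize_leP p k : reflect (forall m, mcoeff m p != 0 -> (mdeg m < k)%N) (msize p <= k)%N.
Proof.
rewrite msizeE; apply: (iffP (bigmax_leqP_seq _ _ _ _)) => H m.
  by rewrite -mcoeff_msupp => mp; exact: H.
by rewrite mcoeff_msupp => mp _; exact: H.
Qed.

Lemma msizeM_leq p q : (msize (p * q) <= (msize p + msize q).-1)%N.
Proof.
have [->|p0] := eqVneq p 0; first by rewrite mul0r msize0.
have [->|q0] := eqVneq q 0; first by rewrite mulr0 msize0.
by rewrite msizeM.
Qed.

Lemma msize_mderiv i p k : (msize p <= k.+1)%N -> (msize (mderiv i p) <= k)%N.
Proof.
move=> /msize_leP H; apply/msize_leP => m; rewrite mcoeff_mderiv => pm.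
have /H : mcoeff (mnm_add m (mnm1 i)) p != 0 by apply: contraNneq pm => ->; rewrite mul0rn.
by rewrite mdegD mdeg1 addn1.
Qed.

Lemma msize_mderivW i p k : (msize p <= k)%N -> (msize (mderiv i p) <= k)%N.
Proof. by move=> pk; apply: msize_mderiv; exact: leqW. Qed.

Lemma mnm_splitS a k : mdeg a = k.+1 -> exists i b, a = mnm_add b (mnm1 i) /\ mdeg b = k.
Proof.
move=> ak; have [i ai] : exists i, a i != 0%N.
  apply: contrapT => /forallNP h; move: ak; rewrite mdegE big1// => i _.
  by have /negP := h i; rewrite negbK => /eqP.
exists i, (mnm_sub a (mnm1 i)); have E : mnm_add (mnm_sub a (mnm1 i)) (mnm1 i) = a by rewrite submK// lep1mP.
by split; rewrite ?E//; move: ak; rewrite -[in mdeg a]E mdegD mdeg1 addn1 => -[].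
Qed.

Lemma mnm_addU_ind (P : multinom n -> Prop) : P (mnm0 (n:=n)) ->
  (forall a i, P a -> P (mnm_add a (mnm1 i))) -> forall a, P a.
Proof.
move=> P0 PS a; move: {2}(mdeg a) (erefl (mdeg a)) => k; elim: k a => [|k IH] a.
  by move=> /eqP; rewrite mdeg_eq0 => /eqP ->.
by move=> /mnm_splitS[i [b [-> bk]]]; apply: PS; exact: IH.
Qed.

Lemma mderivmS a i q : mderivm (mnm_add a (mnm1 i)) q = mderivm a (mderiv i q).
Proof. by rewrite addmC mderivmDm mderivmU1m. Qed.

Lemma mderivm_eq0 a p : (msize p <= mdeg a)%N -> mderivm a p = 0.
Proof.
move: {2}(mdeg a) (erefl (mdeg a)) => k; elim: k a p => [|k IH] a p.
  move=> ->; rewrite leqn0 msize_poly_eq0 => /eqP ->; exact: raddf0.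
move=> ak; move: (ak) => /mnm_splitS[i [b [-> bk]]] pk; rewrite mderivmS; apply: IH => //.
by rewrite bk; apply: msize_mderiv; rewrite mdegD mdeg1 addn1 bk in pk.
Qed.

Lemma pev_at0 p : pev p 0 = mcoeff (mnm0 (n:=n)) p.
Proof.
rewrite /pev [in LHS](mpolyE p) raddf_sum /=.
have H m : meval ((0 : V) ord0) (mpolyX R m) = (m == mnm0 (n:=n))%:R.
  rewrite mevalX; have [->|m0] := eqVneq; first by rewrite big1// => i _; rewrite mnm0E.
  have [i mi] : exists i, m i != 0%N.
    apply: contrapT => /forallNP h; move/eqP: m0; apply; apply/mnmP => i.
    by have /negP := h i; rewrite negbK mnm0E => /eqP.
  by rewrite (bigD1 i)//= mxE expr0n (negbTE mi) mul0r.
under eq_bigr do rewrite mevalZ H.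
have [p0|p0] := boolP (mnm0 (n:=n) \in msupp p).
  rewrite (bigD1_seq _ p0)//= eqxx mulr1 big1 ?addr0// => m /negbTE ->; by rewrite mulr0.
rewrite big_seq big1 ?memN_msupp_eq0// => m mp.
by rewrite (_ : m == _ = false) ?mulr0//; apply: contraNF p0 => /eqP <-.
Qed.

(** The derivatives at 0 are the coefficients multiplied by nonzero products of factorials. *)
Lemma mpoly_eq0 p : (forall b, pev (mderivm b p) 0 = 0) -> p = 0.
Proof.
move=> H; apply/mpolyP => b; have := H b; rewrite pev_at0 mcoeff_mderivm addm0 => /eqP.
rewrite mulrn_eq0 mcoeff0 => /orP[|/eqP->//]; rewrite eqn0Ngt prodn_gt0// => i.
by rewrite ffact_gt0.
Qed.

(** The scalar [s] makes the statement iterable: each derivative multiplies it by [u]. *)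
Lemma pev_mderiv_aff i p p' c (s u : R) : (forall y : V, pev p' y = s * pev p (c + u *: y)) ->
  forall y : V, pev (mderiv i p') y = s * u * pev (mderiv i p) (c + u *: y).
Proof.
move=> H y; have d1 := is_derive_pev i p' y.
have d2 : is_derive y (delta_mx ord0 i) (pev p') (s * u * pev (mderiv i p) (c + u *: y)).
  apply/is_derive_line0.
  rewrite (_ : (fun t : R => _) = (fun t : R => s * pev p ((c + u *: y) + (u * t) *: delta_mx ord0 i))); last first.
    by apply/funext => t; rewrite H scalerDr scalerA addrA.
  have := is_derive_pev i p (c + u *: y) => /is_derive_line0 d3.
  have dl : is_derive (0 : R) 1 (fun t : R => u * t) u.
    by have := is_deriveZ u (is_derive_id (0 : R) 1); congr (is_derive _ _ _ _); rewrite /GRing.scale/= mulr1.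
  rewrite (_ : s * u * _ = s * (pev (mderiv i p) (c + u *: y) * u)); last by ring.
  have d4 : is_derive (0 : R) 1
      (fun t : R => pev p (c + u *: y + (u * t) *: delta_mx ord0 i))
      (pev (mderiv i p) (c + u *: y) * u).
    apply: (@is_derive1_comp _ (fun t => pev p (c + u *: y + t *: delta_mx ord0 i)) (fun t => u * t)).
    by rewrite mulr0.
  exact: is_deriveZ.
by rewrite -(@derive_val _ _ _ _ _ _ _ d1) (@derive_val _ _ _ _ _ _ _ d2).
Qed.

Lemma pev_mderivm_aff a p p' c (s u : R) : (forall y : V, pev p' y = s * pev p (c + u *: y)) ->
  forall y : V, pev (mderivm a p') y = s * u ^+ mdeg a * pev (mderivm a p) (c + u *: y).
Proof.
elim/mnm_addU_ind : a p p' s => [|a i IH] p p' s H y; first by rewrite !mderivm0m mdeg0 mulr1.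
by rewrite !mderivmS (IH _ _ _ (pev_mderiv_aff i H)) mdegD mdeg1 addn1 exprS !mulrA.
Qed.

(** The linear forms [L i] are substituted for the variables; the size of a product of such forms is
    bounded monomial by monomial. *)
Lemma aff_mpoly c (u : R) p : exists p', (msize p' <= msize p)%N /\ forall y : V, pev p' y = pev p (c + u *: y).
Proof.
pose L i : mpoly n R := mpolyC n (c ord0 i) + u *: mpolyX R (mnm1 i).
have Lev i (y : V) : pev (L i) y = (c + u *: y) ord0 i.
  by rewrite /L pevD pevC pevZ pevXU !mxE.
have Ls i : (msize (L i) <= 2)%N.
  apply: (leq_trans (msizeD_le _ _)); rewrite geq_max (leq_trans (msizeZ_le _ _)) ?msizeX ?mdeg1//.
  by rewrite msizeC andbT; case: (_ == _).
have pows i k : (msize (L i ^+ k) <= k.+1)%N.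
  elim: k => [|k IH]; first by rewrite expr0 msize1.
  by rewrite exprS; apply: (leq_trans (msizeM_leq _ _)); move: (Ls i) IH; lia.
pose Q m := \prod_(i < n) L i ^+ m i.
have Qs m : (msize (Q m) <= (mdeg m).+1)%N.
  rewrite /Q mdegE; elim: (index_enum _) => [|i s IH]; first by rewrite !big_nil msize1.
  rewrite !big_cons; apply: (leq_trans (msizeM_leq _ _)).
  have h (a b k l : nat) : (a <= k.+1)%N -> (b <= l.+1)%N -> ((a + b).-1 <= (k + l).+1)%N by lia.
  exact: h (pows i (m i)) IH.
exists (\sum_(m <- msupp p) mcoeff m p *: Q m); split.
  rewrite big_seq; elim/big_ind: _ => [|x y hx hy|m mp]; first by rewrite msize0.
    by apply: (leq_trans (msizeD_le _ _)); rewrite geq_max hx.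
  by apply: (leq_trans (msizeZ_le _ _)); apply: (leq_trans (Qs m)); exact: msize_mdeg_lt.
move=> y; rewrite [in RHS](mpolyE p) /pev !raddf_sum; apply: eq_bigr => m _ /=.
rewrite !mevalZ mevalX rmorph_prod; congr (_ * _); apply: eq_bigr => i _.
by rewrite rmorphXn /= -[meval _ _]/(pev (L i) y) Lev.
Qed.

End mpoly_facts.

Section poly_integral.
Variables (R : realType) (n : nat).
Local Notation V := 'rV[R]_n.
Local Notation mu := (lebesgue_rV R n).
Implicit Types (p q : mpoly n R) (b : multinom n) (U W : set V).

Lemma obox_ball (c : V) (e : R) x : obox (\row_i (c ord0 i - e)) (\row_i (c ord0 i + e)) x <->
  forall i, `|x ord0 i - c ord0 i| < e.
Proof.
by split=> H i; have := H i; rewrite !mxE ltr_norml => /andP[? ?]; apply/andP; split; lra.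
Qed.

Lemma open_obox (a b : V) : open (obox a b).
Proof.
rewrite openE => x ax.
suff H i : nbhs x [set y : V | a ord0 i < y ord0 i < b ord0 i].
  exact: (@filter_forall _ _ (fun i => [set y : V | a ord0 i < y ord0 i < b ord0 i]) (nbhs x) _ H).
have : nbhs (x ord0 i) `]a ord0 i, b ord0 i[%classic.
  by apply: open_nbhs_nbhs; split; [exact: interval_open|rewrite /= in_itv; exact: ax].
move=> A; have := @coord_continuous R 1 n ord0 i x _ A.
rewrite -[X in X -> _]/(nbhs x ((fun y : V => y ord0 i) @^-1` `]a ord0 i, b ord0 i[%classic)).
rewrite (_ : _ @^-1` _ = [set y : V | a ord0 i < y ord0 i < b ord0 i])//.
Qed.

Lemma open_mu_gt0 W x : open W -> W x -> (0 < mu W)%E.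
Proof.
move=> oW Wx; have /nbhs_ballP[e /= e0 sub] : nbhs x W by exact: open_nbhs_nbhs.
pose E := obox (\row_i (x ord0 i - e)) (\row_i (x ord0 i + e)).
have EW : E `<=` W.
  move=> y /obox_ball xy; apply: sub; split=> // i j; rewrite (ord1 i).
  by rewrite /ball /= distrC.
apply: (@lt_le_trans _ _ (mu E)); last first.
  by apply: le_measure; rewrite ?inE//; [exact: measurable_obox|exact: open_measurable_rV].
rewrite [ltRHS]lebesgue_obox; last by move=> i; rewrite !mxE; lra.
by rewrite lte_fin prodr_gt0// => i _; rewrite !mxE; lra.
Qed.

Lemma integral_eq0_open U (f : V -> R) : open U -> mu.-integrable U (EFin \o f) ->
  continuous f -> (forall x, 0 <= f x) -> \int[mu]_(x in U) f x = 0 -> forall x, U x -> f x = 0.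
Proof.
move=> oU iF cf f0 I0 x Ux; apply/eqP; rewrite eq_le f0 andbT leNgt; apply/negP => fx.
have mU := open_measurable_rV oU.
pose W := U `&` f @^-1` `]f x / 2, +oo[%classic.
have oW : open W by apply: openI => //; apply: open_comp => [y _|]; [exact: cf|exact: interval_open].
have Wx : W x by split => //=; rewrite in_itv /= andbT; lra.
have W0 := open_mu_gt0 oW Wx.
have mW := open_measurable_rV oW.
have II : (\int[mu]_(x in U) (f x)%:E = 0)%E.
  have := integrable_fin_num mU iF => /fineK; rewrite -[fine _]/(\int[mu]_(x in U) f x) I0 => <-//.
have : ((f x / 2)%:E * mu W <= \int[mu]_(x in U) (f x)%:E)%E.
  rewrite -integral_cst//; apply: (@le_trans _ _ (\int[mu]_(x in W) (f x)%:E)%E).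
    apply: ge0_le_integral => //.
    - by move=> y _ /=; rewrite lee_fin; lra.
    - by apply/measurable_EFinP; apply: measurable_funTS; exact: continuous_measurable_rV.
    - by move=> y [_] /=; rewrite in_itv/= andbT lee_fin => /ltW.
  apply: ge0_subset_integral => //.
  - by apply/measurable_EFinP; apply: measurable_funTS; exact: continuous_measurable_rV.
  - by move=> y _; rewrite lee_fin.
  - by move=> y [].
by rewrite II leNgt mule_gt0// lte_fin; lra.
Qed.

Lemma pev_mderivm_eq0_open W q : open W -> (forall x, W x -> pev q x = 0) ->
  forall b x, W x -> pev (mderivm b q) x = 0.
Proof.
move=> oW; move=> + b; elim/mnm_addU_ind : b q => [|b i IH] q q0 x Wx; first by rewrite mderivm0m q0.
rewrite mderivmS; apply: IH => // {Wx} {}x Wx.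
rewrite -partial_pev /partial (@near_eq_derive _ _ _ _ (cst 0)) ?derive_cst//.
have : nbhs x W by exact: open_nbhs_nbhs.
by apply: filterS => y /q0.
Qed.

(** All derivatives of [q] vanish at [x]. Translating [x] to the origin shows that the translate
    [q'] is 0, so [q] vanishes everywhere and all its derivatives vanish at 0. *)
Lemma mpoly_eq0_open W x q : open W -> W x -> (forall y, W y -> pev q y = 0) -> q = 0.
Proof.
move=> oW Wx q0; have [q' [_ E]] := aff_mpoly x 1 q.
have E' y : pev q' y = 1 * pev q (x + 1 *: y) by rewrite mul1r E.
have q'0 : q' = 0.
  apply: mpoly_eq0 => b; rewrite (pev_mderivm_aff b E') scaler0 addr0.
  by rewrite (pev_mderivm_eq0_open oW q0) ?mulr0.
apply: mpoly_eq0 => b; apply: (@pev_mderivm_eq0_open setT) => //; first exact: openT.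
by move=> y _; have := E (y - x); rewrite q'0 pev0 scale1r [x + _]addrC subrK.
Qed.

Section bounded.
Variable U : set V.
Hypotheses (mU : measurable U) (bU : bounded_set U).

Lemma integrable_continuous (f : V -> R) : continuous f -> mu.-integrable U (EFin \o f).
Proof.
move=> cf; have [a [b Uab]] := bounded_cbox bU.
apply: (@integrableS _ _ _ mu (cbox a b)) => //; first exact: measurable_cbox.
apply: (@loc_integrable_cbox _ _ setT) => //; apply: loc_integrable_continuous => //.
exact: openT.
Qed.

Lemma integrable_pev q : mu.-integrable U (EFin \o pev q).
Proof. by apply: integrable_continuous; exact: continuous_pev. Qed.

Definition int_pev q := \int[mu]_(x in U) pev q x.

Lemma int_pevD p q : int_pev (p + q) = int_pev p + int_pev q.
Proof. by rewrite /int_pev pevD RintegralD//; exact: integrable_pev. Qed.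

Lemma int_pevZ c q : int_pev (c *: q) = c * int_pev q.
Proof. by rewrite /int_pev pevZ RintegralZl//; exact: integrable_pev. Qed.
End bounded.

End poly_integral.

(** * Definite bilinear forms on polynomials of bounded degree *)

Section bilinear_form.
Variables (R : realType) (n l : nat) (B : mpoly n R -> mpoly n R -> R).
Hypotheses (BD : forall p q w, B (p + q) w = B p w + B q w)
  (BZ : forall c q w, B (c *: q) w = c * B q w)
  (BDr : forall p q w, B w (p + q) = B w p + B w q)
  (BZr : forall c q w, B w (c *: q) = c * B w q)
  (B0 : forall q, (msize q <= l.+1)%N -> B q q = 0 -> q = 0).

Local Notation T := (bmultinom n l.+1).
Local Notation N := #|{: T}|.
Definition mono (j : 'I_N) : mpoly n R := mpolyX R (enum_val j : multinom n).
Definition of_coords (c : 'rV[R]_N) : mpoly n R := \sum_j c ord0 j *: mono j.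
Definition coords (q : mpoly n R) : 'rV[R]_N := \row_(j < N) mcoeff (enum_val j : multinom n) q.

Lemma msize_of_coords c : (msize (of_coords c) <= l.+1)%N.
Proof.
rewrite /of_coords; elim/big_ind: _ => [|x y hx hy|m mp]; first by rewrite msize0.
  by apply: (leq_trans (msizeD_le _ _)); rewrite geq_max hx.
by apply: (leq_trans (msizeZ_le _ _)); rewrite msizeX bmdeg.
Qed.

Lemma of_coordsK c : coords (of_coords c) = c.
Proof.
apply/rowP => j; rewrite mxE raddf_sum (bigD1 j)//= mcoeffZ mcoeffX eqxx mulr1 big1 ?addr0// => k kj.
rewrite mcoeffZ mcoeffX; case: eqP => [E|_]; last by rewrite mulr0.
by move/eqP: kj; case; apply: enum_val_inj; apply: val_inj.
Qed.

Lemma coordsK q : (msize q <= l.+1)%N -> of_coords (coords q) = q.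
Proof.
move=> ql; rewrite [RHS](mpolywE ql) /of_coords (reindex (@enum_rank T)) /=; last first.
  by apply: onW_bij; exact: enum_rank_bij.
by apply: eq_bigr => m _; rewrite /mono mxE enum_rankK.
Qed.

Lemma form_suml (c : 'rV[R]_N) w : B (of_coords c) w = \sum_j c ord0 j * B (mono j) w.
Proof.
have b0 : B 0 w = 0 by rewrite -[X in B X](scale0r 0) BZ mul0r.
rewrite (big_morph (fun q => B q w) (fun p q => BD p q w) b0).
by apply: eq_bigr => j _; rewrite BZ.
Qed.

Lemma form_sumr (c : 'rV[R]_N) w : B w (of_coords c) = \sum_j c ord0 j * B w (mono j).
Proof.
have b0 : B w 0 = 0 by rewrite -[X in B _ X](scale0r 0) BZr mul0r.
rewrite (big_morph (B w) (fun p q => BDr p q w) b0).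
by apply: eq_bigr => j _; rewrite BZr.
Qed.

Definition gram : 'M[R]_N := \matrix_(j, k) B (mono j) (mono k).

Lemma gramE (c : 'rV[R]_N) k : (c *m gram) ord0 k = B (of_coords c) (mono k).
Proof. by rewrite mxE form_suml; apply: eq_bigr => j _; rewrite mxE. Qed.

Lemma gram_unit : gram \in unitmx.
Proof.
apply: posdef_unitmx => c c0; rewrite -[c]of_coordsK (@B0 (of_coords c)); first last.
- transitivity ((c *m gram *m c^T) ord0 ord0); last by rewrite c0 mxE.
  rewrite mxE form_sumr; apply: eq_bigr => j _.
  by rewrite gramE mxE mulrC.
- exact: msize_of_coords.
by apply/rowP => j; rewrite !mxE mcoeff0.
Qed.

(** The inverse Gram matrix recovers the coefficients of [q] from its pairings with monomials. When
    the pairings are integrals, this yields the equivalence of norms on polynomials. *)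
Lemma form_coef q : (msize q <= l.+1)%N ->
  coords q = (\row_k B q (mono k)) *m invmx gram.
Proof.
move=> ql; rewrite (_ : \row_k _ = coords q *m gram) ?mulmxK ?gram_unit//.
by apply/rowP => k; rewrite gramE mxE coordsK.
Qed.

(** Finite-dimensional Riesz representation: the Gram system is solved against the values of [F] on
    monomials, and linearity does the rest. *)
Lemma form_solve (F : mpoly n R -> R) : (forall p q, F (p + q) = F p + F q) ->
  (forall c q, F (c *: q) = c * F q) ->
  exists2 q, (msize q <= l.+1)%N & forall w, (msize w <= l.+1)%N -> B q w = F w.
Proof.
move=> FD FZ; pose q := of_coords ((\row_k F (mono k)) *m invmx gram).
exists q; first exact: msize_of_coords.
have H k : B q (mono k) = F (mono k).
  by rewrite -gramE mulmxKV ?gram_unit// mxE.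
move=> w wl; rewrite -(coordsK wl) form_sumr.
have F0 : F 0 = 0 by rewrite -[X in F X](scale0r 0) FZ mul0r.
rewrite (big_morph F FD F0); apply: eq_bigr => j _; by rewrite FZ H.
Qed.
End bilinear_form.

Lemma common_bound (R : realType) (I : finType) (X : Type) (P : X -> Prop) (F : I -> X -> R) :
  (forall i, exists M, forall x, P x -> `|F i x| <= M) ->
  exists M, 0 <= M /\ forall i x, P x -> `|F i x| <= M.
Proof.
move=> /choice[M HM]; exists (\sum_i `|M i|); split; first exact: sumr_ge0.
move=> i x Px; apply: (le_trans (HM i x Px)); apply: (le_trans (ler_norm _)).
by rewrite (bigD1 i)//= lerDl sumr_ge0.
Qed.

Section inverse_inequality.
Variables (R : realType) (n l : nat).
Local Notation V := 'rV[R]_n.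
Local Notation mu := (lebesgue_rV R n).
Implicit Types (p q : mpoly n R) (b : multinom n) (U W : set V).

Definition cube (c : V) (e : R) : set V := obox (\row_i (c ord0 i - e)) (\row_i (c ord0 i + e)).

Lemma bounded_obox (a b : V) : bounded_set (obox a b).
Proof.
have [M [Mr HM]] := compact_bounded (@compact_cbox _ _ a b).
by exists M; split=> // y My x Ax; apply: HM => //; exact: obox_sub_cbox.
Qed.

Lemma continuous_bounded_cbox (f : V -> R) (a b : V) : continuous f ->
  exists M, forall x, cbox a b x -> `|f x| <= M.
Proof.
move=> cf; have /compact_bounded[M [_ HM]] : compact (f @` cbox a b).
  by apply: continuous_compact; [exact: continuous_subspaceT|exact: compact_cbox].
by exists (M + 1) => x ax; apply: HM; [rewrite ltrDl|exists x].
Qed.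

Let Q := cube 0 1.
Let mQ : measurable Q. Proof. exact: measurable_obox. Qed.
Let bQ : bounded_set Q. Proof. exact: bounded_obox. Qed.
Let oQ : open Q. Proof. exact: open_obox. Qed.
Let Q0 : Q 0. Proof. by apply/obox_ball => i; rewrite !mxE subrr normr0. Qed.
Let B q w := int_pev Q (q * w).

Lemma square_eq0_open U q : open U -> bounded_set U -> int_pev U (q * q) = 0 ->
  forall x, U x -> pev q x = 0.
Proof.
move=> oU bU q0 x Ux; have mU := open_measurable_rV oU.
have : pev (q * q) x = 0.
  apply: (integral_eq0_open oU _ _ _ q0) => //.
  - exact: integrable_pev.
  - exact: continuous_pev.
  - by move=> y; rewrite pevM -expr2 sqr_ge0.
by rewrite pevM => /eqP; rewrite mulf_eq0 orbb => /eqP.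
Qed.

(** For the L^2 product on the unit cube, the pairings of [q] with monomials are at most the
    integral of |q|, because monomials are bounded by 1 there. The point [y] ranges over a larger
    cube since the rescaled U is contained in that one only. *)
Lemma cube_inverse (kappa : R) : exists C, 0 <= C /\ forall q b (y : V),
  (msize q <= l.+1)%N -> (forall i, `|y ord0 i| <= kappa) ->
  `|pev (mderivm b q) y| <= C * \int[mu]_(x in Q) `|pev q x|.
Proof.
have BD p q w : B (p + q) w = B p w + B q w by rewrite /B mulrDl int_pevD.
have BZ c q w : B (c *: q) w = c * B q w by rewrite /B -scalerAl int_pevZ.
have BDr p q w : B w (p + q) = B w p + B w q by rewrite /B mulrDr int_pevD.
have BZr c q w : B w (c *: q) = c * B w q by rewrite /B -scalerAr int_pevZ.
have B0 q : (msize q <= l.+1)%N -> B q q = 0 -> q = 0.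
  by move=> _ q0; apply: (mpoly_eq0_open oQ Q0); exact: square_eq0_open.
pose N := #|{: bmultinom n l.+1}|.
pose D : 'M[R]_N := invmx (gram l B).
pose F (bj : bmultinom n l.+1 * 'I_N) (y : V) := pev (mderivm bj.1 (mono R bj.2)) y.
have [M [M0 HM]] : exists M, 0 <= M /\ forall bj (y : V), (forall i, `|y ord0 i| <= kappa) -> `|F bj y| <= M.
  apply: common_bound => bj.
  have [M HM] := @continuous_bounded_cbox (F bj) (const_mx (- kappa)) (const_mx kappa) (@continuous_pev _ _ _).
  by exists M => x xk; apply: HM => i; rewrite !mxE -ler_norml.
exists (\sum_j \sum_k `|D k j| * M); split.
  by apply: sumr_ge0 => j _; apply: sumr_ge0 => k _; rewrite mulr_ge0.
move=> q b y ql yk; set I := \int[mu]_(x in Q) _.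
have I0 : 0 <= I by apply: Rintegral_ge0.
(* Orders above [l] fall outside the finite index type [bmultinom n l.+1], but the corresponding
   derivatives are 0. *)
have [bl|bl] := ltnP (mdeg b) l.+1; last first.
  rewrite mderivm_eq0 ?(leq_trans ql)// pev0 normr0 mulr_ge0//.
  by apply: sumr_ge0 => j _; apply: sumr_ge0 => k _; rewrite mulr_ge0.
have coef := form_coef BD BZ BDr BZr B0 ql.
have Bk k : `|B q (mono R k)| <= I.
  rewrite /B /int_pev; apply: (le_trans (le_normr_Rintegral mQ (integrable_pev mQ bQ _))).
  apply: le_Rintegral => //.
  - exact: (integrable_abse (integrable_pev mQ bQ (q * mono R k))).
  - exact: (integrable_abse (integrable_pev mQ bQ q)).
  move=> x /obox_ball Qx; rewrite pevM normrM ler_piMr// /mono /pev mevalX normr_prod.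
  apply: prodr_ile1 => i _; rewrite normrX exprn_ge0//= exprn_ile1//.
  by have := Qx i; rewrite mxE subr0 => /ltW.
rewrite -[X in mderivm b X](coordsK ql) raddf_sum /pev raddf_sum /=.
apply: (le_trans (ler_norm_sum _ _ _)); rewrite mulr_suml; apply: ler_sum => j _.
rewrite mderivmZ mevalZ normrM mulr_suml.
have -> : coords l q ord0 j = \sum_k B q (mono R k) * D k j.
  by rewrite coef mxE; apply: eq_bigr => k _; rewrite mxE.
apply: (@le_trans _ _ ((\sum_k I * `|D k j|) * M)).
  apply: ler_pM => //; last exact: (HM (BMultinom bl, j)).
  apply: (le_trans (ler_norm_sum _ _ _)); apply: ler_sum => k _.
  by rewrite normrM ler_wpM2r.
by rewrite -!mulr_suml -mulr_sumr [leRHS]mulrC mulrA.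
Qed.

Lemma lebesgue_cube (c : V) (e : R) : 0 < e -> mu (cube c e) = ((2 * e) ^+ n)%:E.
Proof.
move=> e0; rewrite [LHS]lebesgue_obox; last by move=> i; rewrite !mxE; lra.
congr EFin; rewrite (eq_bigr (fun=> 2 * e)); last by move=> i _; rewrite !mxE; ring.
by rewrite prodr_const card_ord.
Qed.

(** The inner cube is rescaled to the unit cube. Each derivative contributes 1/e, and the Jacobian
    e^-n is at most |k| 2^n / |U| by the volume hypothesis, so [C] depends on U only through [kappa]
    and [k]. *)
Lemma poly_inverse (kappa k : R) : exists C, 0 <= C /\ forall U (c : V) (e : R),
  open U -> bounded_set U -> 0 < e -> cube c e `<=` U ->
  (forall x i, U x -> `|x ord0 i - c ord0 i| <= kappa * e) ->
  (mu U <= k%:E * mu (cube c e))%E ->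
  forall q b (x : V), (msize q <= l.+1)%N -> U x ->
  `|pev (mderivm b q) x| <= C * (e ^+ mdeg b)^-1 * (fine (mu U))^-1 * \int[mu]_(x in U) `|pev q x|.
Proof.
have [C [C0 HC]] := cube_inverse kappa; exists (C * (`|k| * 2 ^+ n)); split.
  by rewrite !mulr_ge0 ?exprn_ge0.
move=> U c e oU bU e0 EU width UE q b x ql Ux.
have mU := open_measurable_rV oU.
have mE : measurable (cube c e) by exact: measurable_obox.
have [q' [q's q'E]] := aff_mpoly c e q.
have q'E' y : pev q' y = 1 * pev q (c + e *: y) by rewrite mul1r.
pose y : V := e^-1 *: (x - c).
have ye : c + e *: y = x by rewrite /y scalerA divff ?gt_eqF// scale1r addrC subrK.
have yk i : `|y ord0 i| <= kappa.
  by rewrite !mxE normrM gtr0_norm ?invr_gt0// mulrC ler_pdivrMr// width.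
have := HC q' b y (leq_trans q's ql) yk.
rewrite (pev_mderivm_aff b q'E') ye mul1r normrM gtr0_norm ?exprn_gt0// => H.
have iq W : measurable W -> bounded_set W -> mu.-integrable W (EFin \o (fun z => `|pev q z|)).
  by move=> mW bW; exact: (integrable_abse (integrable_pev mW bW q)).
have bE : bounded_set (cube c e) by exact: bounded_obox.
have I1 : \int[mu]_(z in Q) `|pev q' z| = (e ^+ n)^-1 * \int[mu]_(z in cube c e) `|pev q z|.
  have mf : measurable_fun setT (fun z => ((\1_(cube c e) z)%:E * `|pev q z|%:E)%E).
    apply: emeasurable_funM; apply/measurable_EFinP; first exact: measurable_indic.
    by apply: measurableT_comp => //; exact: measurable_pev.
  have := @ge0_integral_aff _ _ e c _ (negbT (gt_eqF e0)) mf.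
  rewrite (integral_indicM mu (cube c e) (fun z => `|pev q z|%:E)) (gtr0_norm e0) => IE.
  rewrite /Rintegral -[X in X * _]/(fine (e ^+ n)^-1%:E) -fineM//; last exact: integrable_fin_num (iq _ mE bE).
  congr fine; rewrite -IE; last by move=> z; rewrite mule_ge0// lee_fin.
  rewrite -[LHS]integral_indicM; apply: eq_integral => z _; rewrite q'E; congr ((_%:R)%:E * _)%E.
  have Ez i : (`|(c + e *: z) ord0 i - c ord0 i| < e) = (`|z ord0 i - (0 : V) ord0 i| < 1).
    by rewrite !mxE subr0 addrAC subrr add0r normrM (gtr0_norm e0) gtr_pMr.
  congr nat_of_bool; apply/idP/idP => /set_mem/obox_ball Qz; apply/mem_set/obox_ball => i;
    by have := Qz i; rewrite Ez.
have I2 : \int[mu]_(z in cube c e) `|pev q z| <= \int[mu]_(z in U) `|pev q z|.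
  apply: fine_le; rewrite ?(integrable_fin_num _ (iq _ _ _))//.
  apply: ge0_subset_integral => //; exact: measurable_int (iq _ mU bU).
have e1 : 0 < e ^+ n by exact: exprn_gt0.
have Uoo : mu U \is a fin_num by rewrite ge0_fin_numE// bounded_lty.
have Uf : fine (mu U) <= `|k| * 2 ^+ n * e ^+ n.
  rewrite -lee_fin fineK//; apply: (le_trans UE); rewrite [X in (_ * X <= _)%E]lebesgue_cube//.
  by rewrite -EFinM lee_fin exprMn mulrA !ler_wpM2r ?exprn_ge0 ?(ltW e0)// ler_norm.
have U0 : 0 < fine (mu U) by rewrite fine_gt0// (open_mu_gt0 oU Ux) -ge0_fin_numE.
have IU0 : 0 <= \int[mu]_(z in U) `|pev q z| by exact: Rintegral_ge0.
have eb : 0 < e ^+ mdeg b by exact: exprn_gt0.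
rewrite -(ler_pM2l eb); apply: (le_trans H); rewrite I1.
rewrite [leRHS](_ : _ = C * ((`|k| * 2 ^+ n) * (fine (mu U))^-1 * \int[mu]_(z in U) `|pev q z|)); last first.
  by field; rewrite !gt_eqF.
apply: ler_wpM2l => //; apply: ler_pM => //; rewrite ?invr_ge0 ?(ltW e1) ?Rintegral_ge0//.
by rewrite ler_pdivlMr// mulrC ler_pdivrMr.
Qed.

End inverse_inequality.

(** * The elliptic projector *)

Section projector.
Variables (R : realType) (n l : nat) (U : set 'rV[R]_n) (x0 : 'rV[R]_n).
Local Notation V := 'rV[R]_n.
Local Notation mu := (lebesgue_rV R n).
Hypotheses (oU : open U) (bU : bounded_set U) (Ux0 : U x0).
Implicit Types (p q w : mpoly n R).

Let mU : measurable U. Proof. exact: open_measurable_rV. Qed.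

Lemma Rintegral_sum_fin (I : Type) (s : seq I) (F : I -> V -> R) :
  (forall i, mu.-integrable U (EFin \o F i)) ->
  mu.-integrable U (EFin \o (fun x => \sum_(i <- s) F i x)) /\
  \int[mu]_(x in U) (\sum_(i <- s) F i x) = \sum_(i <- s) \int[mu]_(x in U) F i x.
Proof.
move=> iF; elim: s => [|i s [IH1 IH2]].
  rewrite big_nil (_ : (fun x => _) = cst 0); last by apply/funext => x; rewrite big_nil.
  by split; [exact: integrable0|rewrite Rintegral_cst// mul0r].
rewrite big_cons (_ : (fun x => _) = (fun x => F i x + \sum_(i <- s) F i x)); last first.
  by apply/funext => x; rewrite big_cons.
split; first exact: (integrableD mU (iF i) IH1).
by rewrite RintegralD// IH2.
Qed.

Lemma integrable_mul_pev g q : mu.-integrable U (EFin \o g) ->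
  mu.-integrable U (EFin \o (fun x => g x * pev q x)).
Proof.
move=> ig; have [a [b Uab]] := bounded_cbox bU.
have [M HM] := @continuous_bounded_cbox R n (pev q) a b (@continuous_pev _ _ q).
apply: (@integrableMl _ _ _ mu U mU (EFin \o g) (pev q) ig).
  by apply: measurable_funTS; exact: measurable_pev.
exists M; split; first exact: num_real.
by move=> y My x Ux; apply/ltW/(le_lt_trans _ My)/HM/Uab.
Qed.

Lemma pev_eq0_mderiv q : (forall i x, U x -> pev (mderiv i q) x = 0) -> q = mpolyC n (mcoeff (mnm0 (n:=n)) q).
Proof.
move=> H; have dq i : mderiv i q = 0 by apply: (mpoly_eq0_open oU Ux0); exact: H.
apply/mpolyP => m; rewrite mcoeffC; have [->|m0] := eqVneq (mnm0 (n:=n)) m; first by rewrite mulr1.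
rewrite mulr0; have /mnm_splitS[i [b [-> _]]] : mdeg m = (mdeg m).-1.+1.
  by rewrite prednK// lt0n mdeg_eq0 eq_sym.
have := congr1 (mcoeff b) (dq i); rewrite mcoeff_mderiv mcoeff0 => /eqP.
by rewrite mulrn_eq0 => /eqP.
Qed.

Let muU0 : 0 < fine (mu U).
Proof. by rewrite fine_gt0// (open_mu_gt0 oU Ux0) bounded_lty. Qed.

(** The gradient form is degenerate on constants. Adding the product of the means makes it definite,
    so that [form_solve] yields the gradient and mean conditions together. *)
Lemma elliptic_proj_exists v : mu.-integrable U (EFin \o v) ->
  (forall i, mu.-integrable U (EFin \o wderiv U (mnm1 i) v)) ->
  is_elliptic_proj U l v (elliptic_proj U l v).
Proof.
move=> iv ig.
suff [q ql [H1 H2]] : exists2 q, (msize q <= l.+1)%N &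
  (forall w, (msize w <= l.+1)%N -> \sum_i int_pev U (mderiv i q * mderiv i w) =
    \sum_i \int[mu]_(x in U) (wderiv U (mnm1 i) v x * pev (mderiv i w) x))
  /\ int_pev U q = \int[mu]_(x in U) v x.
  apply: xgetPex; exists (pev q); split; first by exists q.
  - move=> _ [w wl ->]; rewrite -[fun x => meval _ w]/(pev w).
    under eq_Rintegral do under eq_bigr do rewrite !partial_pev -[_ * _]/((fun x => pev _ x * pev _ x) _) -pevM.
    under [RHS]eq_Rintegral do under eq_bigr do rewrite partial_pev.
    rewrite (Rintegral_sum_fin _ (fun i => integrable_pev mU bU _)).2 H1//.
    by rewrite (Rintegral_sum_fin _ (fun i => integrable_mul_pev _ (ig i))).2.
  - by rewrite (RintegralB mU (integrable_pev mU bU q) iv) -[X in X - _]/(int_pev U q) H2 subrr.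
pose B q w := \sum_i int_pev U (mderiv i q * mderiv i w) + int_pev U q * int_pev U w.
have BD p q w : B (p + q) w = B p w + B q w.
  rewrite /B int_pevD// mulrDl addrACA -big_split; congr (_ + _); apply: eq_bigr => i _.
  by rewrite mderivD mulrDl int_pevD.
have BZ c q w : B (c *: q) w = c * B q w.
  rewrite /B int_pevZ// mulrDr mulrA mulr_sumr; congr (_ + _); apply: eq_bigr => i _.
  by rewrite mderivZ -scalerAl int_pevZ.
have BC q w : B q w = B w q.
  by rewrite /B [int_pev U q * _]mulrC; under eq_bigr do rewrite mulrC.
have BDr p q w : B w (p + q) = B w p + B w q by rewrite BC BD !(BC w).
have BZr c q w : B w (c *: q) = c * B w q by rewrite BC BZ (BC w).
have sq0 q : 0 <= int_pev U (q * q).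
  by apply: Rintegral_ge0 => x _; rewrite pevM -expr2 sqr_ge0.
have B0 q : (msize q <= l.+1)%N -> B q q = 0 -> q = 0.
  move=> _ /eqP; rewrite paddr_eq0 ?sumr_ge0// -?expr2 ?sqr_ge0// => /andP[/eqP s0].
  rewrite sqrf_eq0 => /eqP q0.
  have d0 i : int_pev U (mderiv i q * mderiv i q) = 0 by apply: (psumr_eq0P _ s0).
  have qE : q = mpolyC n (mcoeff (mnm0 (n:=n)) q).
    by apply: pev_eq0_mderiv => i; exact: square_eq0_open.
  move: q0; rewrite [in int_pev U q]qE /int_pev pevC Rintegral_cst// => /eqP.
  by rewrite mulf_eq0 (gt_eqF muU0) orbF => /eqP q0; rewrite qE q0 mpolyC0.
pose F w := \sum_i \int[mu]_(x in U) (wderiv U (mnm1 i) v x * pev (mderiv i w) x) +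
  (\int[mu]_(x in U) v x) * int_pev U w.
have FD p q : F (p + q) = F p + F q.
  rewrite /F int_pevD// mulrDr addrACA -big_split; congr (_ + _); apply: eq_bigr => i _.
  rewrite /= -RintegralD; [|by []|exact: integrable_mul_pev|exact: integrable_mul_pev].
  by apply: eq_Rintegral => x _; rewrite mderivD pevD mulrDr.
have FZ c q : F (c *: q) = c * F q.
  rewrite /F int_pevZ// mulrDr mulrCA mulr_sumr; congr (_ + _); apply: eq_bigr => i _.
  rewrite -RintegralZl; [|by []|exact: integrable_mul_pev].
  by apply: eq_Rintegral => x _; rewrite mderivZ pevZ mulrCA.
have [q ql H] := form_solve BD BZ BDr BZr B0 FD FZ.
exists q => //.
have H2 : int_pev U q = \int[mu]_(x in U) v x.
  (* The constant 1 has zero gradient, so testing with it isolates the equality of the means; that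
     equality then removes the mean terms for a general [w]. *)
  have := H (mpolyC n 1); rewrite msizeC (leq_trans (leq_b1 _))// => /(_ isT).
  rewrite /B /F !big1 ?add0r; first last.
  - by move=> i _; rewrite mderivC mulr0 /int_pev pev0 Rintegral_cst// mul0r.
  - by move=> i _; rewrite mderivC pev0; under eq_Rintegral do rewrite mulr0; rewrite Rintegral_cst// mul0r.
  have I1 : int_pev U (mpolyC n 1) != 0 by rewrite /int_pev pevC Rintegral_cst// mul1r gt_eqF.
  exact: (mulIf I1).
split=> // w wl; have := H w wl; rewrite /B /F H2; exact: addIr.
Qed.

End projector.

(** * Error estimates *)

Section averaged_poly.
Variables (R : realType) (n : nat) (U : set 'rV[R]_n) (x0 : 'rV[R]_n).
Local Notation V := 'rV[R]_n.
Local Notation mu := (lebesgue_rV R n).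
Hypotheses (oU : open U) (bU : bounded_set U) (Ux0 : U x0).
Implicit Types (p q w : mpoly n R) (a b : multinom n).

Let mU : measurable U. Proof. exact: open_measurable_rV. Qed.
Let muU0 : 0 < fine (mu U).
Proof. by rewrite fine_gt0// (open_mu_gt0 oU Ux0) bounded_lty. Qed.

(** A derivative of top order is constant, a nonzero multiple of a leading coefficient. Its zero
    mean kills that coefficient, and the degree drops. *)
Lemma mean_zero_poly k q : (msize q <= k)%N ->
  (forall a, (mdeg a < k)%N -> int_pev U (mderivm a q) = 0) -> q = 0.
Proof.
elim: k => [|k IH] qk H; first by apply/eqP; rewrite -msize_poly_eq0 -leqn0.
have q0 m : (k < mdeg m)%N -> mcoeff m q = 0.
  by move=> mk; apply/eqP; apply: contraTT mk => /(msize_leP _ _ qk); rewrite -leqNgt.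
apply: IH => [|a ak]; last by apply: H; exact: ltnW.
apply/msize_leP => a qa; have := msize_leP _ _ qk a qa.
rewrite ltnS leq_eqVlt => /predU1P[ak|//]; move/eqP: qa; case.
have E : mderivm a q = mpolyC n (mcoeff a q *+ \prod_(i < n) (a i) ^_ (a i)).
  apply/mpolyP => m; rewrite mcoeffC mcoeff_mderivm; have [<-|m0] := eqVneq (mnm0 (n:=n)) m.
    by rewrite addm0 mulr1.
  by rewrite mulr0 q0 ?mul0rn// mdegD ak -[X in (X < _)%N]addn0 ltn_add2l lt0n mdeg_eq0 eq_sym.
have := H a; rewrite ak ltnSn E /int_pev pevC Rintegral_cst// => /(_ isT)/eqP.
rewrite mulf_eq0 (gt_eqF muU0) orbF mulrn_eq0 => /orP[|/eqP//].
by rewrite eqn0Ngt prodn_gt0// => i; rewrite ffact_gt0.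
Qed.

(** There are as many mean conditions as monomials, so the linear system is square, and
    [mean_zero_poly] says that it is injective. *)
Lemma averaged_poly s (D : multinom n -> V -> R) :
  (forall a, (mdeg a <= s)%N -> mu.-integrable U (EFin \o D a)) ->
  exists2 Q : mpoly n R, (msize Q <= s.+1)%N &
    forall a, (mdeg a <= s)%N -> \int[mu]_(x in U) (D a x - pev (mderivm a Q) x) = 0.
Proof.
move=> iD; pose N := #|{: bmultinom n s.+1}|.
pose ev (j : 'I_N) : multinom n := enum_val j.
pose M : 'M[R]_N := \matrix_(j, k) int_pev U (mderivm (ev k) (mono R j)).
have ME (c : 'rV[R]_N) k : (c *m M) ord0 k = int_pev U (mderivm (ev k) (of_coords c)).
  rewrite mxE /of_coords raddf_sum /=.
  have IU0 : int_pev U 0 = 0 by rewrite -[X in int_pev U X](scale0r 0) int_pevZ// mul0r.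
  rewrite (big_morph (int_pev U) (int_pevD mU bU) IU0); apply: eq_bigr => j _.
  by rewrite mxE mderivmZ int_pevZ.
have evP a : (mdeg a <= s)%N -> exists k, ev k = a.
  by rewrite -ltnS => al; exists (enum_rank (BMultinom al)); rewrite /ev enum_rankK.
have Mu : M \in unitmx.
  rewrite -row_free_unit; apply: inj_row_free => c c0.
  rewrite -[c]of_coordsK (_ : of_coords c = 0); first by apply/rowP => j; rewrite !mxE mcoeff0.
  apply: (@mean_zero_poly s.+1); first exact: msize_of_coords.
  by move=> a /evP[k <-]; rewrite -ME c0 mxE.
exists (of_coords ((\row_k \int[mu]_(x in U) D (ev k) x) *m invmx M)); first exact: msize_of_coords.
move=> a al; have [k ka] := evP a al; rewrite -ka.
rewrite RintegralB//; [|by rewrite ka; exact: iD|exact: integrable_pev].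
by rewrite -[X in _ - X]/(int_pev U _) -ME mulmxKV// mxE subrr.
Qed.

End averaged_poly.

Lemma succ_sub_pred (m s : nat) : (0 < m <= s.+1)%N -> s = (s.+1 - m + m.-1)%N.
Proof. by lia. Qed.

Lemma abs_le_young (R : realType) (q lam : R) : 0 < lam -> `|q| <= (q ^+ 2 / lam + lam) / 2.
Proof.
move=> l0; rewrite ler_pdivlMr// -(ler_pM2r l0) mulrDl divfK ?gt_eqF//.
have := sqr_ge0 (`|q| - lam); rewrite sqrrB real_normK ?num_real//; lra.
Qed.

(** [wderiv] is a chosen representative; it agrees almost everywhere with the one of finite norm
    that [sobolev] provides, and inherits its finiteness. *)
Lemma sobolev_wderiv (R : realType) (n s : nat) (U : set 'rV[R]_n) (p : \bar R) v a :
  open U -> (1 <= p)%E -> sobolev U s p v -> (mdeg a <= s)%N ->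
  is_wderiv U a v (wderiv U a v) /\ Lfin U p (wderiv U a v).
Proof.
move=> oU p1 sv al; have [g wg gp] := sv a al.
have wD : is_wderiv U a v (wderiv U a v) by apply: xgetPex; exists g.
split=> //; have mg : measurable_fun U g by case: wg => _ [].
have mD : measurable_fun U (wderiv U a v) by case: wD => _ [].
exact: (nrm_ae_eq (open_measurable_rV oU) p1 mD (conj mg gp) (wderiv_unique oU wD wg)).1.
Qed.

Lemma sobolev_wderiv0 (R : realType) (n s : nat) (U : set 'rV[R]_n) (p : \bar R) v :
  open U -> (1 <= p)%E -> sobolev U s p v ->
  is_wderiv U (mnm0 (n:=n)) v v /\ Lfin U p v.
Proof.
move=> oU p1 sv; have d0 : (mdeg (mnm0 (n:=n)) <= s)%N by rewrite mdeg0.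
have [wD LD] := sobolev_wderiv oU p1 sv d0.
have w0 : is_wderiv U (mnm0 (n:=n)) v v.
  have [lv _ _] := wD; split=> // phi tp; rewrite mdeg0 mul1r /partialm.
  apply: eq_Rintegral => x _; congr (_ * _).
  by elim: (enum _) => //= i t IH; rewrite mnm0E.
split=> //; have mv : measurable_fun U v by case: w0 => [[]].
exact: (nrm_ae_eq (open_measurable_rV oU) p1 mv LD (wderiv_unique oU w0 wD)).1.
Qed.

Section estimate.
Variables (R : realType) (n l s' : nat) (U : set 'rV[R]_n) (p : \bar R) (c x0 : 'rV[R]_n)
  (e kappa k C : R).
Local Notation V := 'rV[R]_n.
Local Notation mu := (lebesgue_rV R n).
Local Notation s := s'.+1.
Hypotheses (p1 : (1 <= p)%E) (oU : open U) (bU : bounded_set U) (Ux0 : U x0)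
  (e0 : 0 < e) (kappa0 : 0 <= kappa) (k0 : 0 <= k) (C0 : 0 <= C)
  (EU : cube c e `<=` U)
  (star : forall z x t, cube c e z -> U x -> 0 <= t <= 1 -> U ((1 - t) *: z + t *: x))
  (width : forall x y i, U x -> U y -> `|x ord0 i - y ord0 i| <= kappa * e)
  (UE : (mu U <= k%:E * mu (cube c e))%E)
  (sl : (s <= l.+1)%N)
  (inverse : forall q b (x : V), (msize q <= l.+1)%N -> U x ->
    `|pev (mderivm b q) x| <= C * (e ^+ mdeg b)^-1 * (fine (mu U))^-1 * \int[mu]_(x in U) `|pev q x|).
Implicit Types (q w : mpoly n R) (a b : multinom n).

Let mU : measurable U. Proof. exact: open_measurable_rV. Qed.
Let U0 : (0 < mu U)%E. Proof. exact: open_mu_gt0 oU Ux0. Qed.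
Let Uoo : (mu U < +oo)%E. Proof. exact: bounded_lty. Qed.
Let muU0 : 0 < fine (mu U). Proof. by rewrite fine_gt0// U0. Qed.
Let E0 : (0 < mu (cube c e))%E.
Proof. by rewrite [ltRHS]lebesgue_cube// lte_fin exprn_gt0// mulr_gt0. Qed.

(** The Poincare constant in units of [e]: the width is [kappa * e], and [n] bounds the number of
    first derivatives. The summand 1 makes the powers of [A] nondecreasing in the exponent. *)
Let A : R := 1 + 2 * (2 * (2 ^+ n * (1 + k))) * kappa * n%:R.
Let K0 : 0 <= 2 * (2 * (2 ^+ n * (1 + k))) * kappa.
Proof. by rewrite !mulr_ge0 ?exprn_ge0// addr_ge0. Qed.
Let A1 : 1 <= A. Proof. by rewrite lerDl mulr_ge0. Qed.

Lemma poincare_cube f (g : 'I_n -> V -> R) (B : R) : Lfin U p f -> (forall i, Lfin U p (g i)) ->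
  (forall i (y z : V) F, cbox y z `<=` U -> pbump y z F ->
    \int[mu]_(x in U) (f x * pb (upd F i) x) = - \int[mu]_(x in U) (g i x * pb F x)) ->
  \int[mu]_(x in U) f x = 0 -> (forall i, nrm U p (g i) <= B) -> 0 <= B ->
  nrm U p f <= A * e * B.
Proof.
move=> Lf Lg ibp f0 gB B0.
have := @poincare R n U (cube c e) p (kappa * e) k p1 oU (@open_obox _ _ _ _) EU E0 Uoo
  (mulr_ge0 kappa0 (ltW e0)) star width UE f g Lf Lg ibp f0.
move=> /le_trans; apply.
apply: (@le_trans _ _ (2 * (2 * (2 ^+ n * (1 + k))) * kappa * e * (n%:R * B))).
  rewrite (mulrA _ kappa e) ler_wpM2l//; first by rewrite mulr_ge0// ltW.
  rewrite -[X in X%:R * _]card_ord -sum1_card natr_sum mulr_suml.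
  by apply: ler_sum => i _; rewrite mul1r.
rewrite /A; set P := 2 * _ * kappa.
rewrite (_ : (1 + P * n%:R) * e * B = P * e * (n%:R * B) + e * B); last by ring.
by rewrite lerDl mulr_ge0// ltW.
Qed.

Variable v : V -> R.
Hypothesis sv : sobolev U s p v.
Let D a := wderiv U a v.

Let HD a : (mdeg a <= s)%N -> is_wderiv U a v (D a).
Proof. by move=> al; exact: (sobolev_wderiv oU p1 sv al).1. Qed.

Let LD a : (mdeg a <= s)%N -> Lfin U p (D a).
Proof. by move=> al; exact: (sobolev_wderiv oU p1 sv al).2. Qed.

Let D0 : is_wderiv U (mnm0 (n:=n)) v v.
Proof. exact: (sobolev_wderiv0 oU p1 sv).1. Qed.

Let Lv : Lfin U p v. Proof. exact: (sobolev_wderiv0 oU p1 sv).2. Qed.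

Lemma Lfin_pev q : Lfin U p (pev q).
Proof.
have [a [b Uab]] := bounded_cbox bU.
have [M HM] := @continuous_bounded_cbox R n (pev q) a b (@continuous_pev _ _ q).
have := @nrm_le R n U p mU p1 (pev q) (cst `|M|) _ (Lfin_cst mU p1 U0 Uoo _) _.
case=> //; first by apply: measurable_funTS; exact: measurable_pev.
by apply: nearW => x Ux; rewrite normr_id (le_trans (HM x (Uab x Ux)))// ler_norm.
Qed.

Let W q a x := D a x - pev (mderivm a q) x.

Let HW q a : (mdeg a <= s)%N -> is_wderiv U a (fun x => v x - pev q x) (W q a).
Proof. by move=> al; apply: is_wderivB => //; [exact: HD|exact: is_wderiv_pev]. Qed.

Let LW q a : (mdeg a <= s)%N -> Lfin U p (W q a).
Proof. by move=> al; apply: LfinB => //; [exact: LD|exact: Lfin_pev]. Qed.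

Let T := \sum_(b : bmultinom n s.+1 | mdeg b == s) nrm U p (D b).

Let T0 : 0 <= T. Proof. by apply: sumr_ge0 => b _; exact: nrm_ge0. Qed.

(** Descending induction on the order of [a]. At order [s] the derivative of [Q] vanishes and only
    that of [v] remains; below, zero means allow one Poincare step, at the cost of [A * e]. *)
Lemma averaged_bounds Q : (msize Q <= s)%N ->
  (forall a, (mdeg a < s)%N -> \int[mu]_(x in U) W Q a x = 0) ->
  forall j a, (mdeg a + j)%N = s -> nrm U p (W Q a) <= (A * e) ^+ j * T.
Proof.
move=> Qs Q0; elim=> [|j IH] a; rewrite ?addn0 => aj.
  have ab : (mdeg a < s.+1)%N by rewrite aj.
  rewrite mul1r /W mderivm_eq0 ?aj// (_ : (fun x => _) = D a); last first.
    by apply/funext => x; rewrite pev0 /= subr0.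
  rewrite /T (bigD1 (BMultinom ab)) ?aj//= lerDl; apply: sumr_ge0 => b _; exact: nrm_ge0.
have aS : (mdeg a < s)%N by rewrite -aj addnS ltnS leq_addr.
rewrite exprS -mulrA; apply: (@poincare_cube _ (fun i => W Q (mnm_add a (mnm1 i)))).
- by apply: LW; exact: ltnW.
- by move=> i; apply: LW; rewrite mdegD mdeg1 addn1.
- move=> i b b' B; apply: wderiv_step; first by apply: HW; exact: ltnW.
  by apply: HW; rewrite mdegD mdeg1 addn1.
- exact: Q0.
- by move=> i; apply: IH; rewrite mdegD mdeg1 addn1 -aj addnS addSn.
- by rewrite mulr_ge0// exprn_ge0// mulr_ge0 ?(ltW e0)// (le_trans _ A1).
Qed.

(** Let X and Y be the sums on the two sides. The inverse inequality bounds grad r pointwise by C X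
    / |U|, so the Galerkin identity bounds the energy by C X Y / |U|. Conversely X^2 is at most n
    |U| times the energy. A factor X cancels. *)
Lemma gradient_bound r (w : 'I_n -> V -> R) : (msize r <= l.+1)%N ->
  (forall i, Lfin U p (w i)) ->
  \sum_i int_pev U (mderiv i r * mderiv i r) = \sum_i \int[mu]_(x in U) (w i x * pev (mderiv i r) x) ->
  \sum_i \int[mu]_(x in U) `|pev (mderiv i r) x| <= n%:R * C * \sum_i \int[mu]_(x in U) `|w i x|.
Proof.
move=> rl Lw H; set X := \sum_i _; set Y := (X in _ <= _ * X).
have X0 : 0 <= X by apply: sumr_ge0 => i _; exact: Rintegral_ge0.
have Y0 : 0 <= Y by apply: sumr_ge0 => i _; exact: Rintegral_ge0.
have sup i x : U x -> `|pev (mderiv i r) x| <= C * (fine (mu U))^-1 * X.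
  move=> Ux; have := inverse (mnm0 (n:=n)) (msize_mderivW i rl) Ux.
  rewrite mdeg0 expr0 invr1 mulr1 mderivm0m => /le_trans; apply.
  rewrite ler_wpM2l// ?mulr_ge0 ?invr_ge0 ?(ltW muU0)// /X (bigD1 i)//= lerDl.
  by apply: sumr_ge0 => j _; exact: Rintegral_ge0.
have iw i : mu.-integrable U (EFin \o w i) by exact: (Lfin_integrable mU p1 U0 Uoo (Lw i)).
have SQ : \sum_i int_pev U (mderiv i r * mderiv i r) <= C * (fine (mu U))^-1 * X * Y.
  rewrite H /Y mulr_sumr; apply: ler_sum => i _; apply: (le_trans (ler_norm _)).
  have iwp := integrable_mul_pev oU bU (mderiv i r) (iw i).
  apply: (le_trans (le_normr_Rintegral mU iwp)).
  rewrite -RintegralZl//; last exact: (integrable_abse (iw i)).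
  apply: le_Rintegral => //; first exact: (integrable_abse iwp).
    exact: (integrableZl mU _ (integrable_abse (iw i))).
  by move=> x Ux; rewrite normrM mulrC ler_wpM2r// sup.
suff Hlam eps : 0 < eps -> X <= n%:R * (C * Y + eps).
  apply/ler_addgt0Pr => eps eps0.
  have n1 : 0 < (n.+1)%:R :> R by rewrite ltr0n.
  apply: (le_trans (Hlam (eps / n.+1%:R) _)); first exact: divr_gt0.
  rewrite mulrDr mulrA lerD2l mulrCA ger_pMr// ler_pdivrMr// mul1r ler_nat.
  by rewrite leqnSn.
(* With this [a], [abs_le_young] replaces the Cauchy-Schwarz inequality; [eps]
   only serves to make [a] positive. *)
move=> eps0; pose a := (C * Y + eps) / fine (mu U).
have a0 : 0 < a by rewrite divr_gt0// ltr_wpDl// mulr_ge0.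
have XS : X <= (\sum_i int_pev U (mderiv i r * mderiv i r) / a + n%:R * (a * fine (mu U))) / 2.
  rewrite /X -[X in X%:R * _]card_ord -sum1_card natr_sum mulr_suml -big_split mulr_suml.
  apply: ler_sum => i _; rewrite mul1r.
  rewrite -(Rintegral_cst mu mU) /int_pev -[_ / a]mulrC -RintegralZl//; last exact: integrable_pev.
  rewrite /= -RintegralD//; last 2 first.
  - exact: (integrableZl mU _ (integrable_pev mU bU _)).
  - exact: (Lfin_integrable mU p1 U0 Uoo (Lfin_cst mU p1 U0 Uoo a)).
  have iD : mu.-integrable U (EFin \o (fun x => a^-1 * pev (mderiv i r * mderiv i r) x + a)).
    have i1 := integrableZl mU a^-1 (integrable_pev mU bU (mderiv i r * mderiv i r)).
    exact: (integrableD mU i1 (Lfin_integrable mU p1 U0 Uoo (Lfin_cst mU p1 U0 Uoo a))).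
  rewrite /= -[leRHS]mulrC -RintegralZl//; apply: le_Rintegral => //.
  - exact: (integrable_abse (integrable_pev mU bU (mderiv i r))).
  - exact: (integrableZl mU _ iD).
  by move=> x _; rewrite mulrC pevM -expr2 [a^-1 * _]mulrC; exact: abs_le_young.
(* By the choice of [a], the energy term is at most X and the other one equals n (C Y + eps); the
   half of X is then absorbed on the left. *)
have : X <= (X + n%:R * (C * Y + eps)) / 2.
  apply: (le_trans XS); rewrite ler_pM2r ?invr_gt0// lerD//.
    rewrite -mulr_suml ler_pdivrMr//; apply: (le_trans SQ).
    rewrite [leRHS](_ : _ = (C * (fine (mu U))^-1 * X * Y) + X * eps / fine (mu U)).
      by rewrite lerDl divr_ge0 ?(ltW muU0)// mulr_ge0// ltW.
    by rewrite /a; field; rewrite gt_eqF.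
  by rewrite /a divfK// gt_eqF.
lra.
Qed.

Let Ap := nrm U p (cst 1).
Let Ap0 : 0 < Ap. Proof. exact: nrm_cst1_gt0. Qed.

Lemma nrm_const_le (f : V -> R) (B : R) : measurable_fun U f -> 0 <= B -> (forall x, U x -> `|f x| <= B) ->
  nrm U p f <= B * Ap.
Proof.
move=> mf B0 fB; rewrite -[X in X * _](ger0_norm B0) -nrm_cst//.
apply: (@nrm_le R n U p mU p1 f (cst B) mf (Lfin_cst mU p1 U0 Uoo B) _).2.
by apply: nearW => x Ux /=; rewrite (ger0_norm B0) fB.
Qed.

(** In the constant, one [n * C] comes from [gradient_bound], another [n] from summing the
    components of grad (v - Q), and another [C] from the inverse inequality applied to r. Order 0
    takes one more Poincare factor [A]. *)
Lemma elliptic_bound q : (msize q <= l.+1)%N -> is_elliptic_proj U l v (pev q) ->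
  forall a, (mdeg a <= s)%N ->
  nrm U p (W q a) <= A ^+ s.+1 * (1 + n%:R ^+ 2 * C ^+ 2) * e ^+ (s - mdeg a) * T.
Proof.
move=> ql [_ galerkin mean].
have iD a : (mdeg a <= s')%N -> mu.-integrable U (EFin \o D a).
  by move=> as'; apply: (Lfin_integrable mU p1 U0 Uoo (LD _)); exact: leqW.
have [Q Qs Q0] := averaged_poly oU bU Ux0 iD.
have Ql : (msize Q <= l.+1)%N by exact: leq_trans sl.
pose r := q - Q.
have rl : (msize r <= l.+1)%N.
  rewrite /r; apply: (leq_trans (msizeD_le _ _)); rewrite geq_max ql /=.
  by rewrite -scaleN1r (leq_trans (msizeZ_le _ _)).
have bnd := averaged_bounds Qs Q0.
have A0 : 0 <= A by exact: le_trans A1.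
have d1 i : (mdeg (mnm1 i : multinom n) <= s)%N by rewrite mdeg1.
pose w i := W Q (mnm1 i).
have Lw i : Lfin U p (w i) by exact: LW.
have wB i : nrm U p (w i) <= (A * e) ^+ s' * T by apply: bnd; rewrite mdeg1 add1n.
(* Galerkin orthogonality is tested with [r] itself; this is legitimate because [s <= l + 1] puts
   [Q], hence [r], in the polynomial space. *)
have energy : \sum_i int_pev U (mderiv i r * mderiv i r) =
    \sum_i \int[mu]_(x in U) (w i x * pev (mderiv i r) x).
  have := galerkin (pev r); rewrite /poly_space /= => /(_ (ex_intro2 _ _ r rl erefl)).
  under eq_Rintegral do under eq_bigr do rewrite !partial_pev -[_ * _]/((fun x => pev _ x * pev _ x) _) -pevM.
  under [X in _ = X -> _]eq_Rintegral do under eq_bigr do rewrite partial_pev.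
  rewrite (Rintegral_sum_fin oU _ (fun i => integrable_pev mU bU _)).2.
  have iDi i : mu.-integrable U (EFin \o D (mnm1 i)).
    exact: (Lfin_integrable mU p1 U0 Uoo (LD (d1 i))).
  rewrite (Rintegral_sum_fin oU _ (fun i => integrable_mul_pev oU bU _ (iDi i))).2 => G.
  have -> : \sum_i \int[mu]_(x in U) (w i x * pev (mderiv i r) x) =
     \sum_i \int[mu]_(x in U) (D (mnm1 i) x * pev (mderiv i r) x) -
     \sum_i int_pev U (mderiv i Q * mderiv i r).
    rewrite -sumrB; apply: eq_bigr => i _.
    rewrite /int_pev -RintegralB//; last 2 first.
    - exact: integrable_mul_pev.
    - exact: integrable_pev.
    by apply: eq_Rintegral => x _; rewrite pevM /w /W mderivmU1m mulrBl.
  rewrite -G -sumrB; apply: eq_bigr => i _; rewrite -[_ - _]/(int_pev U _ - int_pev U _).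
  have -> : mderiv i r * mderiv i r = mderiv i q * mderiv i r - mderiv i Q * mderiv i r.
    by rewrite -mulrBl -mderivB.
  by rewrite int_pevD// -scaleN1r int_pevZ// mulN1r.
have grad := gradient_bound rl Lw energy.
have wI i : (\int[mu]_(x in U) `|w i x|) * Ap <= fine (mu U) * ((A * e) ^+ s' * T).
  apply: (le_trans (hoelder_nrm mU p1 U0 Uoo (Lw i))).
  by rewrite ler_wpM2l// ltW.
pose B0 := (A * e) ^+ s' * T.
have B00 : 0 <= B0 by rewrite mulr_ge0// exprn_ge0// mulr_ge0// ltW.
have gradB : (\sum_i \int[mu]_(x in U) `|pev (mderiv i r) x|) * Ap <= n%:R ^+ 2 * C * (fine (mu U) * B0).
  apply: (@le_trans _ _ (n%:R * C * (\sum_i \int[mu]_(x in U) `|w i x|) * Ap)).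
    by rewrite ler_wpM2r// ltW.
  rewrite expr2 -!mulrA ler_wpM2l//; rewrite [leRHS]mulrCA ler_wpM2l//.
  rewrite mulr_suml -[X in _ <= X%:R * _]card_ord -sum1_card natr_sum mulr_suml.
  by apply: ler_sum => i _; rewrite mul1r.
have high a : (1 <= mdeg a <= s)%N ->
    nrm U p (W q a) <= A ^+ s * (1 + n%:R ^+ 2 * C ^+ 2) * e ^+ (s - mdeg a) * T.
  (* One derivative is set apart: [gradient_bound] controls the derivative of [r] in direction [i],
     and the inverse inequality pays for the remaining [b]. *)
  case/andP => a1 as_; have /mnm_splitS[i [b [ab bd]]] : mdeg a = (mdeg a).-1.+1 by rewrite prednK.
  have -> : W q a = (fun x => W Q a x - pev (mderivm a r) x).
    apply/funext => x; rewrite /W /r mderivmB pevB; ring.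
  apply: (le_trans (nrmB mU p1 (LW Q as_) (Lfin_pev _))).
  have N1 : nrm U p (W Q a) <= (A * e) ^+ (s - mdeg a) * T by apply: bnd; rewrite subnKC.
  have N2 : nrm U p (pev (mderivm a r)) <= n%:R ^+ 2 * C ^+ 2 * (e ^+ (mdeg a).-1)^-1 * B0.
    pose I := \int[mu]_(x in U) `|pev (mderiv i r) x|.
    have I0 : 0 <= I by exact: Rintegral_ge0.
    have eb0 : 0 <= C * (e ^+ mdeg b)^-1 * (fine (mu U))^-1.
      by rewrite !mulr_ge0// ?invr_ge0 ?exprn_ge0 ?(ltW e0)// ltW.
    apply: (@le_trans _ _ (C * (e ^+ mdeg b)^-1 * (fine (mu U))^-1 * I * Ap)).
      apply: nrm_const_le.
      - by apply: measurable_funTS; exact: measurable_pev.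
      - by rewrite mulr_ge0.
      - by move=> x Ux; rewrite ab mderivmS; apply: inverse => //; exact: msize_mderivW.
    have IB : I * Ap <= n%:R ^+ 2 * C * (fine (mu U) * B0).
      apply: le_trans gradB; rewrite ler_wpM2r ?(ltW Ap0)// (bigD1 i)//= lerDl.
      by apply: sumr_ge0 => j _; exact: Rintegral_ge0.
    rewrite -mulrA; apply: (le_trans (ler_wpM2l eb0 IB)).
    rewrite bd le_eqVlt; apply/orP; left; apply/eqP; field.
    by rewrite !gt_eqF// exprn_gt0.
  apply: (le_trans (lerD N1 N2)).
  have es : (e ^+ (mdeg a).-1)^-1 * e ^+ s' = e ^+ (s - mdeg a).
    rewrite [in e ^+ s'](@succ_sub_pred (mdeg a) s') ?a1//.
    by rewrite exprD mulrCA mulVf ?mulr1// gt_eqF// exprn_gt0.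
  have es0 : 0 <= e ^+ (s - mdeg a) by rewrite exprn_ge0// ltW.
  rewrite /B0 !exprMn.
  have -> : n%:R ^+ 2 * C ^+ 2 * (e ^+ (mdeg a).-1)^-1 * (A ^+ s' * e ^+ s' * T) =
     A ^+ s' * (n%:R ^+ 2 * C ^+ 2) * e ^+ (s - mdeg a) * T by rewrite -es; ring.
  rewrite -mulrDl ler_wpM2r// -mulrDl ler_wpM2r// mulrDr mulr1 lerD//.
    by apply: ler_weXn2l => //; exact: leq_subr.
  rewrite ler_wpM2r ?mulr_ge0// ?sqr_ge0//.
  by apply: ler_weXn2l.
have G0 : 0 <= 1 + n%:R ^+ 2 * C ^+ 2 by rewrite addr_ge0// mulr_ge0// sqr_ge0.
(* Galerkin orthogonality says nothing at order 0; the mean condition of the projector makes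
   Poincare applicable there. *)
move=> a as_; have [a0|a1] := posnP (mdeg a); last first.
  apply: (le_trans (high a _)); first by rewrite a1.
  do 3 (rewrite ler_wpM2r// ?exprn_ge0// ?(ltW e0)//).
  by apply: ler_weXn2l.
move/eqP: a0; rewrite mdeg_eq0 => /eqP ->; rewrite mdeg0 subn0.
have d0 : (mdeg (mnm0 (n:=n)) <= s)%N by rewrite mdeg0.
have e1 i : (mnm_add (mnm0 (n:=n)) (mnm1 i)) = mnm1 i by rewrite add0m.
have := @poincare_cube (W q (mnm0 (n:=n))) (fun i => W q (mnm1 i))
  (A ^+ s * (1 + n%:R ^+ 2 * C ^+ 2) * e ^+ s' * T) (LW q d0) (fun i => LW q (d1 i)).
move=> /(_ _ _ _ _)/le_trans; apply.
- move=> i y z F yz pF; apply: wderiv_step yz pF; first exact: HW.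
  by rewrite e1; exact: HW.
(* The weak derivative of order 0 chosen by [wderiv] need not be [v] itself, only almost everywhere
   equal to it, and the mean condition is about [v]. *)
- have wq : {ae mu, forall x, U x -> W q (mnm0 (n:=n)) x = v x - pev q x}.
    apply: filterS (wderiv_unique oU (HD d0) D0) => x + Ux => /(_ Ux).
    by rewrite /W mderivm0m => ->.
  have iv := Lfin_integrable mU p1 U0 Uoo Lv; have iq := integrable_pev mU bU q.
  have iW := Lfin_integrable mU p1 U0 Uoo (LW q d0).
  transitivity (\int[mu]_(x in U) (v x - pev q x)).
    congr fine; apply: ae_eq_integral => //; first exact: measurable_int iW.
    - exact: measurable_int (integrableB mU iv iq).
    - by apply: filterS wq => x + Ux => /(_ Ux) ->.
  rewrite RintegralB// -[LHS]opprB; move: mean; rewrite RintegralB// => ->.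
  by rewrite oppr0.
- move=> i; apply: (le_trans (high _ _)); first by rewrite mdeg1.
  by rewrite mdeg1 subn1.
- by rewrite !mulr_ge0// ?exprn_ge0// ltW.
rewrite le_eqVlt; apply/orP; left; apply/eqP; rewrite [A ^+ s.+1]exprS [e ^+ s]exprS; ring.
Qed.

End estimate.

(** * The inner cube of a star-shaped set *)

Section geometry_facts.
Variables (R : realType) (d : nat).
Local Notation V := 'rV[R]_d.
Local Notation mu := (lebesgue_rV R d).
Implicit Types (x y z : V) (U : set V).

Lemma coord_le_enorm z i : `|z ord0 i| <= enorm z.
Proof.
rewrite /enorm -sqrtr_sqr ler_wsqrtr// (bigD1 i)//= lerDl.
by apply: sumr_ge0 => j _; exact: sqr_ge0.
Qed.

Lemma enorm_le_sum z : enorm z <= \sum_i `|z ord0 i|.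
Proof.
have S0 : 0 <= \sum_i `|z ord0 i| by exact: sumr_ge0.
rewrite /enorm -[leRHS]ger0_norm// -sqrtr_sqr ler_wsqrtr//.
elim: (index_enum _) => [|i s IH]; first by rewrite !big_nil sqr_ge0.
rewrite !big_cons sqrrD real_normK ?num_real// -addrA lerD2l.
by apply: (le_trans IH); rewrite lerDr mulrn_wge0// mulr_ge0// sumr_ge0.
Qed.

Lemma enorm_le_diam U x y : bounded_set U -> U x -> U y -> enorm (x - y) <= diam U.
Proof.
move=> /bounded_cbox[a [b Uab]] Ux Uy; apply: ub_le_sup; last by exists x => //; exists y.
exists (\sum_i (b ord0 i - a ord0 i)) => _ [u Uu [w Uw <-]].
apply: (le_trans (enorm_le_sum _)); apply: ler_sum => i _; rewrite !mxE ler_norml.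
have /andP[? ?] := Uab _ Uu i; have /andP[? ?] := Uab _ Uw i.
by apply/andP; split; lra.
Qed.

Lemma diam_gt0 U x : (0 < d)%N -> open U -> bounded_set U -> U x -> 0 < diam U.
Proof.
move=> d0 oU bU Ux; have /nbhs_ballP[r /= r0 sub] : nbhs x U by exact: open_nbhs_nbhs.
pose i := Ordinal d0; pose y := x + (r / 2) *: delta_mx ord0 i.
have Uy : U y.
  apply: sub; split=> // j k; rewrite /ball /= /y !mxE opprD addrA subrr add0r normrN normrM.
  rewrite (ord1 j) eqxx /= gtr0_norm ?divr_gt0//.
  by case: eqP => _; rewrite ?normr1 ?normr0; lra.
apply: (lt_le_trans _ (enorm_le_diam bU Uy Ux)); apply: (lt_le_trans _ (coord_le_enorm _ i)).
rewrite /y !mxE addrAC subrr add0r !eqxx mulr1 gtr0_norm; lra.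
Qed.

(** In the cube of half-edge e, the Euclidean distance to [c] is at most d e, and dividing by
    [d + 1] keeps it strictly below the radius [rho * diam U]. The ratio [kappa] is chosen so that
    [kappa * e] is the diameter. *)
Lemma star_cube (U : set V) x (rho : R) : (0 < d)%N -> 0 < rho -> open U -> bounded_set U -> U x ->
  star_shaped_ball U (rho * diam U) ->
  exists c, let e := rho / d.+1%:R * diam U in let kappa := d.+1%:R / rho in
  [/\ cube c e `<=` U,
   forall z y t, cube c e z -> U y -> 0 <= t <= 1 -> U ((1 - t) *: z + t *: y),
   forall y z i, U y -> U z -> `|y ord0 i - z ord0 i| <= kappa * e,
   U c & (mu U <= ((2 * kappa) ^+ d)%:E * mu (cube c e))%E].
Proof.
move=> d0 rho0 oU bU Ux [c Hc]; exists c => e kappa.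
have h0 := diam_gt0 d0 oU bU Ux.
have d1 : 0 < d.+1%:R :> R by rewrite ltr0n.
have e0 : 0 < e by rewrite /e mulr_gt0// divr_gt0.
have kappa0 : 0 < kappa by rewrite divr_gt0.
have keh : kappa * e = diam U by rewrite /kappa /e; field; rewrite !gt_eqF//; exact: ltr0Sn.
have star z y t : cube c e z -> U y -> 0 <= t <= 1 -> U ((1 - t) *: z + t *: y).
  move=> /obox_ball cz; apply: Hc; apply: (le_lt_trans (enorm_le_sum _)).
  apply: (@le_lt_trans _ _ (\sum_(i < d) e)).
    by apply: ler_sum => i _; rewrite !mxE ltW.
  rewrite sumr_const card_ord -mulr_natl /e mulrA ltr_pM2r// mulrCA gtr_pMr// ltr_pdivrMr// mul1r.
  by rewrite ltr_nat.
have cc : cube c e c by apply/obox_ball => i; rewrite subrr normr0.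
have EU : cube c e `<=` U.
  (* At time 0 the segment from z is at z itself, so star-shapedness places z in [U]. *)
  by move=> z cz; have := star z x 0 cz Ux; rewrite subr0 scale1r scale0r addr0 lexx ler01; exact.
have width y z i : U y -> U z -> `|y ord0 i - z ord0 i| <= kappa * e.
  move=> Uy Uz; rewrite keh; apply: le_trans (enorm_le_diam bU Uy Uz).
  by apply: le_trans (coord_le_enorm _ i); rewrite !mxE.
split=> //; first exact: EU.
rewrite [X in (_ <= _ * X)%E]lebesgue_cube// -EFinM -exprMn.
(* [U] is compared with the cube of half-edge [2 * kappa * e]: half of it bounds the coordinates of
   [U] relative to [c], and the factor 2 gives the strict inequalities of an open cube. *)
rewrite (_ : 2 * kappa * (2 * e) = 2 * (2 * kappa * e)); last by ring.
rewrite -(lebesgue_cube c); last exact: mulr_gt0 (mulr_gt0 (ltr0Sn _ 1) kappa0) e0.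
apply: le_measure; rewrite ?inE//; [exact: open_measurable_rV|exact: measurable_obox|].
move=> y Uy; apply/obox_ball => i; apply: (le_lt_trans (width y c i Uy (EU _ cc))).
by rewrite -mulrA ltr_pMl ?ltr1n//; exact: mulr_gt0.
Qed.

End geometry_facts.

Theorem theorem1 (R : realType) (d : nat) (hd : (1 <= d)%N) (l : nat)
    (rho : R) (hrho : 0 < rho) (s : nat) (hs : (1 <= s <= l.+1)%N)
    (p : \bar R) (hp : (1 <= p)%E) :
  exists C : R, 0 < C /\
    forall U : set 'rV[R]_d,
      open U -> bounded_set U -> connected U ->
      star_shaped_ball U (rho * diam U) ->
    forall m : nat, (m <= s)%N ->
    forall v : 'rV[R]_d -> R, sobolev U s p v ->
      (sobolev_seminorm U m p (v \- elliptic_proj U l v)%R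
       <= (C * diam U ^+ (s - m)%N)%:E * sobolev_seminorm U s p v)%E.
Proof.
case/andP: hs; case: s => [//|s'] _ sl; pose s := s'.+1.
pose kappa : R := d.+1%:R / rho; pose k := (2 * kappa) ^+ d.
have [C1 [C10 HC1]] := poly_inverse d l kappa k.
have rd0 : 0 < rho / d.+1%:R by rewrite divr_gt0// ltr0Sn.
have kappa0 : 0 <= kappa by rewrite divr_ge0 ?ltW.
have k0 : 0 <= k by rewrite exprn_ge0// mulr_ge0.
pose A : R := 1 + 2 * (2 * (2 ^+ d * (1 + k))) * kappa * d%:R.
pose B : R := A ^+ s.+1 * (1 + d%:R ^+ 2 * C1 ^+ 2).
have k1 : 0 <= 1 + k by rewrite addr_ge0.
have pow2 : 0 <= 2 ^+ d :> R by rewrite exprn_ge0.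
have two0 : 0 <= 2 :> R by [].
have A0 : 0 <= A.
  exact: addr_ge0 ler01 (mulr_ge0 (mulr_ge0 (mulr_ge0 two0 (mulr_ge0 two0 (mulr_ge0 pow2 k1))) kappa0) (ler0n _ _)).
have B0 : 0 <= B by rewrite mulr_ge0 ?exprn_ge0// addr_ge0// mulr_ge0// sqr_ge0.
(* [N] dominates the number of multi-indices for each [m <= s], and [G] below dominates every power
   of [rho / (d + 1)] with exponent [s - m]; the constant is thus independent of [m]. *)
pose N : R := \sum_(m < s.+1) #|{: bmultinom d m.+1}|%:R.
have N0 : 0 <= N by exact: sumr_ge0.
pose G : R := (1 + rho / d.+1%:R) ^+ s.
have G0 : 0 <= G by rewrite exprn_ge0// addr_ge0// ltW.
(* The added 1 makes the constant positive. *)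
exists (N * B * G + 1); split; first exact: ltr_pwDr ltr01 (mulr_ge0 (mulr_ge0 N0 B0) G0).
move=> U oU bU _ starU m ms v sv.
(* On the empty set every norm is 0, whatever value [elliptic_proj] takes; otherwise a point is
   available to start the geometric construction. *)
have [->|/set0P[x Ux]] := eqVneq U set0.
  have L0 f : Lp_norm set0 p f = 0%E.
    rewrite /Lp_norm (_ : EFin \o _ = cst 0%E) ?Lnorm0 ?gt_eqF ?(lt_le_trans _ hp)//.
    by apply/funext => x /=; rewrite patchE in_set0.
  rewrite /sobolev_seminorm !big1 ?mule0// => a _; exact: L0.
have [c [EU star width Uc UE]] := star_cube hd hrho oU bU Ux starU.
set e := rho / _ * diam U in EU star width UE.
have h0 := diam_gt0 hd oU bU Ux.
have e0 : 0 < e by rewrite mulr_gt0.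
have mU := open_measurable_rV oU.
have U0 := open_mu_gt0 oU Ux; have Uoo := bounded_lty mU bU.
have inv := HC1 U c e oU bU e0 EU (fun x i Ux => width x c i Ux Uc) UE.
have T0 : sobolev_seminorm U s p v =
    (\sum_(b : bmultinom d s.+1 | mdeg b == s) nrm U p (wderiv U b v))%:E.
  rewrite /sobolev_seminorm -sumEFin; apply: eq_bigr => b /eqP bs.
  by rewrite nrmE//; apply: (sobolev_wderiv oU hp sv _).2; rewrite bs.
set T := (X in X%:E) in T0.
have Tge0 : 0 <= T by apply: sumr_ge0 => b _; exact: nrm_ge0.
have iv : (lebesgue_rV R d).-integrable U (EFin \o v).
  exact: (Lfin_integrable mU hp U0 Uoo (sobolev_wderiv0 oU hp sv).2).
have ig i : (lebesgue_rV R d).-integrable U (EFin \o wderiv U (mnm1 i) v).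
  apply: (Lfin_integrable mU hp U0 Uoo); apply: (sobolev_wderiv oU hp sv _).2.
  by rewrite mdeg1.
have ell := elliptic_proj_exists l oU bU Ux iv ig.
have [[q ql qE] _ _] := ell; rewrite qE -[fun x => meval _ q]/(pev q) in ell *.
have bound := elliptic_bound hp oU bU Ux e0 kappa0 k0 C10 EU star width UE sl inv sv ql ell.
rewrite T0 -EFinM.
(* The seminorm uses the representative that [wderiv] chooses for the error; by uniqueness it is
   almost everywhere the difference of the chosen derivative of [v] and the classical derivative of
   [q]. *)
have Wa a : (mdeg a <= s)%N -> Lp_norm U p (wderiv U a (v \- pev q)) =
    (nrm U p (fun x => wderiv U a v x - pev (mderivm a q) x))%:E.
  move=> as_; have [wD LD] := sobolev_wderiv oU hp sv as_.
  have wW := is_wderivB oU wD (is_wderiv_pev a q oU).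
  have wX : is_wderiv U a (v \- pev q) (wderiv U a (v \- pev q)).
    by apply: xgetPex; exists (wderiv U a v \- pev (mderivm a q)).
  have LW := LfinB mU hp LD (Lfin_pev hp oU bU Ux (mderivm a q)).
  have mX : measurable_fun U (wderiv U a (v \- pev q)) by case: wX => _ [].
  have [LX XE] := nrm_ae_eq mU hp mX LW (wderiv_unique oU wX wW).
  by rewrite -(nrmE LX) XE.
rewrite /sobolev_seminorm (eq_bigr (fun a : bmultinom d m.+1 =>
  (nrm U p (fun x => wderiv U a v x - pev (mderivm a q) x))%:E)); last first.
  by move=> a /eqP am; rewrite Wa// am.
rewrite sumEFin lee_fin.
have hm0 : 0 <= diam U ^+ (s - m) by rewrite exprn_ge0// ltW.
apply: (@le_trans _ _ (\sum_(a : bmultinom d m.+1) B * (G * diam U ^+ (s - m)) * T)).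
  rewrite big_mkcond; apply: ler_sum => a _; case: eqP => [am|_]; last first.
    exact: mulr_ge0 (mulr_ge0 B0 (mulr_ge0 G0 hm0)) Tge0.
  have := bound a; rewrite am => /(_ ms)/le_trans; apply.
  rewrite ler_wpM2r// -/A -/B ler_wpM2l// /e exprMn ler_wpM2r// /G.
  apply: (@le_trans _ _ ((1 + rho / d.+1%:R) ^+ (s - m))).
    by apply: lerXn2r; rewrite ?nnegrE ?addr_ge0 ?(ltW rd0)// lerDr.
  by apply: ler_weXn2l; rewrite ?leq_subr// lerDl ltW.
rewrite sumr_const -mulr_natl.
have Nm : #|{: bmultinom d m.+1}|%:R <= N.
  by rewrite /N (bigD1 (Ordinal (ms : (m < s.+1)%N)))//= lerDl sumr_ge0.
apply: (@le_trans _ _ (N * (B * (G * diam U ^+ (s - m)) * T))).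
  by apply: ler_wpM2r => //; exact: mulr_ge0 (mulr_ge0 B0 (mulr_ge0 G0 hm0)) Tge0.
rewrite [leRHS](_ : _ = N * (B * (G * diam U ^+ (s - m)) * T) + diam U ^+ (s - m) * T); last by ring.
by rewrite lerDl mulr_ge0.
Qed.
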